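(* Let $E$ be a directed graph. Then $C^*(E)$ is liminal if and only if $E$ satisfies condition $(M)$.
   Context: A directed graph $E=(E^0,E^1,o,t)$ consists of countable sets $E^0$ (vertices) and $E^1$ (edges) and maps $o,t:E^1\to E^0$ (origin and terminus). A vertex is a sink if it is the origin of no edge; it is singular if it is a sink or emits infinitely many edges. A finite path is a sequence of edges $e_1\cdots e_n$ with $t(e_i)=o(e_{i+1})$, with $o(e_1\cdots e_n)=o(e_1)$, $t(e_1\cdots e_n)=t(e_n)$; a vertex $v$ is a path of length $0$ with $o(v)=t(v)=v$. $E^*$ is the set of finite paths. An infinite path is an infinite sequence $e_1e_2\cdots$ of edges with $t(e_i)=o(e_{i+1})$, with origin $o(e_1)$; $E^\infty$ is the set of infinite paths. $\Lambda^*$ is the set of finite paths (including those of length $0$) whose terminus is a singular vertex. $C^*(E)$ is the universal $C^*$-algebra generated by a Cuntz-Krieger $E$-family: mutually orthogonal projections $\{p_v:v\in E^0\}$ and partial isometries $\{s_e:e\in E^1\}$ with (i) $s_e^*s_e=p_{t(e)}$ for all $e\in E^1$; (ii) $\sum_{e\in F}s_es_e^*\le p_v$ for every $v\in E^0$ and every finite $F\subseteq\{e:o(e)=v\}$; (iii) $\sum_{o(e)=v}s_es_e^*=p_v$ for every non-singular $v$. Define $\sim$ on $E^\infty\cup\Lambda^*$: two infinite paths $e_1e_2\cdots$ and $f_1f_2\cdots$ are equivalent iff there are $j,k$ with $e_{j+r}=f_{k+r}$ for all $r\ge 0$; two finite paths $p,q$ are equivalent iff $t(p)=t(q)$; a finite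 path is never equivalent to an infinite one. Condition $(M)$: for every class $[p]\in(E^\infty\cup\Lambda^* )/\sim$ and every $v\in E^0$, the number of representatives $q$ of $[p]$ with $o(q)=v$ is finite. Liminal (CCR) means that the image of every irreducible representation consists of compact operators. *)

(* Defs.v *)
From HB Require Import structures.
From mathcomp Require Import all_boot all_order all_algebra.
From mathcomp Require Import sesquilinear complex.
From mathcomp Require Import all_classical all_reals all_analysis.
Set Implicit Arguments.
Unset Strict Implicit.
Unset Printing Implicit Defensive.
Import Order.TTheory GRing.Theory Num.Theory.
Import numFieldNormedType.Exports.
Local Open Scope classical_set_scope.
Local Open Scope complex_scope.
Local Open Scope ring_scope.

(** * C*-algebras *)

(* Not assumed unital: C*(E) has a unit only when E has finitely many
   vertices, so the multiplication is not that of a [pzRingType].  The norm of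
   a normed module over R[i] takes its values in R[i]. *)
HB.mixin Record CompleteNormedModule_isCStarAlgebra (R : realType) A
    & CompleteNormedModule R[i] A := {
  cmul : A -> A -> A;
  cstar : A -> A;
  cmulA : forall x y z, cmul x (cmul y z) = cmul (cmul x y) z;
  cmul_linearl : forall (c : R[i]) x y z,
    cmul (c *: x + y) z = c *: cmul x z + cmul y z;
  cmul_linearr : forall (c : R[i]) x y z,
    cmul x (c *: y + z) = c *: cmul x y + cmul x z;
  cstarK : forall x, cstar (cstar x) = x;
  cstar_antilinear : forall (c : R[i]) x y,
    cstar (c *: x + y) = Num.conj c *: cstar x + cstar y;
  cstarM : forall x y, cstar (cmul x y) = cmul (cstar y) (cstar x);
  cnormM : forall x y, `|cmul x y| <= `|x| * `|y|;
  cnorm_star_mul : forall x, `|cmul (cstar x) x| = `|x| ^+ 2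
}.

#[short(type="cstarAlgType")]
HB.structure Definition CStarAlgebra (R : realType) :=
  {A of CompleteNormedModule R[i] A
      & CompleteNormedModule_isCStarAlgebra R A}.

Definition cpositive (R : realType) (A : cstarAlgType R) (a : A) : Prop :=
  exists b : A, a = cmul (cstar b) b.

Definition cle (R : realType) (A : cstarAlgType R) (a b : A) : Prop :=
  cpositive (b - a).

Record star_hom (R : realType) (A B : cstarAlgType R) (f : A -> B) : Prop := {
  star_hom_linear : forall (c : R[i]) x y, f (c *: x + y) = c *: f x + f y;
  star_homM : forall x y, f (cmul x y) = cmul (f x) (f y);
  star_hom_star : forall x, f (cstar x) = cstar (f x)
}.

Record cstar_subalgebra (R : realType) (A : cstarAlgType R) (S : set A) :
    Prop := {
  cstar_subalgebra_closed : closed S;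
  cstar_subalgebra0 : S 0;
  cstar_subalgebra_linear : forall (c : R[i]) x y,
    S x -> S y -> S (c *: x + y);
  cstar_subalgebraM : forall x y, S x -> S y -> S (cmul x y);
  cstar_subalgebra_star : forall x, S x -> S (cstar x)
}.

(** * Representations on Hilbert spaces *)

(* The inner product is linear in its first argument and conjugate-linear in
   the second. *)
HB.mixin Record CompleteNormedModule_isHilbert (R : realType) H
    & CompleteNormedModule R[i] H := {
  inner : {dot H for (@Num.conj R[i])};
  inner_norm : forall x : H, `|x| ^+ 2 = inner x x
}.

#[short(type="hilbertType")]
HB.structure Definition Hilbert (R : realType) :=
  {H of CompleteNormedModule R[i] H & CompleteNormedModule_isHilbert R H}.

(* A *-homomorphism from A to the bounded operators on H. *)
Record representation (R : realType) (A : cstarAlgType R) (H : hilbertType R)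
    (pi : A -> {linear H -> H}) : Prop := {
  repr_bounded : forall a, continuous (pi a);
  repr_linear : forall (c : R[i]) a b x,
    pi (c *: a + b) x = c *: pi a x + pi b x;
  reprM : forall a b x, pi (cmul a b) x = pi a (pi b x);
  repr_star : forall a x y, inner (pi (cstar a) x) y = inner x (pi a y)
}.

Definition irreducible (R : realType) (A : cstarAlgType R) (H : hilbertType R)
    (pi : A -> {linear H -> H}) : Prop :=
  (exists a x, pi a x != 0) /\
  forall V : set H, closed V -> V 0 ->
    (forall (c : R[i]) x y, V x -> V y -> V (c *: x + y)) ->
    (forall a x, V x -> V (pi a x)) ->
    V = [set 0] \/ V = setT.

Definition compact_operator (R : realType) (H : hilbertType R) (T : H -> H) :
    Prop :=
  precompact (T @` [set x | `|x| <= 1]).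

Definition liminal (R : realType) (A : cstarAlgType R) : Prop :=
  forall (H : hilbertType R) (pi : A -> {linear H -> H}),
    representation pi -> irreducible pi -> forall a, compact_operator (pi a).

(** * Directed graphs and their C*-algebras *)

(* A [countType] may be finite, or empty. *)
Record digraph := Digraph {
  vertex : countType;
  edge : countType;
  origin : edge -> vertex;
  terminus : edge -> vertex
}.

Definition emits (E : digraph) (v : vertex E) : set (edge E) :=
  [set e | origin e = v].

Definition sink (E : digraph) (v : vertex E) : Prop := emits v = set0.

Definition singular (E : digraph) (v : vertex E) : Prop :=
  sink v \/ infinite_set (emits v).

Record CK_family (R : realType) (E : digraph) (A : cstarAlgType R)
    (p : vertex E -> A) (s : edge E -> A) : Prop := {
  CK_proj : forall v, cmul (p v) (p v) = p v /\ cstar (p v) = p v;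
  CK_orth : forall v w, v != w -> cmul (p v) (p w) = 0;
  CK_partial_isometry : forall e, cmul (cmul (s e) (cstar (s e))) (s e) = s e;
  CK_source : forall e, cmul (cstar (s e)) (s e) = p (terminus e);
  CK_le : forall v (F : set (edge E)), finite_set F -> F `<=` emits v ->
    cle (\sum_(e \in F) cmul (s e) (cstar (s e))) (p v);
  CK_sum : forall v, ~ singular v ->
    \sum_(e \in emits v) cmul (s e) (cstar (s e)) = p v
}.

(* The pair (A, (p, s)) is C*(E) with its canonical generators; it is thereby
   determined up to a unique isomorphism, as [graph_algebra_generated] makes
   the homomorphism of [graph_algebra_universal] unique. *)
Record graph_algebra (R : realType) (E : digraph) (A : cstarAlgType R)
    (p : vertex E -> A) (s : edge E -> A) : Prop := {
  graph_algebra_CK : CK_family p s;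
  graph_algebra_generated : forall S : set A, cstar_subalgebra S ->
    (forall v, S (p v)) -> (forall e, S (s e)) -> S = setT;
  graph_algebra_universal : forall (B : cstarAlgType R)
      (q : vertex E -> B) (t : edge E -> B), CK_family q t ->
    exists2 f : A -> B, star_hom f &
      (forall v, f (p v) = q v) /\ (forall e, f (s e) = t e)
}.

(** * Condition (M) *)

Fixpoint walk (E : digraph) (v : vertex E) (s : seq (edge E)) : bool :=
  if s is e :: s' then (origin e == v) && walk (terminus e) s' else true.

(* The edges are recorded together with the origin, so that the path of length
   0 at v is the pair (v, [::]); for a nonempty list of edges, [walk] forces
   the origin to be that of the first edge. *)
Record fpath (E : digraph) := FPath {
  fpath_origin : vertex E;
  fpath_edges : seq (edge E);
  fpath_walk : walk fpath_origin fpath_edges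
}.

Definition fpath_terminus (E : digraph) (p : fpath E) : vertex E :=
  last (fpath_origin p) (map (@terminus E) (fpath_edges p)).

Record ipath (E : digraph) := IPath {
  ipath_edge : nat -> edge E;
  ipath_walk : forall n,
    terminus (ipath_edge n) = origin (ipath_edge n.+1)
}.

Variant boundary_path (E : digraph) :=
| Infinite of ipath E
| Finite (p : fpath E) of singular (fpath_terminus p).

Definition boundary_origin (E : digraph) (x : boundary_path E) : vertex E :=
  match x with
  | Infinite p => origin (ipath_edge p 0%N)
  | Finite p _ => fpath_origin p
  end.

Definition boundary_equiv (E : digraph) (x y : boundary_path E) : Prop :=
  match x, y with
  | Infinite p, Infinite q =>
      exists j k, forall r, ipath_edge p (j + r)%N = ipath_edge q (k + r)%N
  | Finite p _, Finite q _ => fpath_terminus p = fpath_terminus q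
  | _, _ => False
  end.

Definition condition_M (E : digraph) : Prop :=
  forall (x : boundary_path E) (v : vertex E),
    finite_set [set y | boundary_equiv x y /\ boundary_origin y = v].

(* Main.v *)
(* For [liminal A -> condition_M E]: the boundary paths equivalent to a fixed x
   form the orthonormal basis of a Hilbert space on which C*(E) acts by
   prepending edges.  The diagonal projections in the image separate basis
   vectors and the generators permute them, so this representation is
   irreducible; it sends p_v to the projection onto the basis vectors starting
   at v, which is compact only if there are finitely many of them.

   For the converse, let C*(E) act irreducibly.  If from every vertex v with
   p_v <> 0 two incomparable paths led to a common such vertex, an infinite path
   through these vertices would have infinitely many tail-equivalent variants
   with the same origin, against (M).  Hence at some vertex w all paths leading
   to a common vertex are comparable; either they are equal, or w can be moved to
   a cycle, which by (M) has no exit.  In both cases the operators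
   s_m s_n^* with m, n starting at w commute, and irreducibility makes the range
   of p_w a line.  That line follows a single boundary path x from w, and the
   range of p_v is spanned by vectors which depend, up to scalars, only on a path
   that starts at v and is equivalent to x.  By (M) there are finitely many, so
   p_v has finite rank, and compactness propagates to all of C*(E). *)
Require Import Defs.
From HB Require Import structures.
From mathcomp Require Import all_boot all_order all_algebra.
From mathcomp Require Import sesquilinear complex finmap ring lra.
From mathcomp Require Import all_classical all_reals all_analysis.
Set Implicit Arguments.
Unset Strict Implicit.
Unset Printing Implicit Defensive.
Import Order.TTheory GRing.Theory Num.Theory.
Import numFieldNormedType.Exports.
Local Open Scope classical_set_scope.
Local Open Scope complex_scope.
Local Open Scope ring_scope.

(** * Real norms and completeness *)

(** C*(E) is available only through its generators and its universal property, and a representation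
    is merely a family of continuous operators. Two facts must therefore come before the generators
    can be exploited: representations are contractive, so that closed conditions pass from
    generators to all of C*(E), and a Schur lemma holds for commuting families. Both are derived,
    without spectral theory, from one convergent iteration for 1 - sqrt (1 - a). In the converse,
    attention is restricted to [good] vertices, those with p_v non-zero in the representation at
    hand: a path ending elsewhere acts as 0, so comparability is asked only of paths with a good
    terminus. Once the range of p_w is a line, its spanning vector is pushed along the adjoints of
    the edges. Either it reaches a vertex where all of them kill it, which the sum relation forces
    to be singular, or it goes on forever and traces an infinite path. These are the two kinds of
    boundary path. *)

Section RealNorm.
Variables (R : realType) (V : normedModType R[i]).
Implicit Types (x y : V) (S : set V).

Definition rnorm x : R := complex.Re `|x|.

Lemma normE x : `|x| = (rnorm x)%:C.
Proof. by rewrite RRe_real// realE normr_ge0. Qed.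

Lemma rnorm_ge0 x : 0 <= rnorm x.
Proof. by have := normr_ge0 x; rewrite normE lecR. Qed.

Lemma rnorm0 : rnorm 0 = 0. Proof. by rewrite /rnorm normr0. Qed.

Lemma rnorm_eq0 x : (rnorm x == 0) = (x == 0).
Proof. by rewrite -[RHS]normr_eq0 normE (inj_eq (@complexI R) _ 0). Qed.

Lemma rnormN x : rnorm (- x) = rnorm x.
Proof. by rewrite /rnorm normrN. Qed.

Lemma rnormD x y : rnorm (x + y) <= rnorm x + rnorm y.
Proof. by have := ler_normD x y; rewrite !normE -rmorphD lecR. Qed.

Lemma rnormB x y : rnorm (x - y) <= rnorm x + rnorm y.
Proof. by rewrite (le_trans (rnormD _ _))// rnormN. Qed.

Lemma rnormC x y : rnorm (x - y) = rnorm (y - x).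
Proof. by rewrite -rnormN opprB. Qed.

Lemma rnorm_tri x y z : rnorm (x - z) <= rnorm (x - y) + rnorm (y - z).
Proof. by rewrite -[X in rnorm X](subrKA y) rnormD. Qed.

Lemma rnormZ (c : R[i]) x : rnorm (c *: x) = complex.Re `|c| * rnorm x.
Proof.
apply: (@complexI R); rewrite -normE normrZ normE rmorphM/=.
by rewrite (RRe_real (normr_real _)).
Qed.

Lemma rnormZr (c : R) x : rnorm (c%:C *: x) = `|c| * rnorm x.
Proof. by rewrite rnormZ normc_def/= expr0n addr0 sqrtr_sqr. Qed.

Lemma closure_rnormP S x :
  closure S x <-> forall e : R, 0 < e -> exists2 y, S y & rnorm (x - y) < e.
Proof.
split=> [Sx e e0|H B].
  have /Sx[y [Sy]] : nbhs x (ball x e%:C).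
    by apply: nbhsx_ballx; rewrite ltcR.
  by rewrite -ball_normE /ball_/= normE ltcR; exists y.
move=> /nbhs_ballP[e /= e0 eB].
have e1 : e = (complex.Re e)%:C by rewrite RRe_real// gtr0_real.
have [|y Sy xy] := H (complex.Re e); first by rewrite -ltcR -e1.
exists y; split=> //; apply: eB.
by rewrite -ball_normE /ball_/= normE e1 ltcR.
Qed.

Lemma closed_rnormP S :
  closed S <->
  forall x, (forall e : R, 0 < e -> exists2 y, S y & rnorm (x - y) < e) -> S x.
Proof.
by split=> H x; [move/closure_rnormP/H|move/closure_rnormP; apply: H].
Qed.

Definition rcauchy (u : nat -> V) := forall e : R, 0 < e ->
  exists N, forall m n, (N <= m)%N -> (N <= n)%N -> rnorm (u m - u n) < e.

Definition rcvg (u : nat -> V) (l : V) := forall e : R, 0 < e ->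
  exists N, forall n, (N <= n)%N -> rnorm (u n - l) < e.

Lemma rcvg_unique u l l' : rcvg u l -> rcvg u l' -> l = l'.
Proof.
move=> ul ul'; apply/eqP; rewrite -subr_eq0 -rnorm_eq0 eq_le rnorm_ge0 andbT.
apply/ler_addgt0Pr => e e0; rewrite add0r.
have e2 : 0 < e / 2 by rewrite divr_gt0.
have [N1 H1] := ul _ e2; have [N2 H2] := ul' _ e2.
have h1 := H1 _ (leq_maxl N1 N2); have h2 := H2 _ (leq_maxr N1 N2).
have := rnorm_tri l (u (maxn N1 N2)) l'; rewrite (rnormC l (u _)).
by move: h1 h2; lra.
Qed.

Lemma rcvg_shift u l k : rcvg u l -> rcvg (fun n => u (n + k)%N) l.
Proof.
by move=> ul e /ul[N H]; exists N => n Nn; apply: H; rewrite (leq_trans Nn)// leq_addr.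
Qed.

Lemma rcvg_le u l (M : R) : rcvg u l -> (forall n, rnorm (u n) <= M) -> rnorm l <= M.
Proof.
move=> ul uM; apply/ler_addgt0Pr => e /ul[N /(_ N (leqnn _)) h].
have := rnormB (u N) (u N - l); rewrite opprB addrC subrK.
by move: (uM N) h; lra.
Qed.

(** Serves the completeness instances of [bop] and [ell2], where limits are built for sequences. A
    Cauchy filter contains balls of radius 1/(n+1); any choice of their centres is a Cauchy
    sequence, and its limit is the limit of the filter. *)
Lemma rcauchy_complete :
  (forall u, rcauchy u -> exists l, rcvg u l) ->
  forall F : set_system V, ProperFilter F -> cauchy F -> cvg F.
Proof.
move=> H F FF /cauchyP cF.
have /choice[c cP] : forall n : nat, exists x, F (ball x (n.+1%:R^-1)%:C : set V).
  by move=> n; apply: cF; rewrite ltcR invr_gt0 ltr0n.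
have cc m n : rnorm (c m - c n) < m.+1%:R^-1 + n.+1%:R^-1.
  have [z []] := filter_ex (filterI (cP m) (cP n)).
  rewrite -!ball_normE /ball_/= !normE !ltcR => h1 h2.
  have := rnorm_tri (c m) z (c n); rewrite (rnormC z (c n)) => /le_lt_trans; apply; exact: ltrD.
have small (e : R) : 0 < e -> exists N, forall n, (N <= n)%N -> n.+1%:R^-1 < e :> R.
  move=> e0; exists (Num.bound e^-1) => n Nn; rewrite invf_plt ?posrE ?ltr0n//.
  rewrite (lt_le_trans (archi_boundP _))// ?invr_ge0 ?(ltW e0)//.
  by rewrite ler_nat (leq_trans Nn).
have [u|l cl] := H c.
  move=> u0; have [|N HN] := small (u / 2); first by rewrite divr_gt0.
  exists N => m n /HN h1 /HN h2; by rewrite (lt_trans (cc m n))// [ltRHS]splitr ltrD.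
apply: (cvgP l); apply/fcvg_ballP => e e0.
have eE : e = (complex.Re e)%:C by rewrite RRe_real// gtr0_real.
have e0' : 0 < complex.Re e / 2 by rewrite divr_gt0// -ltcR -eE.
have [N1 H1] := small _ e0'; have [N2 H2] := cl _ e0'.
have h1 := H1 _ (leq_maxl N1 N2); have h2 := H2 _ (leq_maxr N1 N2).
move: (cP (maxn N1 N2)); apply: filterS => z.
rewrite -!ball_normE /ball_/= !normE eE !ltcR => h3.
have := rnorm_tri l (c (maxn N1 N2)) z; rewrite (rnormC l (c _)) => /le_lt_trans; apply.
by rewrite [ltRHS]splitr ltrD// (lt_trans h3).
Qed.

End RealNorm.

Lemma rcauchy_cvg (R : realType) (V : completeNormedModType R[i]) (u : nat -> V) :
  rcauchy u -> exists l, rcvg u l.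
Proof.
move=> uc.
have /cvg_ex[l ul] : cvg (u @ \oo).
  apply/cauchy_cvgP/cauchyP => e e0.
  have eE : e = (complex.Re e)%:C by rewrite RRe_real// gtr0_real.
  have [|N H] := uc (complex.Re e); first by rewrite -ltcR -eE.
  exists (u N); exists N => // n /= Nn.
  by rewrite -ball_normE /ball_/= normE eE ltcR H.
exists l => e e0; have /cvg_ballP/(_ e%:C) := ul.
rewrite ltcR => /(_ e0)[N _ H]; exists N => n /H.
by rewrite /= -ball_normE /ball_/= normE ltcR rnormC.
Qed.

Section TotallyBounded.
Variable (R : realType).

Definition tbounded (V : normedModType R[i]) (S : set V) := forall e : R, 0 < e ->
  exists l : seq V, forall x, S x -> exists2 y, y \in l & rnorm (x - y) < e.

(** An ultrafilter on the closure of [S] must contain one of the finitely many [e]-balls around a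
    finite net: otherwise it would contain all their complements, which leave no point of the
    closure. Hence it is Cauchy. *)
Lemma tbounded_precompact (V : completeNormedModType R[i]) (S : set V) :
  tbounded S -> precompact S.
Proof.
move=> tb; rewrite precompactE compact_ultra => F FU FS.
have PF : ProperFilter F by exact: ultra_proper.
suff /cvg_ex[l Fl] : cvg F.
  exists l; split=> //.
  apply: (@closed_closure _ S); rewrite closureEcvg; exists F => //.
  by split=> // B SB; exact: filterS SB FS.
apply/cauchy_cvgP/cauchyP => e e0.
have eE : e = (complex.Re e)%:C by rewrite RRe_real// gtr0_real.
have e0' : 0 < complex.Re e / 2 by rewrite divr_gt0// -ltcR -eE.
have [l lP] := tb _ e0'.
apply: contrapT => nF.
have : F (closure S `&` \bigcap_(y in [set` l]) ~` ball y e).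
  apply: filterI => //; rewrite bigcap_seq; elim: l {lP} => [|y l IH].
    by rewrite big_nil; exact: filterT.
  rewrite big_cons; apply: filterI => //.
  by have [h|//] := in_ultra_setVsetC (ball y e) FU; case: nF; exists y.
move=> /filter_ex[z [/closure_rnormP/(_ _ e0')[t St zt] zl]].
have [y yl ty] := lP _ St; apply: (zl y yl).
rewrite -ball_normE /ball_/= normE eE ltcR rnormC.
have := rnorm_tri z t y; move: zt ty; lra.
Qed.

End TotallyBounded.

(** The scalars are general because the result is applied to real segments as well as to spaces over
    [R[i]]. *)
Lemma compact_tbounded (K : numFieldType) (V : normedModType K) (S : set V) (e : K) :
  compact S -> 0 < e -> exists l : seq V, forall x, S x -> exists2 y, y \in l & `|x - y| < e.
Proof.
move=> cS e0.
have : cover_compact S by rewrite -compact_cover.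
move=> /(_ V S (fun x => (ball x e)^°))[||D _ DS].
- by move=> x _; exact: open_interior.
- move=> x Sx; exists x => //=; rewrite /interior; exact: nbhsx_ballx.
exists (enum_fset D) => x /DS[y /= yD /interior_subset].
by rewrite -ball_normE /ball_/= => h; exists y => //; rewrite distrC.
Qed.

Lemma precompact_tbounded (R : realType) (V : normedModType R[i]) (S : set V) :
  precompact S -> tbounded S.
Proof.
rewrite precompactE => cS e e0.
have [|l lP] := compact_tbounded (e := e%:C) cS; first by rewrite ltcR.
exists l => x /(@subset_closure _ S)/lP[y yl]; rewrite normE ltcR => h.
by exists y.
Qed.

(** * Inner products *)

Section Scalars.
Variable R : realType.
Implicit Types c d : R[i].

Definition cmod c : R := complex.Re `|c|.

Lemma cmodE c : `|c| = (cmod c)%:C.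
Proof. by rewrite RRe_real// realE normr_ge0. Qed.

Lemma cmod_ge0 c : 0 <= cmod c.
Proof. by rewrite -lecR -cmodE normr_ge0. Qed.

Lemma cmodM c d : cmod (c * d) = cmod c * cmod d.
Proof. by apply: (@complexI R); rewrite -cmodE normrM !cmodE rmorphM. Qed.

Lemma cmodD c d : cmod (c + d) <= cmod c + cmod d.
Proof. by rewrite -lecR rmorphD/= -!cmodE ler_normD. Qed.

Lemma cmodN c : cmod (- c) = cmod c.
Proof. by rewrite /cmod normrN. Qed.

Lemma cmodR (a : R) : cmod a%:C = `|a|.
Proof. by rewrite /cmod normc_def/= expr0n addr0 sqrtr_sqr. Qed.

Lemma cmod0 : cmod 0 = 0. Proof. by rewrite /cmod normr0. Qed.

Lemma cmod1 : cmod 1 = 1. Proof. by rewrite /cmod normr1. Qed.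

Lemma cmod_eq0 c : (cmod c == 0) = (c == 0).
Proof. by rewrite -[RHS]normr_eq0 cmodE (inj_eq (@complexI R) _ 0). Qed.

Lemma cmod_conj c : cmod (Num.conj c) = cmod c.
Proof. by rewrite /cmod norm_conjC. Qed.

Lemma cmodK c : c * Num.conj c = (cmod c ^+ 2)%:C.
Proof. by rewrite -normCK cmodE rmorphXn. Qed.

Lemma Re_le_cmod c : `|complex.Re c| <= cmod c.
Proof. by have := normc_ge_Re c; rewrite cmodE lecR. Qed.

Lemma conjCE c : Num.conj c = (c^*)%C. Proof. by []. Qed.

Lemma Re_conj c : complex.Re (Num.conj c) = complex.Re c.
Proof. by case: c. Qed.

Lemma conjR (a : R) : Num.conj a%:C = a%:C.
Proof. by rewrite conjCE conjc_real. Qed.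

End Scalars.

Section InnerProduct.
Variables (R : realType) (H : hilbertType R).
Implicit Types (x y z : H) (c : R[i]).

Lemma innerDl x y z : inner (x + y) z = inner x z + inner y z.
Proof. exact: linearDl. Qed.

Lemma innerDr x y z : inner x (y + z) = inner x y + inner x z.
Proof. exact: linearDr. Qed.

Lemma innerZl c x y : inner (c *: x) y = c * inner x y.
Proof. exact: linearZl_LR. Qed.

Lemma innerZr c x y : inner x (c *: y) = Num.conj c * inner x y.
Proof. exact: linearZr_LR. Qed.

Lemma innerNl x y : inner (- x) y = - inner x y.
Proof. exact: linearNl. Qed.

Lemma innerNr x y : inner x (- y) = - inner x y.
Proof. exact: linearNr. Qed.

Lemma innerBl x y z : inner (x - y) z = inner x z - inner y z.
Proof. by rewrite innerDl innerNl. Qed.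

Lemma innerBr x y z : inner x (y - z) = inner x y - inner x z.
Proof. by rewrite innerDr innerNr. Qed.

Lemma inner0l x : inner 0 x = 0. Proof. exact: linear0l. Qed.

Lemma inner0r x : inner x 0 = 0. Proof. exact: linear0r. Qed.

Lemma innerC x y : inner x y = Num.conj (inner y x).
Proof. by rewrite hermC/= expr0 mul1r. Qed.

Lemma innerxx x : inner x x = (rnorm x ^+ 2)%:C.
Proof. by rewrite -inner_norm normE rmorphXn. Qed.

Lemma Re_innerxx x : complex.Re (inner x x) = rnorm x ^+ 2.
Proof. by rewrite innerxx. Qed.

Lemma inner_eq0 x : (forall y, inner x y = 0) -> x = 0.
Proof.
move=> /(_ x); rewrite innerxx => /(@complexI R)/eqP.
by rewrite sqrf_eq0 rnorm_eq0 => /eqP.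
Qed.

Lemma inner_inj x y : (forall z, inner x z = inner y z) -> x = y.
Proof.
move=> h; apply/eqP; rewrite -subr_eq0; apply/eqP/inner_eq0 => z.
by rewrite innerBl h subrr.
Qed.

Lemma rnormD_sqr x y :
  rnorm (x + y) ^+ 2 = rnorm x ^+ 2 + rnorm y ^+ 2 + 2 * complex.Re (inner x y).
Proof.
rewrite -!Re_innerxx innerDl !innerDr (innerC y x) !raddfD/= Re_conj.
ring.
Qed.

Lemma rnormB_sqr x y :
  rnorm (x - y) ^+ 2 = rnorm x ^+ 2 + rnorm y ^+ 2 - 2 * complex.Re (inner x y).
Proof. by rewrite rnormD_sqr rnormN innerNr raddfN/= mulrN. Qed.

Lemma cauchy_schwarz x y : cmod (inner x y) <= rnorm x * rnorm y.
Proof.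
have [->|y0] := eqVneq y 0; first by rewrite inner0r cmod0 rnorm0 mulr0.
have ny : 0 < rnorm y by rewrite lt_def rnorm_ge0 rnorm_eq0 y0.
rewrite -(ler_pXn2r (ltn0Sn 1)) ?nnegrE ?cmod_ge0 ?mulr_ge0 ?rnorm_ge0//.
(* [a *: y] is the projection of [x] onto the line of [y]; the inequality is the non-negativity of
   the squared distance to it. *)
pose a := ((rnorm y ^+ 2)^-1)%:C * inner x y.
have := sqr_ge0 (rnorm (x - a *: y)).
have conja : Num.conj a = ((rnorm y ^+ 2)^-1)%:C * Num.conj (inner x y).
  by rewrite /a rmorphM/= conjR.
rewrite rnormB_sqr rnormZ -/(cmod a) innerZr conja -mulrA [_ * inner _ _]mulrC.
rewrite cmodK -rmorphM/= cmodM cmodR.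
set n := rnorm y; set m := cmod _; set k := rnorm x.
rewrite ger0_norm ?invr_ge0 ?sqr_ge0//.
have -> : k ^+ 2 + ((n ^+ 2)^-1 * m * n) ^+ 2 - 2 * ((n ^+ 2)^-1 * m ^+ 2) = k ^+ 2 - m ^+ 2 / n ^+ 2.
  by field; rewrite gt_eqF.
by rewrite subr_ge0 ler_pdivrMr ?exprn_gt0// exprMn.
Qed.

End InnerProduct.

(** * The C*-algebra of adjointable bounded operators *)

Section AdjointableOperators.
Variables (R : realType) (H : hilbertType R).
Implicit Types (x y : H) (c : R[i]) (f g : H -> H).

Definition rbounded f (M : R) := forall x, rnorm (f x) <= M * rnorm x.

Definition adjoint_of f g := forall x y, inner (g x) y = inner x (f y).

(** Linearity follows from having an adjoint ([bop_linearP]), so the operators form a submodule of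
    the functions [H -> H]. Asking for the adjoint outright bypasses the Riesz representation
    theorem. *)
Definition adjointable : {pred H -> H} := fun f =>
  `[< (exists M, rbounded f M) /\ exists g, adjoint_of f g >].

Lemma adjoint_of_sym f g : adjoint_of f g -> adjoint_of g f.
Proof. by move=> fg x y; rewrite innerC -fg -innerC. Qed.

(** Cauchy-Schwarz gives |g x|^2 = <x, f (g x)> <= |x| M |g x|, and |g x| cancels unless it is 0. *)
Lemma rbounded_adjoint f g M : adjoint_of f g -> rbounded f M -> rbounded g M.
Proof.
move=> fg fM x.
have [g0|g0] := eqVneq (g x) 0.
  rewrite g0 rnorm0.
  have [->|x0] := eqVneq x 0; first by rewrite rnorm0 mulr0.
  have h := le_trans (rnorm_ge0 _) (fM x).
  by rewrite h.
rewrite -(ler_pM2r (x := rnorm (g x))) ?lt_def ?rnorm_ge0 ?rnorm_eq0 ?g0//.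
rewrite -expr2 -Re_innerxx fg (le_trans (ler_norm _))//.
rewrite (le_trans (Re_le_cmod _))// (le_trans (cauchy_schwarz _ _))//.
by rewrite mulrAC mulrC ler_wpM2r ?rnorm_ge0.
Qed.

Fact adjointable_submod_closed : submod_closed adjointable.
Proof.
split.
  apply/asboolP; split; first by exists 0 => x; rewrite rnorm0 mul0r.
  by exists 0 => x y; rewrite inner0l inner0r.
move=> c f g /asboolP[[M fM] [f' ff']] /asboolP[[N gN] [g' gg']]; apply/asboolP; split.
  exists (cmod c * M + N) => x.
  rewrite (le_trans (rnormD _ _))// rnormZ mulrDl lerD// -mulrA.
  by rewrite ler_wpM2l ?cmod_ge0.
exists (Num.conj c *: f' + g') => x y.
by rewrite innerDl innerDr innerZl innerZr ff' gg'.
Qed.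

HB.instance Definition _ := GRing.isSubmodClosed.Build _ _ adjointable
  adjointable_submod_closed.

Record bop := Bop { bop_fun :> H -> H; _ : bop_fun \in adjointable }.

HB.instance Definition _ := [isSub for bop_fun].
HB.instance Definition _ := [Choice of bop by <:].
HB.instance Definition _ := [SubChoice_isSubLmodule of bop by <:].

Implicit Types S T U : bop.

Lemma bopP T : (exists M, rbounded T M) /\ exists g, adjoint_of T g.
Proof. by case: T => f /= /asboolP. Qed.

Lemma bop_eqP S T : S =1 T -> S = T.
Proof. by move=> ST; apply/val_inj/funext. Qed.
Lemma bopDE S T x : (S + T) x = S x + T x. Proof. by []. Qed.
Lemma bopNE T x : (- T) x = - T x. Proof. by []. Qed.
Lemma bopBE S T x : (S - T) x = S x - T x. Proof. by []. Qed.
Lemma bopZE c T x : (c *: T) x = c *: T x. Proof. by []. Qed.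

Lemma bop_linearP T c x y : T (c *: x + y) = c *: T x + T y.
Proof.
have [_ [g Tg]] := bopP T; apply: inner_inj => z.
by rewrite innerDl innerZl !(adjoint_of_sym Tg) innerDl innerZl.
Qed.

Lemma bopD T x y : T (x + y) = T x + T y.
Proof. by have := bop_linearP T 1 x y; rewrite !scale1r. Qed.

Lemma bop0 T : T 0 = 0.
Proof. by apply: (addrI (T 0)); rewrite -bopD !addr0. Qed.

Lemma bopZ T c x : T (c *: x) = c *: T x.
Proof. by rewrite -[c *: x]addr0 bop_linearP bop0 addr0. Qed.

Lemma bopN T x : T (- x) = - T x.
Proof. by rewrite -scaleN1r bopZ scaleN1r. Qed.

Lemma bopB T x y : T (x - y) = T x - T y.
Proof. by rewrite bopD bopN. Qed.

(** On the zero space every real number is a bound; the condition [0 <= M] keeps the set bounded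
    below there. *)
Definition opnorm T : R := inf [set M | 0 <= M /\ rbounded T M].

Lemma rbounded_nonneg f M : rbounded f M -> exists2 N, 0 <= N & rbounded f N.
Proof.
move=> fM; exists (Num.max 0 M); first by rewrite le_max lexx.
by move=> x; rewrite (le_trans (fM x))// ler_wpM2r ?rnorm_ge0// le_max lexx orbT.
Qed.

Let opnorm_has_inf T : has_inf [set M | 0 <= M /\ rbounded T M].
Proof.
have [[M /rbounded_nonneg[N N0 TN]] _] := bopP T; split; first by exists N.
by exists 0 => ? [].
Qed.

Lemma opnorm_ge0 T : 0 <= opnorm T.
Proof. by apply: lb_le_inf; [case: (opnorm_has_inf T)|move=> ? []]. Qed.

Lemma opnormP T : rbounded T (opnorm T).
Proof.
move=> x; have [->|x0] := eqVneq x 0; first by rewrite bop0 rnorm0 mulr0.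
have nx : 0 < rnorm x by rewrite lt_def rnorm_ge0 rnorm_eq0 x0.
rewrite -ler_pdivrMr//; apply: lb_le_inf; first by case: (opnorm_has_inf T).
by move=> M [_ TM]; rewrite ler_pdivrMr.
Qed.

Lemma opnorm_le T M : 0 <= M -> rbounded T M -> opnorm T <= M.
Proof. by move=> M0 TM; apply: ge_inf => //; case: (opnorm_has_inf T). Qed.

Fact opnormD S T : (opnorm (S + T))%:C <= (opnorm S)%:C + (opnorm T)%:C.
Proof.
rewrite -rmorphD lecR; apply: opnorm_le; first by rewrite addr_ge0 ?opnorm_ge0.
by move=> x; rewrite (le_trans (rnormD _ _))// mulrDl lerD ?opnormP.
Qed.

Let opnormZ_le c T : opnorm (c *: T) <= cmod c * opnorm T.
Proof.
apply: opnorm_le; first by rewrite mulr_ge0 ?cmod_ge0 ?opnorm_ge0.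
by move=> x; rewrite rnormZ -mulrA ler_wpM2l ?cmod_ge0 ?opnormP.
Qed.

Fact opnormZ c T : (opnorm (c *: T))%:C = `|c| * (opnorm T)%:C.
Proof.
rewrite cmodE -rmorphM; congr (_%:C); apply/eqP; rewrite eq_le opnormZ_le/=.
have [->|c0] := eqVneq c 0; first by rewrite cmod0 mul0r opnorm_ge0.
have c1 : 0 < cmod c by rewrite lt_def cmod_ge0 cmod_eq0 c0.
rewrite mulrC -ler_pdivlMr// mulrC -[in leLHS](scalerK c0 T).
rewrite (le_trans (opnormZ_le _ _))// ler_wpM2r ?opnorm_ge0//.
rewrite -(ler_pM2l c1) -cmodM mulfV// cmod1 mulfV//.
by rewrite cmod_eq0.
Qed.

Fact opnorm_eq0 T : (opnorm T)%:C = 0 -> T = 0.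
Proof.
move=> /(@complexI R) T0; apply: bop_eqP => x; apply/eqP.
by rewrite -rnorm_eq0 eq_le rnorm_ge0 andbT (le_trans (opnormP _ _))// T0 mul0r.
Qed.

HB.instance Definition _ :=
  Lmodule_isNormed.Build R[i] bop opnormD opnormZ opnorm_eq0.

Lemma rnorm_bop T : rnorm T = opnorm T. Proof. by []. Qed.

(** The operators and their adjoints converge pointwise, the latter because an adjoint obeys the
    same bounds. The two pointwise limits are adjoint to each other, which makes the limit an
    element of [bop]. *)
Fact bop_rcauchy (u : nat -> bop) : rcauchy u -> exists l, rcvg u l.
Proof.
move=> uc.
have uxc x : rcauchy (fun n => u n x).
  move=> e e0; have e1 : 0 < e / (rnorm x + 1).
    by rewrite divr_gt0// ltr_wpDl ?rnorm_ge0.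
  have [N uN] := uc _ e1; exists N => m n Nm Nn.
  rewrite -bopBE (le_lt_trans (opnormP _ _))//.
  have := uN _ _ Nm Nn; rewrite rnorm_bop.
  rewrite ltr_pdivlMr ?ltr_wpDl ?rnorm_ge0// => /le_lt_trans; apply.
  by rewrite ler_wpM2l ?opnorm_ge0// lerDl.
have /choice[f fP] x := rcauchy_cvg (uxc x).
have /choice[v vP] n := (bopP (u n)).2.
have vxc x : rcauchy (fun n => v n x).
  move=> e e0; have e1 : 0 < e / (rnorm x + 1).
    by rewrite divr_gt0// ltr_wpDl ?rnorm_ge0.
  have [N uN] := uc _ e1; exists N => m n Nm Nn.
  have adj : adjoint_of (u m - u n) (v m - v n).
    by move=> y z; rewrite innerBl bopBE innerBr !vP.
  have := rbounded_adjoint adj (@opnormP _) x.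
  move=> /le_lt_trans; apply.
  have := uN _ _ Nm Nn; rewrite rnorm_bop.
  rewrite ltr_pdivlMr ?ltr_wpDl ?rnorm_ge0// => /le_lt_trans; apply.
  by rewrite ler_wpM2l ?opnorm_ge0// lerDl.
have /choice[g gP] x := rcauchy_cvg (vxc x).
have fg : adjoint_of f g.
  move=> x y; apply/eqP; rewrite -subr_eq0 -cmod_eq0 eq_le cmod_ge0 andbT.
  apply/ler_addgt0Pr => e e0; rewrite add0r.
  have e1 : 0 < e / (rnorm x + rnorm y + 1).
    by rewrite divr_gt0// ltr_wpDl ?addr_ge0 ?rnorm_ge0.
  have [N1 h1] := fP y _ e1; have [N2 h2] := gP x _ e1.
  set N := maxn N1 N2.
  have {}h1 := h1 N (leq_maxl _ _); have {}h2 := h2 N (leq_maxr _ _).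
  have -> : inner (g x) y - inner x (f y) =
      inner (g x - v N x) y + inner x (u N y - f y).
    by rewrite innerBl innerBr vP addrA subrK.
  rewrite (le_trans (cmodD _ _))//.
  rewrite (le_trans (lerD (cauchy_schwarz _ _) (cauchy_schwarz _ _)))//.
  rewrite rnormC.
  set a := rnorm (v N x - g x) in h2 *; set b := rnorm (u N y - f y) in h1 *.
  set d := rnorm x + rnorm y + 1 in e1 h1 h2 *.
  have d0 : 0 < d by rewrite ltr_wpDl ?addr_ge0 ?rnorm_ge0.
  have -> : e = e / d * rnorm y + rnorm x * (e / d) + e / d.
    by rewrite -[LHS](divfK (lt0r_neq0 d0)); set q := e / d; rewrite /d; ring.
  rewrite -[leLHS]addr0 lerD//; last exact: ltW.
  by rewrite lerD// ?ler_wpM2r ?ler_wpM2l ?rnorm_ge0// ltW.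
(* Uniformity in [x]: the auxiliary index [N'] depends on [x], but it is used only to compare with
   the limit and does not enter the bound. *)
have fbnd e : 0 < e -> exists N, forall n, (N <= n)%N -> forall x, rnorm (u n x - f x) <= e * rnorm x.
  move=> e0; have [N uN] := uc _ e0; exists N => n Nn x.
  apply/ler_addgt0Pr => d d0.
  have [N' h] := fP x _ d0; have {}h := h _ (leq_maxr N N').
  rewrite (le_trans (rnorm_tri _ (u (maxn N N') x) _))// lerD//; last exact: ltW.
  rewrite -bopBE (le_trans (opnormP _ _))// ler_wpM2r ?rnorm_ge0// -rnorm_bop.
  by rewrite ltW// uN// leq_max leqnn.
have fadj : f \in adjointable.
  apply/asboolP; split; last by exists g.
  have [N /(_ _ (leqnn _)) uN] := fbnd 1 ltr01.
  exists (opnorm (u N) + 1) => x.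
  have := rnormB (u N x) (u N x - f x); rewrite opprB addrC subrK => /le_trans; apply.
  by rewrite mulrDl lerD// opnormP.
exists (Bop fadj) => e e0; have e2 : 0 < e / 2 by rewrite divr_gt0.
have [N uN] := fbnd _ e2; exists N => n Nn; rewrite rnorm_bop.
rewrite (@le_lt_trans _ _ (e / 2))//; last lra.
by apply: opnorm_le => [|x]; [rewrite ltW|rewrite bopBE uN].
Qed.

HB.instance Definition _ :=
  Uniform_isComplete.Build bop (rcauchy_complete bop_rcauchy).

Fact bop_comp_subproof S T : S \o T \in adjointable.
Proof.
have [[M SM] [S' SS']] := bopP S; have [[N TN] [T' TT']] := bopP T.
have [M' M'0 {}SM] := rbounded_nonneg SM.
apply/asboolP; split; last by exists (T' \o S') => x y; rewrite TT' SS'.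
exists (M' * N) => x; rewrite /= (le_trans (SM _))// -mulrA.
by rewrite ler_wpM2l.
Qed.

Definition bop_comp S T : bop := Bop (bop_comp_subproof S T).

Fact bop_adj_subproof T : sval (cid (bopP T).2) \in adjointable.
Proof.
case: cid => g /= Tg; have [[M TM] _] := bopP T; apply/asboolP; split.
  by exists M; apply: rbounded_adjoint TM.
by exists T; apply: adjoint_of_sym.
Qed.

Definition bop_adj T : bop := Bop (bop_adj_subproof T).

Lemma bop_adjP T x y : inner (bop_adj T x) y = inner x (T y).
Proof. by rewrite /bop_adj/=; case: cid => g /= ->. Qed.

Lemma bop_adjPr T x y : inner (T x) y = inner x (bop_adj T y).
Proof. by rewrite innerC -bop_adjP -innerC. Qed.

Lemma bop_adj_unique S T : adjoint_of S T -> bop_adj S = T.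
Proof. by move=> ST; apply: bop_eqP => x; apply: inner_inj => y; rewrite bop_adjP ST. Qed.

Lemma bop_adjK : involutive bop_adj.
Proof. by move=> T; apply/bop_adj_unique/adjoint_of_sym => x y; rewrite bop_adjP. Qed.

Lemma opnormM S T : opnorm (bop_comp S T) <= opnorm S * opnorm T.
Proof.
apply: opnorm_le; first by rewrite mulr_ge0 ?opnorm_ge0.
by move=> x; rewrite (le_trans (@opnormP S _))// -mulrA ler_wpM2l ?opnorm_ge0 ?opnormP.
Qed.

Lemma opnorm_adj T : opnorm (bop_adj T) <= opnorm T.
Proof.
apply: opnorm_le; first exact: opnorm_ge0.
by apply: (rbounded_adjoint _ (@opnormP T)) => x y; rewrite bop_adjP.
Qed.

(** For the lower bound, |T x|^2 = <T^* T x, x> shows that the square root of the norm of T^* T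
    bounds [T]. *)
Lemma opnorm_adj_comp T : opnorm (bop_comp (bop_adj T) T) = opnorm T ^+ 2.
Proof.
apply/eqP; rewrite eq_le; apply/andP; split.
  rewrite (le_trans (opnormM _ _))// expr2 ler_wpM2r ?opnorm_ge0//.
  exact: opnorm_adj.
set q := opnorm (bop_comp _ _); have q0 : 0 <= q by exact: opnorm_ge0.
rewrite -[leRHS]sqr_sqrtr// (ler_pXn2r (ltn0Sn 1)) ?nnegrE ?opnorm_ge0 ?sqrtr_ge0//.
apply: opnorm_le; first exact: sqrtr_ge0.
move=> x; rewrite -(ler_pXn2r (ltn0Sn 1)) ?nnegrE ?mulr_ge0 ?rnorm_ge0 ?sqrtr_ge0//.
rewrite exprMn sqr_sqrtr// -Re_innerxx -bop_adjP.
rewrite (le_trans (ler_norm _))// (le_trans (Re_le_cmod _))//.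
rewrite (le_trans (cauchy_schwarz _ _))// expr2 mulrA ler_wpM2r ?rnorm_ge0//.
exact: (@opnormP (bop_comp (bop_adj T) T) x).
Qed.

Fact bop_compA S T U : bop_comp S (bop_comp T U) = bop_comp (bop_comp S T) U.
Proof. exact: bop_eqP. Qed.

Fact bop_comp_linearl c S T U :
  bop_comp (c *: S + T) U = c *: bop_comp S U + bop_comp T U.
Proof. exact: bop_eqP. Qed.

Fact bop_comp_linearr c S T U :
  bop_comp S (c *: T + U) = c *: bop_comp S T + bop_comp S U.
Proof. by apply: bop_eqP => x; rewrite /= bop_linearP. Qed.

Fact bop_adj_antilinear c S T :
  bop_adj (c *: S + T) = Num.conj c *: bop_adj S + bop_adj T.
Proof.
apply: bop_adj_unique => x y.
by rewrite innerDl innerZl !bop_adjP bopDE innerDr bopZE innerZr.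
Qed.

Fact bop_adjM S T : bop_adj (bop_comp S T) = bop_comp (bop_adj T) (bop_adj S).
Proof. by apply: bop_adj_unique => x y /=; rewrite !bop_adjP. Qed.

Fact bop_normM S T : `|bop_comp S T| <= `|S| * `|T|.
Proof. by rewrite !normE -rmorphM lecR opnormM. Qed.

Fact bop_norm_star_mul T : `|bop_comp (bop_adj T) T| = `|T| ^+ 2.
Proof. by rewrite !normE -rmorphXn rnorm_bop opnorm_adj_comp. Qed.

HB.instance Definition _ := CompleteNormedModule_isCStarAlgebra.Build R bop
  bop_compA bop_comp_linearl bop_comp_linearr bop_adjK bop_adj_antilinear
  bop_adjM bop_normM bop_norm_star_mul.

End AdjointableOperators.

(** * Square roots and contractivity of representations *)

Section CStarAlgebraTheory.
Variables (R : realType) (A : cstarAlgType R).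
Implicit Types (x y z a b : A) (c : R[i]).

Lemma cmulDl x y z : cmul (x + y) z = cmul x z + cmul y z.
Proof. by have := cmul_linearl 1 x y z; rewrite !scale1r. Qed.

Lemma cmulDr x y z : cmul x (y + z) = cmul x y + cmul x z.
Proof. by have := cmul_linearr 1 x y z; rewrite !scale1r. Qed.

Lemma cmul0l z : cmul 0 z = 0 :> A.
Proof. by apply: (addrI (cmul 0 z)); rewrite -cmulDl !addr0. Qed.

Lemma cmul0r z : cmul z 0 = 0 :> A.
Proof. by apply: (addrI (cmul z 0)); rewrite -cmulDr !addr0. Qed.

Lemma cmulZl c x z : cmul (c *: x) z = c *: cmul x z.
Proof. by rewrite -[c *: x]addr0 cmul_linearl cmul0l addr0. Qed.

Lemma cmulZr c x z : cmul x (c *: z) = c *: cmul x z.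
Proof. by rewrite -[c *: z]addr0 cmul_linearr cmul0r addr0. Qed.

Lemma cmulNl x z : cmul (- x) z = - cmul x z.
Proof. by rewrite -scaleN1r cmulZl scaleN1r. Qed.

Lemma cmulNr x z : cmul x (- z) = - cmul x z.
Proof. by rewrite -scaleN1r cmulZr scaleN1r. Qed.

Lemma cmulBl x y z : cmul (x - y) z = cmul x z - cmul y z.
Proof. by rewrite cmulDl cmulNl. Qed.

Lemma cmulBr x y z : cmul x (y - z) = cmul x y - cmul x z.
Proof. by rewrite cmulDr cmulNr. Qed.

Lemma cstarD x y : cstar (x + y) = cstar x + cstar y.
Proof. by have := cstar_antilinear 1 x y; rewrite rmorph1 !scale1r. Qed.

Lemma cstar0 : cstar 0 = 0 :> A.
Proof. by apply: (addrI (cstar 0)); rewrite -cstarD !addr0. Qed.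

Lemma cstarZ c x : cstar (c *: x) = Num.conj c *: cstar x.
Proof. by rewrite -[c *: x]addr0 cstar_antilinear cstar0 addr0. Qed.

Lemma cstarN x : cstar (- x) = - cstar x.
Proof. by rewrite -scaleN1r cstarZ rmorphN rmorph1 scaleN1r. Qed.

Lemma cstarB x y : cstar (x - y) = cstar x - cstar y.
Proof. by rewrite cstarD cstarN. Qed.

Lemma rnorm_cmul x y : rnorm (cmul x y) <= rnorm x * rnorm y.
Proof. by have := cnormM x y; rewrite !normE -rmorphM lecR. Qed.

Lemma rnorm_star_mul x : rnorm (cmul (cstar x) x) = rnorm x ^+ 2.
Proof.
by apply: (@complexI R); rewrite -normE cnorm_star_mul normE rmorphXn.
Qed.

Lemma rnorm_star_le x : rnorm x <= rnorm (cstar x).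
Proof.
have [->|x0] := eqVneq x 0; first by rewrite rnorm0 rnorm_ge0.
rewrite -(ler_pM2r (x := rnorm x)) ?lt_def ?rnorm_ge0 ?rnorm_eq0 ?x0//.
by rewrite -expr2 -rnorm_star_mul rnorm_cmul.
Qed.

Lemma rnorm_star x : rnorm (cstar x) = rnorm x.
Proof.
by apply/eqP; rewrite eq_le rnorm_star_le -{2}[x]cstarK rnorm_star_le.
Qed.

Lemma rcvg_star (u : nat -> A) l : rcvg u l -> rcvg (fun n => cstar (u n)) (cstar l).
Proof.
by move=> ul e /ul[N h]; exists N => n /h; rewrite -cstarB rnorm_star.
Qed.

Lemma rcvg_mull (u : nat -> A) l b :
  rcvg u l -> rcvg (fun n => cmul b (u n)) (cmul b l).
Proof.
move=> ul e e0; have b1 : 0 < rnorm b + 1 by rewrite ltr_wpDl ?rnorm_ge0.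
have [|N h] := ul (e / (rnorm b + 1)); first by rewrite divr_gt0.
exists N => n /h; rewrite ltr_pdivlMr// -cmulBr => /(le_lt_trans _); apply.
by rewrite (le_trans (rnorm_cmul _ _))// mulrC ler_wpM2l ?rnorm_ge0// lerDl.
Qed.

Lemma rcvg_mulr (u : nat -> A) l b :
  rcvg u l -> rcvg (fun n => cmul (u n) b) (cmul l b).
Proof.
move=> /rcvg_star/(@rcvg_mull _ _ (cstar b))/rcvg_star; rewrite cstarM !cstarK.
by congr (rcvg _ _); apply/funext => n; rewrite cstarM !cstarK.
Qed.

(* The scalar iteration t = (1 + t ^ 2) / 2 dominates the norms of the
   increments of y = (a + y ^ 2) / 2, whose limit is 1 - sqrt (1 - a). *)
Fixpoint sqrt_majorant (n : nat) : R :=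
  if n is n'.+1 then 2^-1 * (1 + sqrt_majorant n' ^+ 2) else 0.

Fixpoint sqrt_iter a (n : nat) : A :=
  if n is n'.+1 then
    (2^-1)%:C *: (a + cmul (sqrt_iter a n') (sqrt_iter a n'))
  else 0.

Let t := sqrt_majorant.

Let t_bounds n : 0 <= t n <= 1.
Proof.
elim: n => [|n /andP[t0 t1]]; first by rewrite lexx ler01.
have := sqr_ge0 (t n); have : t n ^+ 2 <= 1 by rewrite expr_le1.
by rewrite -/(t _) /=; rewrite -/(t n); move=> h1 h2; apply/andP; split; lra.
Qed.

Let iter_norm a n : rnorm a <= 1 -> rnorm (sqrt_iter a n) <= t n.
Proof.
move=> a1; elim: n => [|n IH]; first by rewrite /= rnorm0.
rewrite /= rnormZr ger0_norm ?invr_ge0// -/(t n) ler_wpM2l ?invr_ge0//.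
rewrite (le_trans (rnormD _ _))// lerD// (le_trans (rnorm_cmul _ _))//.
by rewrite expr2 ler_pM// rnorm_ge0.
Qed.

Let iter_step a n : rnorm a <= 1 ->
  rnorm (sqrt_iter a n.+1 - sqrt_iter a n) <= t n.+1 - t n.
Proof.
move=> a1; elim: n => [|n IH].
  rewrite [sqrt_iter a 0]/= subr0 subr0; exact: iter_norm.
have -> : t n.+2 - t n.+1 = 2^-1 * ((t n.+1 + t n) * (t n.+1 - t n)).
  have -> : t n.+2 = 2^-1 * (1 + t n.+1 ^+ 2) by [].
  have -> : t n.+1 - t n = 2^-1 * (1 + t n ^+ 2) - t n by [].
  have -> : t n.+1 = 2^-1 * (1 + t n ^+ 2) by [].
  by ring.
have -> : sqrt_iter a n.+2 - sqrt_iter a n.+1 = (2^-1)%:C *: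
    (cmul (sqrt_iter a n.+1) (sqrt_iter a n.+1 - sqrt_iter a n) +
     cmul (sqrt_iter a n.+1 - sqrt_iter a n) (sqrt_iter a n)).
  rewrite [in RHS]cmulBr [in RHS]cmulBl subrKA.
  rewrite [sqrt_iter a n.+2]/= {2}[sqrt_iter a n.+1]/= -scalerBr -/(sqrt_iter a n.+1).
  by rewrite [in LHS]opprD addrACA subrr add0r.
rewrite rnormZr ger0_norm ?invr_ge0// ler_wpM2l ?invr_ge0//.
rewrite (le_trans (rnormD _ _))// mulrDl lerD//.
  rewrite (le_trans (rnorm_cmul _ _))// ler_pM ?rnorm_ge0//; exact: iter_norm.
rewrite (le_trans (rnorm_cmul _ _))// mulrC ler_pM ?rnorm_ge0//; exact: iter_norm.
Qed.

Let iter_dist a m n : rnorm a <= 1 -> (m <= n)%N ->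
  rnorm (sqrt_iter a n - sqrt_iter a m) <= t n - t m.
Proof.
move=> a1 /subnK <-; elim: (n - m)%N => [|k IH].
  by rewrite !add0n !subrr rnorm0.
rewrite addSn (le_trans (rnorm_tri _ (sqrt_iter a (k + m)) _))//.
have := iter_step (k + m) a1; move: IH; lra.
Qed.

Let t_cauchy (e : R) : 0 < e -> exists N, forall n, (N <= n)%N -> t n - t N < e.
Proof.
move=> e0; have hs : has_sup (range t).
  split; first by exists (t 0%N), 0%N.
  by exists 1 => _ [n _ <-]; case/andP: (t_bounds n).
have [_ [N _ <-] h] := sup_adherent e0 hs.
exists N => n _; have : t n <= sup (range t) by apply: ub_le_sup; [case: hs|exists n].
by move: h; lra.
Qed.

(** The equation for [y] is (1 - y)^2 = 1 - a written without the unit, which [A] may lack.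
    Self-adjointness and commutation hold for every iterate and survive in the limit. *)
Lemma csqrt_exists a : rnorm a <= 1 -> exists y,
  [/\ cmul y y = y + y - a, rnorm y <= 1, cstar a = a -> cstar y = y
    & forall b, cmul a b = cmul b a -> cmul y b = cmul b y].
Proof.
move=> a1.
have [e e0|y yP] := @rcauchy_cvg _ _ (sqrt_iter a).
  have [|N h] := t_cauchy (e := e / 2); first by rewrite divr_gt0.
  exists N => m n Nm Nn.
  rewrite (le_lt_trans (rnorm_tri _ (sqrt_iter a N) _))// (rnormC (sqrt_iter a N)).
  by rewrite [ltRHS]splitr ltrD// (le_lt_trans (iter_dist a1 _))// h.
have y1 : rnorm y <= 1.
  apply: rcvg_le yP _ => n; rewrite (le_trans (iter_norm _ a1))//.
  by case/andP: (t_bounds n).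
exists y; split=> //.
(* Passing to the limit in the recursion makes [y] a fixed point of it. *)
- have h : rcvg (fun n => sqrt_iter a n.+1) ((2^-1)%:C *: (a + cmul y y)).
    move=> e e0; have [N yN] := yP _ e0; exists N => n Nn.
    rewrite /= -scalerBr rnormZr ger0_norm ?invr_ge0//.
    rewrite opprD addrACA subrr add0r.
    set s := sqrt_iter a n.
    have -> : cmul s s - cmul y y = cmul s (s - y) + cmul (s - y) y.
      by rewrite cmulBr cmulBl subrKA.
    have sy := yN _ Nn; rewrite -/s in sy.
    have s1 : rnorm s <= 1.
      by rewrite (le_trans (iter_norm _ a1))//; case/andP: (t_bounds n).
    rewrite mulrC ltr_pdivrMr// mulr2n mulrDr mulr1.
    rewrite (le_lt_trans (rnormD _ _))// ltrD// (le_lt_trans _ sy)//.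
      by rewrite (le_trans (rnorm_cmul _ _))// ler_piMl ?rnorm_ge0.
    by rewrite (le_trans (rnorm_cmul _ _))// ler_piMr ?rnorm_ge0.
  have h' : rcvg (fun n => sqrt_iter a n.+1) y.
    have := rcvg_shift 1 yP; congr (rcvg _ _).
    by apply/funext => n; rewrite addn1.
  have {}h := rcvg_unique h' h.
  have -> : y + y = a + cmul y y.
    rewrite {1 2}h -scalerDl -rmorphD/= (_ : 2^-1 + 2^-1 = 1 :> R); last by field.
    by rewrite scale1r.
  by rewrite addrAC subrr add0r.
- move=> sa; apply: (rcvg_unique _ yP).
  have := rcvg_star yP; congr (rcvg _ _); apply/funext.
  elim=> [|n IH] /=; first by rewrite cstar0.
  by rewrite cstarZ conjR cstarD sa cstarM IH.
- move=> b ab; apply: (rcvg_unique (rcvg_mulr b yP)).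
  have := rcvg_mull b yP; congr (rcvg _ _); apply/funext.
  elim=> [|n IH] /=; first by rewrite cmul0l cmul0r.
  by rewrite cmulZr cmulZl cmulDl cmulDr ab cmulA IH -cmulA IH cmulA.
Qed.

End CStarAlgebraTheory.

Section Representations.
Variables (R : realType) (A : cstarAlgType R) (H : hilbertType R).
Variables (pi : A -> {linear H -> H}) (pi_rep : representation pi).

Lemma reprD a b x : pi (a + b) x = pi a x + pi b x.
Proof. by have := repr_linear pi_rep 1 a b x; rewrite !scale1r. Qed.

Lemma repr0 x : pi 0 x = 0.
Proof. by apply: (addrI (pi 0 x)); rewrite -reprD !addr0. Qed.

Lemma reprZ c a x : pi (c *: a) x = c *: pi a x.
Proof. by rewrite -[c *: a]addr0 (repr_linear pi_rep) repr0 addr0. Qed.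

Lemma reprN a x : pi (- a) x = - pi a x.
Proof. by rewrite -scaleN1r reprZ scaleN1r. Qed.

Lemma reprB a b x : pi (a - b) x = pi a x - pi b x.
Proof. by rewrite reprD reprN. Qed.

Lemma repr_adj a x y : inner (pi a x) y = inner x (pi (cstar a) y).
Proof. by rewrite -[in LHS](cstarK a) (repr_star pi_rep). Qed.

(* With [y = 1 - sqrt (1 - a ^ 2)] in [A], the operator [1 - pi a ^ 2] is the
   square of the self-adjoint [1 - pi y], hence positive. *)
Let contractive_sa1 a x : cstar a = a -> rnorm a <= 1 -> rnorm (pi a x) <= rnorm x.
Proof.
move=> sa a1.
have [|y [yy _ sy _]] := @csqrt_exists _ _ (cmul a a).
  by rewrite (le_trans (rnorm_cmul _ _))// mulr_ile1 ?rnorm_ge0.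
have {}sy : cstar y = y by apply: sy; rewrite cstarM sa.
have aa : cmul a a = y + y - cmul y y by rewrite yy opprB addrC subrK.
rewrite -(ler_pXn2r (ltn0Sn 1)) ?nnegrE ?rnorm_ge0// -Re_innerxx.
rewrite repr_adj sa -(reprM pi_rep) aa reprB reprD (reprM pi_rep).
rewrite innerBr innerDr -[X in inner x (pi X (pi y x))]sy -repr_adj innerxx.
have := rnormB_sqr x (pi y x); have := sqr_ge0 (rnorm (x - pi y x)).
rewrite !raddfB !raddfD/=; lra.
Qed.

Let contractive_sa a x : cstar a = a -> rnorm (pi a x) <= rnorm a * rnorm x.
Proof.
move=> sa; have [->|a0] := eqVneq a 0; first by rewrite repr0 !rnorm0 mul0r.
have na : 0 < rnorm a by rewrite lt_def rnorm_ge0 rnorm_eq0 a0.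
have := @contractive_sa1 ((rnorm a)^-1%:C *: a) x.
rewrite cstarZ conjR sa reprZ !rnormZr ger0_norm ?invr_ge0 ?rnorm_ge0//.
rewrite mulVf ?gt_eqF// => /(_ erefl (lexx _)).
by rewrite mulrC ler_pdivrMr// mulrC.
Qed.

(** Reduces to the self-adjoint element a^* a, whose norm is the square of that of [a]. It makes
    [pi] continuous in [a], so that invariance and compactness can be tested on the generators. *)
Lemma repr_contractive a x : rnorm (pi a x) <= rnorm a * rnorm x.
Proof.
rewrite -(ler_pXn2r (ltn0Sn 1)) ?nnegrE ?mulr_ge0 ?rnorm_ge0//.
rewrite -Re_innerxx repr_adj -(reprM pi_rep) (le_trans (ler_norm _))//.
rewrite (le_trans (Re_le_cmod _))// (le_trans (cauchy_schwarz _ _))//.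
rewrite exprMn [leRHS]mulrC [rnorm x ^+ 2]expr2 -mulrA ler_wpM2l ?rnorm_ge0//.
rewrite -rnorm_star_mul [leRHS]mulrC contractive_sa//.
by rewrite cstarM cstarK.
Qed.

Fact repr_bop_subproof a : (pi a : H -> H) \in adjointable (H := H).
Proof.
apply/asboolP; split; first by exists (rnorm a) => x; exact: repr_contractive.
by exists (pi (cstar a)) => x y; rewrite (repr_star pi_rep).
Qed.

Definition repr_bop a : bop H := Bop (repr_bop_subproof a).

End Representations.

(** * Irreducible commuting families of operators *)

Lemma ReZ (R : realType) (a : R) (c : R[i]) : complex.Re (a%:C * c) = a * complex.Re c.
Proof. by case: c => u v /=; rewrite mul0r subr0. Qed.

Lemma ReD (R : realType) (c d : R[i]) : complex.Re (c + d) = complex.Re c + complex.Re d.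
Proof. by case: c; case: d. Qed.

Lemma ReN (R : realType) (c : R[i]) : complex.Re (- c) = - complex.Re c.
Proof. by case: c. Qed.

Section CommutingOperators.
Variables (R : realType) (H : hilbertType R).
Implicit Types (S T D : bop H) (x y : H).

Definition bop_commute S T := forall x, S (T x) = T (S x).

Definition self_adjoint T := forall x y, inner (T x) y = inner x (T y).

Fact bop_id_subproof : idfun \in adjointable (H := H).
Proof.
by apply/asboolP; split; [exists 1 => x; rewrite mul1r|exists idfun].
Qed.

Definition bop_id : bop H := Bop bop_id_subproof.

(** With a = 1 - T^2 the limit of the iteration is y = 1 - |T|, so [D] is 1 - y. The element [a] is
    a contraction since |x - T^2 x|^2 = |x|^2 + |T^2 x|^2 - 2 |T x|^2, and [D] is positive since [y]
    is a contraction. *)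
Let contractive_abs T : self_adjoint T -> rnorm T <= 1 -> exists D,
  [/\ forall x, D (D x) = T (T x), forall x, 0 <= complex.Re (inner (D x) x)
    & forall S, bop_commute T S -> bop_commute D S].
Proof.
move=> Tsa T1.
pose a : bop H := bop_id - bop_comp T T.
have aE x : a x = x - T (T x) by [].
have [|y [yy y1 _ yC]] := @csqrt_exists _ _ a.
  apply: opnorm_le => // x.
  rewrite mul1r -(ler_pXn2r (ltn0Sn 1)) ?nnegrE ?rnorm_ge0// aE rnormB_sqr.
  rewrite -Tsa Re_innerxx.
  have : rnorm (T (T x)) ^+ 2 <= rnorm (T x) ^+ 2.
    rewrite ler_pXn2r ?nnegrE ?rnorm_ge0// (le_trans (@opnormP _ _ T _))//.
    by rewrite ler_piMl ?rnorm_ge0.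
  have := sqr_ge0 (rnorm (T x)); lra.
have yyE x : y (y x) = y x + y x - (x - T (T x)).
  by have /(congr1 (fun U : bop H => U x)) := yy.
exists (bop_id - y); split.
- move=> x; rewrite !bopBE !bopB yyE /= opprB addrACA -opprD.
  by rewrite [y x + y x - _]addrC addrA addrK opprB addrCA subrr addr0.
- move=> x; rewrite bopBE innerBl raddfB/= Re_innerxx subr_ge0.
  rewrite (le_trans (ler_norm _))// (le_trans (Re_le_cmod _))//.
  rewrite (le_trans (cauchy_schwarz _ _))// expr2 ler_wpM2r ?rnorm_ge0//.
  by rewrite (le_trans (@opnormP _ _ y _))// ler_piMl ?rnorm_ge0.
- move=> S TS x; have aS : cmul a S = cmul S a.
    apply: bop_eqP => z.
    by change (S z - T (T (S z)) = S (z - T (T z))); rewrite bopB !TS.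
  have /(congr1 (fun U : bop H => U x)) := yC _ aS.
  by rewrite /cmul/= => yS; change (S x - y (S x) = S (x - y x)); rewrite bopB yS.
Qed.

Lemma bop_abs T : self_adjoint T -> exists D,
  [/\ forall x, D (D x) = T (T x), forall x, 0 <= complex.Re (inner (D x) x)
    & forall S, bop_commute T S -> bop_commute D S].
Proof.
move=> Tsa; pose r := rnorm T + 1.
have r0 : 0 < r by rewrite ltr_wpDl ?rnorm_ge0.
have [||D [D2 D0 DC]] := @contractive_abs ((r^-1)%:C *: T).
- by move=> x y; rewrite !bopZE innerZl innerZr conjR Tsa.
- rewrite rnormZr ger0_norm ?invr_ge0 ?(ltW r0)// mulrC ler_pdivrMr// mul1r.
  by rewrite lerDl.
have rC : r%:C * (r^-1)%:C = 1 by rewrite -rmorphM/= mulfV ?gt_eqF.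
exists (r%:C *: D); split.
- move=> x; rewrite !bopZE bopZ D2 !bopZE bopZ !scalerA.
  by rewrite -!mulrA (mulrA r%:C (r^-1)%:C) rC mul1r rC scale1r.
- by move=> x; rewrite bopZE innerZl ReZ mulr_ge0// ltW.
- move=> S TS x; rewrite !bopZE bopZ (DC S)// => y.
  by rewrite !bopZE bopZ TS.
Qed.

Section Schur.
Variables (K : set H) (P : bop H).
Hypothesis KP : forall x, K x <-> P x = x.

Variable G : set (bop H).
Hypothesis GP : G P.
Hypothesis GC : forall S T, G S -> G T -> bop_commute S T.
(** Irreducibility on [K] phrased through kernels: it excludes zero divisors in the commutant
    restricted to [K], which takes the place of spectral projections. *)
Hypothesis G_irr : forall D, (forall S, G S -> bop_commute S D) ->
  (exists x, [/\ K x, x != 0 & D x = 0]) -> forall x, K x -> D x = 0.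

Let KD x y : K x -> K y -> K (x + y).
Proof. by move=> /KP Kx /KP Ky; apply/KP; rewrite bopD Kx Ky. Qed.

Let K_commute D x : (forall S, G S -> bop_commute S D) -> K x -> K (D x).
Proof. by move=> GD /KP Kx; apply/KP; rewrite GD// Kx. Qed.

(* For [D = |T|] we have [(D - T) (D + T) = 0], and on [K] a product in the
   commutant vanishes only if one of the factors does, so [T] has a sign on [K].
   Applied to all [T - l] this makes [T] scalar. *)
Let sa_dichotomy T : self_adjoint T -> (forall S, G S -> bop_commute S T) ->
  (forall x, K x -> 0 <= complex.Re (inner (T x) x)) \/
  (forall x, K x -> complex.Re (inner (T x) x) <= 0).
Proof.
move=> Tsa GT; have [D [D2 D0 DC]] := bop_abs Tsa.
have GD S : G S -> bop_commute S D.
  by move=> GS x; rewrite DC// => y; rewrite GT.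
have DT : bop_commute D T by apply: DC.
have [DT0|/existsNP[x /not_implyP[Kx /eqP Dx]]] := pselect (forall x, K x -> (D + T) x = 0).
  right=> x Kx; have -> : T x = - D x by apply/eqP; rewrite -addr_eq0 addrC -bopDE DT0.
  by rewrite innerNl raddfN/= oppr_le0.
left=> y Ky; suff -> : T y = D y by [].
apply/esym/eqP; rewrite -subr_eq0 -bopBE; apply/eqP.
apply: G_irr Ky => [S GS z|]; first by rewrite !bopBE bopB GD// GT.
exists ((D + T) x); split=> //.
  by apply: K_commute => // S GS z; rewrite !bopDE bopD GD// GT.
by rewrite bopBE !bopDE !bopD D2 DT [X in _ - X]addrC subrr.
Qed.

Let sa_scalar T : self_adjoint T -> (forall S, G S -> bop_commute S T) ->
  exists c : R[i], forall x, K x -> T x = c *: x.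
Proof.
move=> Tsa GT.
have [[x0 [Kx0 x00]]|K0] := pselect (exists x, K x /\ x != 0); last first.
  exists 0 => x Kx; rewrite scale0r; case: (eqVneq x 0) => [->|x0]; first exact: bop0.
  by case: K0; exists x.
pose q x := complex.Re (inner (T x) x).
(* The numbers [l] for which T - l is non-negative on [K]; their supremum will be the scalar. *)
pose L := [set l : R | forall x, K x -> l * rnorm x ^+ 2 <= q x].
have nx0 : 0 < rnorm x0 ^+ 2 by rewrite exprn_gt0// lt_def rnorm_ge0 rnorm_eq0 x00.
have q_abs x : `|q x| <= rnorm T * rnorm x ^+ 2.
  rewrite (le_trans (Re_le_cmod _))// (le_trans (cauchy_schwarz _ _))//.
  by rewrite expr2 mulrA ler_wpM2r ?rnorm_ge0// (@opnormP _ _ T).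
have Lsup : has_sup L.
  split.
    by exists (- rnorm T) => x _; have := q_abs x; rewrite ler_norml -mulNr => /andP[].
  exists (rnorm T) => l /(_ _ Kx0) h.
  rewrite -(ler_pM2r nx0) (le_trans h)// (le_trans (ler_norm _))//.
pose l0 := sup L.
have ge_l0 x : K x -> l0 * rnorm x ^+ 2 <= q x.
  move=> Kx; apply/ler_addgt0Pr => e e0.
  have n1 : 0 < rnorm x ^+ 2 + 1 by rewrite ltr_wpDl ?sqr_ge0.
  have [|l Ll hl] := @sup_adherent _ L (e / (rnorm x ^+ 2 + 1)) _ Lsup.
    by rewrite divr_gt0.
  have := Ll _ Kx; have := sqr_ge0 (rnorm x).
  have he : e / (rnorm x ^+ 2 + 1) * (rnorm x ^+ 2 + 1) = e by rewrite divfK ?gt_eqF.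
  have h1 : 0 <= (l - (l0 - e / (rnorm x ^+ 2 + 1))) * rnorm x ^+ 2.
    by rewrite mulr_ge0 ?sqr_ge0// subr_ge0 ltW.
  have h2 : 0 <= e / (rnorm x ^+ 2 + 1) by rewrite divr_ge0 ?ltW.
  move: he h1 h2; set d := e / _; set n := rnorm x ^+ 2; nra.
have le_l0 x : K x -> q x <= l0 * rnorm x ^+ 2.
  move=> Kx; apply/ler_addgt0Pr => e e0.
  have n1 : 0 < rnorm x ^+ 2 + 1 by rewrite ltr_wpDl ?sqr_ge0.
  pose d := e / (rnorm x ^+ 2 + 1).
  have d0 : 0 < d by rewrite divr_gt0.
  have he : d * (rnorm x ^+ 2 + 1) = e by rewrite divfK ?gt_eqF.
  have qE y : complex.Re (inner ((T - (l0 + d)%:C *: bop_id) y) y)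
      = q y - (l0 + d) * rnorm y ^+ 2.
    change (complex.Re (inner (T y - (l0 + d)%:C *: y) y) = q y - (l0 + d) * rnorm y ^+ 2).
    by rewrite innerBl raddfB/= innerZl ReZ Re_innerxx.
  have [||h|/(_ _ Kx)] := @sa_dichotomy (T - (l0 + d)%:C *: bop_id).
  - move=> y z; change (inner (T y - (l0 + d)%:C *: y) z = inner y (T z - (l0 + d)%:C *: z)).
    by rewrite innerBl innerBr Tsa innerZl innerZr conjR.
  - move=> S GS y; change (S (T y - (l0 + d)%:C *: y) = T (S y) - (l0 + d)%:C *: S y).
    by rewrite bopB bopZ GT.
  (* If T - (l0 + d) were non-negative on [K], then l0 + d would belong to [L], beyond its
     supremum. *)
  - have : l0 + d <= l0.
      apply: ub_le_sup; first by case: Lsup.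
      by move=> y /h; rewrite qE subr_ge0.
    by move: d0; lra.
  - rewrite qE; move: he d0; have := sqr_ge0 (rnorm x); nra.
exists l0%:C => x Kx.
pose X := T - l0%:C *: bop_id.
have XE y : X y = T y - l0%:C *: y by [].
have KX y : K y -> K (X y).
  by apply: K_commute => S GS z; rewrite !XE bopB bopZ GT.
have Xq y : K y -> complex.Re (inner (X y) y) = 0.
  move=> Ky; rewrite XE innerBl raddfB/= innerZl ReZ Re_innerxx.
  by apply/eqP; rewrite subr_eq0 eq_le le_l0// ge_l0.
(* The quadratic form of [X] vanishes on [K]. At x + X x only the two cross terms survive, and
   self-adjointness turns each into |X x|^2. *)
have := Xq _ (KD Kx (KX _ Kx)).
have expand (u v w z : H) : complex.Re (inner (u + v) (w + z)) =
    complex.Re (inner u w) + complex.Re (inner u z) +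
    (complex.Re (inner v w) + complex.Re (inner v z)).
  by rewrite innerDl !innerDr !ReD.
rewrite bopD expand (Xq x Kx) (Xq (X x) (KX _ Kx)).
have -> : inner (X (X x)) x = inner (X x) (X x).
  have Xsa : self_adjoint X.
    move=> y z; change (inner (T y - l0%:C *: y) z = inner y (T z - l0%:C *: z)).
    by rewrite innerBl innerBr Tsa innerZl innerZr conjR.
  exact: Xsa.
rewrite add0r addr0 Re_innerxx => /eqP.
by rewrite -mulr2n mulrn_eq0 sqrf_eq0 rnorm_eq0 subr_eq0 => /eqP.
Qed.

Hypothesis G_adj : forall S, G S -> G (bop_adj S).

Lemma commuting_scalar S : G S -> exists c : R[i], forall x, K x -> S x = c *: x.
Proof.
move=> GS; have GS' := G_adj GS.
have [||c cP] := @sa_scalar (S + bop_adj S).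
- by move=> x y; rewrite !bopDE innerDl innerDr bop_adjP addrC bop_adjPr.
- by move=> T GT x; rewrite !bopDE bopD !(GC GT).
have [||d dP] := @sa_scalar ('i *: (S - bop_adj S)).
- move=> x y; rewrite !bopZE innerZl innerZr !bopBE innerBl innerBr bop_adjP.
  by rewrite bop_adjPr conjCi mulNr -mulrN opprB.
- by move=> T GT x; rewrite !bopZE bopZ !bopBE bopB !(GC GT).
(* S is half of (S + S^* ) - i (i (S - S^* )), and the two self-adjoint parts act as [c] and [d]. *)
exists (2^-1 * (c - 'i * d)) => x Kx.
have := cP x Kx; have := dP x Kx; rewrite bopZE !bopDE bopNE => hd hc.
rewrite -scalerA scalerBl -scalerA -hd -hc scalerA -expr2 sqrCi scaleN1r opprK.
by rewrite addrACA subrr addr0 -mulr2n -[S x *+ 2]scaler_nat scalerA mulVf ?scale1r// pnatr_eq0.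
Qed.

End Schur.

End CommutingOperators.

(** * Compact operators and closed spans *)

Section CompactOperators.
Variables (R : realType) (H : hilbertType R).
Implicit Types (S T : H -> H) (x y z : H).

Definition tboperator T := tbounded (T @` [set x | rnorm x <= 1]).

Lemma tboperatorP T : tboperator T <-> forall e : R, 0 < e ->
  exists l : seq H, forall x, rnorm x <= 1 -> exists2 y, y \in l & rnorm (T x - y) < e.
Proof.
split=> h e /h[l lP]; exists l; first by move=> x x1; apply: lP; exists x.
by move=> _ [x x1 <-]; exact: lP.
Qed.

Lemma norm_le1 x : (`|x| <= 1) = (rnorm x <= 1).
Proof. by rewrite normE (lecR _ 1). Qed.

Lemma compact_operatorP T : compact_operator T <-> tboperator T.
Proof.
rewrite /compact_operator /tboperator.
have -> : [set x : H | `|x| <= 1] = [set x | rnorm x <= 1].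
  by apply/seteqP; split=> x /=; rewrite norm_le1.
split; first exact: precompact_tbounded.
exact: tbounded_precompact.
Qed.

Lemma tboperator0 : tboperator (fun=> 0).
Proof.
by apply/tboperatorP => e e0; exists [:: 0] => x _; exists 0; rewrite ?inE ?subrr ?rnorm0.
Qed.

Lemma tboperator_linear (c : R[i]) S T :
  tboperator S -> tboperator T -> tboperator (fun x => c *: S x + T x).
Proof.
move=> /tboperatorP St /tboperatorP Tt; apply/tboperatorP => e e0.
have c1 : 0 < cmod c + 1 by rewrite ltr_wpDl ?cmod_ge0.
have [|l lP] := St (e / 2 / (cmod c + 1)); first by rewrite !divr_gt0.
have [|m mP] := Tt (e / 2); first by rewrite divr_gt0.
exists [seq c *: a + b | a <- l, b <- m] => x x1.
have [a al xa] := lP x x1; have [b bm xb] := mP x x1.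
exists (c *: a + b); first by apply/allpairsP; exists (a, b).
rewrite opprD addrACA -scalerBr (le_lt_trans (rnormD _ _))// [ltRHS]splitr.
rewrite ler_ltD// rnormZ; move: xa; rewrite ltr_pdivlMr// => /ltW; apply: le_trans.
by rewrite mulrC ler_wpM2l ?rnorm_ge0// lerDl.
Qed.

Lemma tboperator_compl (T : bop H) S : tboperator S -> tboperator (T \o S).
Proof.
move=> /tboperatorP St; apply/tboperatorP => e e0.
have T1 : 0 < rnorm T + 1 by rewrite ltr_wpDl ?rnorm_ge0.
have [|l lP] := St (e / (rnorm T + 1)); first by rewrite divr_gt0.
exists (map T l) => x /lP[y yl]; rewrite ltr_pdivlMr// => xy.
exists (T y); first exact: map_f.
rewrite /= -bopB (le_lt_trans (@opnormP _ _ T _))// (le_lt_trans _ xy)//.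
by rewrite mulrC ler_wpM2l ?rnorm_ge0// lerDl.
Qed.

Lemma tboperator_compr (S T : bop H) : tboperator S -> tboperator (S \o T).
Proof.
move=> /tboperatorP St; apply/tboperatorP => e e0.
set M := rnorm T + 1.
have T1 : 0 < M by rewrite ltr_wpDl ?rnorm_ge0.
have [|l lP] := St (e / M); first by rewrite divr_gt0.
exists [seq M%:C *: y | y <- l] => x x1.
have [|y yl] := lP ((M^-1)%:C *: T x).
  rewrite rnormZr ger0_norm ?invr_ge0 ?(ltW T1)// ler_pdivrMl// mulr1.
  rewrite (le_trans (@opnormP _ _ T _))// (@le_trans _ _ (rnorm T))//.
    by rewrite ler_piMr ?opnorm_ge0.
  by rewrite lerDl.
exists (M%:C *: y); first exact: map_f.
have -> : (S \o T) x = M%:C *: S ((M^-1)%:C *: T x).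
  by rewrite bopZ scalerA -rmorphM/= mulfV ?gt_eqF// scale1r.
by rewrite -scalerBr rnormZr gtr0_norm// mulrC -ltr_pdivlMr.
Qed.

Lemma tboperator_lim S : (forall e : R, 0 < e -> exists2 T : H -> H, tboperator T &
    forall x, rnorm x <= 1 -> rnorm (S x - T x) < e) -> tboperator S.
Proof.
move=> h; apply/tboperatorP => e e0; have e2 : 0 < e / 2 by rewrite divr_gt0.
have [T /tboperatorP/(_ _ e2)[l lP] ST] := h _ e2.
exists l => x x1; have [y yl Ty] := lP _ x1; exists y => //.
by rewrite (le_lt_trans (rnorm_tri _ (T x) _))// [ltRHS]splitr ltrD ?ST.
Qed.

(** A finite net of the real segment, used for both the real and the imaginary part, gives a grid
    for the disc. The 2 in the mesh shares the error between the two parts, and the added 1 covers z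
    = 0. *)
Lemma tbounded_disc (M : R) z : tbounded [set c *: z | c in [set c : R[i] | cmod c <= M]].
Proof.
move=> e e0; have z1 : 0 < 2 * (rnorm z + 1) by rewrite mulr_gt0// ltr_wpDl ?rnorm_ge0.
have [||l lP] := @compact_tbounded R R `[- M, M]%classic (e / (2 * (rnorm z + 1))).
- exact: segment_compact.
- by rewrite divr_gt0.
exists [seq (a +i* b)%C *: z | a <- l, b <- l] => _ [c cM <-].
have [|a al ca] := lP (complex.Re c).
  by rewrite /= in_itv/= -ler_norml (le_trans (Re_le_cmod _)).
have Im_le : `|complex.Im c| <= cmod c.
  have -> : complex.Im c = complex.Re (- 'i%C * c).
    by case: c {cM ca} => u v /=; rewrite oppr0 mul0r mulN1r opprK add0r.
  rewrite (le_trans (Re_le_cmod _))// cmodM cmodN.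
  by rewrite /cmod complexiE normCi mul1r.
have [|b bl cb] := lP (complex.Im c).
  by rewrite /= in_itv/= -ler_norml (le_trans Im_le).
exists ((a +i* b)%C *: z); first by apply/allpairsP; exists (a, b).
rewrite -scalerBl rnormZ -/(cmod _).
have h : cmod (c - (a +i* b)%C) <= `|complex.Re c - a| + `|complex.Im c - b|.
  have -> : c - (a +i* b)%C = (complex.Re c - a)%:C + 'i%C * (complex.Im c - b)%:C.
    by rewrite [LHS]complexE; case: c {cM ca Im_le cb}.
  rewrite (le_trans (cmodD _ _))// cmodM !cmodR.
  by rewrite {1}/cmod complexiE normCi mul1r.
move: ca cb; rewrite !ltr_pdivlMr// => ca cb.
have := ler_wpM2r (rnorm_ge0 z) h => /le_lt_trans; apply.
have := normr_ge0 (complex.Re c - a); have := normr_ge0 (complex.Im c - b).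
have := rnorm_ge0 z; move: ca cb; nra.
Qed.

Lemma tboperator_rank1 y z : tboperator (fun x => inner x y *: z).
Proof.
move=> e /(@tbounded_disc (rnorm y) z)[l lP]; exists l => _ [x x1 <-].
apply: lP; exists (inner x y) => //=.
by rewrite (le_trans (cauchy_schwarz _ _))// ler_piMl ?rnorm_ge0.
Qed.

Lemma tboperator_sum (l : seq (H * H)) :
  tboperator (fun x => \sum_(yz <- l) inner x yz.1 *: yz.2).
Proof.
elim: l => [|[y z] l IH].
  by under eq_fun do rewrite big_nil; exact: tboperator0.
under eq_fun do rewrite big_cons -[X in X + _]scale1r.
by apply: tboperator_linear => //; exact: tboperator_rank1.
Qed.

Definition closed_subspace (V : set H) := [/\ closed V, V 0 &
  forall (c : R[i]) x y, V x -> V y -> V (c *: x + y)].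

Lemma subspaceZ (V : set H) (c : R[i]) x : closed_subspace V -> V x -> V (c *: x).
Proof. by move=> [_ V0 VL] Vx; rewrite -[c *: x]addr0; exact: VL. Qed.

(** The closed linear span as an intersection: a fact about the span is proved by exhibiting one
    closed subspace that contains the generators. *)
Definition cspan (G : set H) : set H :=
  [set x | forall V, closed_subspace V -> G `<=` V -> V x].

Lemma sub_cspan G : G `<=` cspan G.
Proof. by move=> x Gx V _; exact. Qed.

Lemma cspan_min G V : closed_subspace V -> G `<=` V -> cspan G `<=` V.
Proof. by move=> cV GV x; exact. Qed.

Lemma cspan_subspace G : closed_subspace (cspan G).
Proof.
split.
- apply/closed_rnormP => x h V cV GV; case: (cV) => /closed_rnormP clV _ _.
  by apply: clV => e /h[y Gy xy]; exists y => //; exact: Gy.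
- by move=> V [].
- by move=> c x y hx hy V cV GV; case: (cV) => _ _; apply; [exact: hx|exact: hy].
Qed.

Lemma cspan0 G : cspan G 0. Proof. by case: (cspan_subspace G). Qed.

Lemma zero_subspace : closed_subspace [set 0].
Proof.
split=> //; last by move=> c x y /= -> ->; rewrite scaler0 addr0.
apply/closed_rnormP => x h; apply/eqP; rewrite -rnorm_eq0 eq_le rnorm_ge0 andbT.
by apply/ler_addgt0Pr => e /h[_ ->]; rewrite subr0 add0r => /ltW.
Qed.

Lemma subspace_preimage (T : bop H) V : closed_subspace V -> closed_subspace (T @^-1` V).
Proof.
move=> [/closed_rnormP clV V0 VL]; split.
- apply/closed_rnormP => x h; apply: clV => e e0.
  have T1 : 0 < rnorm T + 1 by rewrite ltr_wpDl ?rnorm_ge0.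
  have [|y Vy] := h (e / (rnorm T + 1)); first by rewrite divr_gt0.
  rewrite ltr_pdivlMr// => xy; exists (T y) => //.
  rewrite -bopB (le_lt_trans (@opnormP _ _ T _))// (le_lt_trans _ xy)//.
  by rewrite mulrC ler_wpM2l ?rnorm_ge0// lerDl.
- by rewrite /= bop0.
- by move=> c x y /=; rewrite bopD bopZ; exact: VL.
Qed.

Lemma cspan_map (T : bop H) G G' : (forall x, G x -> cspan G' (T x)) ->
  forall x, cspan G x -> cspan G' (T x).
Proof. by move=> h; apply: (cspan_min (subspace_preimage T (cspan_subspace G'))). Qed.

Definition expansion (l : seq H) x : H := \sum_(e <- l) inner x e *: e.

Lemma expansion_adj l x y : inner (expansion l x) y = inner x (expansion l y).
Proof.
elim: l => [|e l IH]; first by rewrite /expansion !big_nil inner0l inner0r.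
rewrite /expansion !big_cons innerDl innerDr -/(expansion l x) -/(expansion l y) IH.
by rewrite innerZl innerZr -innerC mulrC.
Qed.

Lemma expansion_linear l (c : R[i]) x y :
  expansion l (c *: x + y) = c *: expansion l x + expansion l y.
Proof. by apply: inner_inj => z; rewrite expansion_adj !innerDl !innerZl !expansion_adj. Qed.

Lemma expansion0 l : expansion l 0 = 0.
Proof. by rewrite /expansion big1// => e _; rewrite inner0l scale0r. Qed.

Lemma expansionZ l (c : R[i]) x : expansion l (c *: x) = c *: expansion l x.
Proof. by rewrite -[c *: x]addr0 expansion_linear expansion0 addr0. Qed.

Lemma expansionD l x y : expansion l (x + y) = expansion l x + expansion l y.
Proof. by have := expansion_linear l 1 x y; rewrite !scale1r. Qed.

Lemma expansion_cons e l x : expansion (e :: l) x = inner x e *: e + expansion l x.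
Proof. by rewrite /expansion big_cons. Qed.

Fact expansion_adjointable l : expansion l \in adjointable (H := H).
Proof.
apply/asboolP; split; last by exists (expansion l) => x y; exact: expansion_adj.
elim: l => [|e l [M lM]].
  by exists 0 => x; rewrite /expansion big_nil rnorm0 mul0r.
exists (rnorm e * rnorm e + M) => x; rewrite expansion_cons mulrDl.
rewrite (le_trans (rnormD _ _))// lerD// rnormZ mulrAC ler_wpM2r ?rnorm_ge0//.
by rewrite mulrC (le_trans (cauchy_schwarz _ _))// mulrC.
Qed.

Definition expansion_bop l : bop H := Bop (expansion_adjointable l).

Lemma expansion_fixed_subspace l : closed_subspace [set x | expansion l x = x].
Proof.
have -> : [set x | expansion l x = x] = (expansion_bop l - bop_id H) @^-1` [set 0].
  apply/seteqP; split=> x xE.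
    by change (expansion l x - x = 0); rewrite xE subrr.
  have /eqP : expansion l x - x = 0 by exact: xE.
  by rewrite subr_eq0 => /eqP.
exact/subspace_preimage/zero_subspace.
Qed.

(* Fixing its own frame makes [expansion l'] a projection, so no orthonormality
   needs to be tracked. *)
Lemma gram_schmidt (l : seq H) : exists l',
  (forall e, e \in l' -> expansion l' e = e) /\ (forall x, x \in l -> expansion l' x = x).
Proof.
elim: l => [|a l [l' [l'P lP]]]; first by exists [::].
set Q := expansion l' in l'P lP.
have fixl k x : {subset k <= l'} -> Q (expansion k x) = expansion k x.
  elim: k => [|e k IH] ek; first by rewrite /Q [expansion [::] x]big_nil expansion0.
  rewrite expansion_cons /Q expansionD expansionZ -/Q l'P ?ek ?mem_head// IH// => i ik.
  by rewrite ek// inE ik orbT.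
have QQ x : Q (Q x) = Q x by exact: fixl.
pose r := a - Q a.
have ra : a = r + Q a by rewrite subrK.
have Qr : Q r = 0.
  by rewrite /r addrC -scaleN1r /Q expansion_linear -/Q QQ scaleN1r addNr.
have [r0|r0] := eqVneq r 0.
  exists l'; split=> // x; rewrite inE => /predU1P[->|/lP//].
  by rewrite -/Q {2}ra r0 add0r.
have nr : rnorm r != 0 by rewrite rnorm_eq0.
pose e0 := (rnorm r)^-1%:C *: r.
have Qe0 : Q e0 = 0 by rewrite /e0 /Q expansionZ -/Q Qr scaler0.
have fix0 x : Q x = x -> inner x e0 = 0.
  by move=> <-; rewrite expansion_adj -/Q Qe0 inner0r.
exists (e0 :: l'); split=> x; rewrite inE expansion_cons => /predU1P[->|xl].
- rewrite -/(Q _) Qe0 addr0 innerxx rnormZr ger0_norm ?invr_ge0 ?rnorm_ge0//.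
  by rewrite mulVf// expr1n scale1r.
- by rewrite -/(Q x) l'P// fix0 ?l'P// scale0r add0r.
- rewrite -/(Q a) {3}ra; congr (_ + _).
  rewrite {1}ra innerDl (fix0 (Q a))// addr0 /e0 innerZr conjR innerxx scalerA.
  rewrite -!rmorphM/= (_ : _ * _ * _ = 1) ?scale1r//.
  by field.
- by rewrite -/(Q x) lP// fix0 ?lP// scale0r add0r.
Qed.

(** Closed because the line is the fixed space of the projection onto its unit vector. *)
Lemma line_subspace h : closed_subspace [set x | exists c : R[i], x = c *: h].
Proof.
have [->|h0] := eqVneq h 0.
  have -> : [set x | exists c : R[i], x = c *: 0] = [set 0 : H].
    by apply/seteqP; split=> x /= => [[c ->]|->]; [|exists 0]; rewrite scaler0.
  exact: zero_subspace.
pose e := (rnorm h)^-1%:C *: h.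
have nh : rnorm h != 0 by rewrite rnorm_eq0.
have -> : [set x | exists c : R[i], x = c *: h] = [set x | expansion [:: e] x = x].
  apply/seteqP; split=> x /=; rewrite /expansion big_seq1.
    move=> [c ->]; rewrite innerZl innerZr conjR innerxx !scalerA.
    have nn : (rnorm h)^-1%:C * (rnorm h ^+ 2)%:C * (rnorm h)^-1%:C = 1.
      by rewrite -!rmorphM/= (_ : _ * _ * _ = 1)//; field.
    by rewrite -[in RHS](mulr1 c) -nn !mulrA.
  by move=> <-; exists (inner x e * (rnorm h)^-1%:C); rewrite -scalerA.
exact: expansion_fixed_subspace.
Qed.

(** Expanding T x in a frame of the finite span, with coefficients <T x, e> = <x, T^* e>, writes [T]
    as a finite sum of rank-one operators. *)
Lemma finite_rank_tboperator (T : bop H) (l : seq H) :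
  (forall x, cspan [set` l] (T x)) -> tboperator T.
Proof.
move=> TL; have [l' [_ lP]] := gram_schmidt l.
rewrite (_ : (T : H -> H) =
    fun x => \sum_(yz <- [seq (bop_adj T e, e) | e <- l']) inner x yz.1 *: yz.2).
  exact: tboperator_sum.
apply/funext => x.
rewrite big_map; under eq_bigr do rewrite /= -(adjoint_of_sym (@bop_adjP _ _ _)).
by symmetry; apply: (cspan_min (expansion_fixed_subspace l') _ (TL x)).
Qed.

End CompactOperators.

(** * Boundary paths *)

Section Paths.
Variable E : digraph.
Implicit Types (u v w : vertex E) (e f : edge E) (m n : seq (edge E)).

Definition wterm v m : vertex E := last v (map (@terminus E) m).

Lemma wterm_cat v m n : wterm v (m ++ n) = wterm (wterm v m) n.
Proof. by rewrite /wterm map_cat last_cat. Qed.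

Lemma wterm_cons v e m : wterm v (e :: m) = wterm (terminus e) m.
Proof. by []. Qed.

Lemma walk_cat v m n : walk v (m ++ n) = walk v m && walk (wterm v m) n.
Proof.
elim: m v => [|e m IH] v //=; rewrite IH wterm_cons andbA.
by [].
Qed.

End Paths.

Section InitialSegments.
Local Open Scope nat_scope.
Variable T : eqType.
Implicit Types (f : nat -> T) (m n : seq T).

Definition initial f m : Prop := m = mkseq f (size m).

Lemma initial_nth x0 f m i : initial f m -> (i < size m)%N -> nth x0 m i = f i.
Proof. by move=> fm im; rewrite fm nth_mkseq// -fm. Qed.

Lemma initial_prefix f m n : initial f m -> initial f n -> (size m <= size n)%N ->
  prefix m n.
Proof.
move=> fm fn mn; rewrite prefixE {1}fn {2}fm /mkseq -map_take take_iota.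
by rewrite (minn_idPl mn).
Qed.

Lemma initial_catl f m n : initial f (m ++ n) -> initial f m.
Proof.
move=> fmn; apply: (@eq_from_nth _ (f 0%N)) => [|i im]; first by rewrite size_mkseq.
have := initial_nth (f 0%N) fmn (i := i); rewrite size_cat ltn_addr// nth_mkseq//.
by rewrite nth_cat im => ->.
Qed.

Lemma initial_comparable f m n : initial f m -> initial f n -> prefix m n || prefix n m.
Proof.
move=> fm fn; have [mn|/ltnW nm] := leqP (size m) (size n).
  by rewrite (initial_prefix fm fn).
by rewrite (initial_prefix fn fm) ?orbT.
Qed.

Lemma no_infinite_seq (y : nat -> T) (l : seq T) : injective y -> ~ forall k, y k \in l.
Proof.
move=> yI yl; have := @uniq_leq_size _ (map y (iota 0 (size l).+1)) l.
rewrite map_inj_uniq// iota_uniq size_map size_iota ltnn => /(_ isT) h.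
by suff : false by []; apply: h => _ /mapP[k _ ->].
Qed.

End InitialSegments.

Lemma mkseqD T (f : nat -> T) a b :
  mkseq f (a + b)%N = mkseq f a ++ mkseq (fun i => f (a + i)%N) b.
Proof.
rewrite /mkseq iotaD map_cat add0n; congr (_ ++ _).
by rewrite -{1}[a]addn0 iotaDl -map_comp.
Qed.

Lemma prefix_cat2l (T : eqType) (k m n : seq T) : prefix (k ++ m) (k ++ n) = prefix m n.
Proof. by rewrite prefix_catr// eqxx. Qed.

(** * Consequences of condition (M) for finite and infinite paths *)

Section BoundaryPaths.
Local Open Scope nat_scope.
Variable E : digraph.
Hypothesis hM : condition_M E.
Implicit Types (u v w : vertex E) (e f : edge E) (m n : seq (edge E)).
Implicit Types (X : nat -> edge E).

(** Condition (M) for the class of the path of length 0 at [u]. *)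
Lemma finite_paths_to_singular u v : singular u ->
  exists l : seq (seq (edge E)), forall m, walk v m -> wterm v m = u -> m \in l.
Proof.
move=> su.
have st : singular (fpath_terminus (@FPath E u [::] isT)) by [].
pose F (x : boundary_path E) := if x is Defs.Finite q _ then fpath_edges q else [::].
have := finite_image F (hM (Defs.Finite st) v) => /finite_seqP[l lE].
exists l => m wm mu; have sm : singular (fpath_terminus (FPath wm)).
  by rewrite /fpath_terminus/= -/(wterm v m) mu.
have : [set` l] m; last by [].
rewrite -lE; exists (Defs.Finite sm) => //=; split=> //.
Qed.

Definition infinite_path X := forall i, terminus (X i) = origin (X i.+1).

(** The path [m] followed by the tail of [X] from index [k]: past the end of [m], [nth] returns its
    default, which is the matching entry of the tail. *)
Definition graft m (k : nat) X (i : nat) : edge E := nth (X (k + (i - size m))%N) m i.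

Lemma graft_initial m k X : initial (graft m k X) m.
Proof.
apply: (@eq_from_nth _ (X 0%N)) => [|i im]; first by rewrite size_mkseq.
by rewrite nth_mkseq// /graft; apply: set_nth_default.
Qed.

Lemma graft_shift m k X r : graft m k X (size m + r) = X (k + r)%N.
Proof. by rewrite /graft nth_default ?leq_addr// addKn. Qed.

Lemma graft_cons e m k X i : graft (e :: m) k X i.+1 = graft m k X i.
Proof. by rewrite /graft /= subSS. Qed.

Lemma graft_path v m k X : infinite_path X -> walk v m -> wterm v m = origin (X k) ->
  infinite_path (graft m k X) /\ origin (graft m k X 0) = v.
Proof.
move=> Xp; elim: m v => [|e m IH] v.
  move=> _ vX; split; last by rewrite /graft/= addn0 -vX.
  by move=> i; rewrite /graft !nth_nil !subn0 Xp addnS.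
move=> /= /andP[/eqP<- wm] mX; have [gp go] := IH _ wm mX; split=> //.
case=> [|i]; first by rewrite graft_cons go.
by rewrite !graft_cons.
Qed.

(** All these grafts share a tail with [X] and start at [v], so (M) bounds their number at once for
    all [m] and [k]. *)
Lemma finite_grafts X v : infinite_path X ->
  exists l : seq (nat -> edge E), forall m k,
    walk v m -> wterm v m = origin (X k) -> graft m k X \in l.
Proof.
move=> Xp; pose F (x : boundary_path E) := if x is Defs.Infinite q then ipath_edge q else X.
have := finite_image F (hM (Defs.Infinite (IPath Xp)) v) => /finite_seqP[l lE].
exists l => m k wm mX; have [gp go] := graft_path Xp wm mX.
have : [set` l] (graft m k X); last by [].
rewrite -lE; exists (Defs.Infinite (IPath gp)) => //=; split=> //.
by exists k, (size m) => r; rewrite graft_shift.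
Qed.

(** Later the vertices whose projection is non-zero in a given representation; the combinatorics
    relies on the property travelling backwards along paths. *)
Variable good : vertex E -> Prop.
Hypothesis good_origin : forall u m, walk u m -> good (wterm u m) -> good u.

Definition comparable_at w := forall m n, walk w m -> walk w n ->
  wterm w m = wterm w n -> good (wterm w m) -> prefix m n || prefix n m.

Lemma exists_comparable w0 : good w0 -> exists2 w, good w & comparable_at w.
Proof.
move=> gw0; apply: contrapT => nocomp.
have /choice[F FP] w : exists mn : seq (edge E) * seq (edge E), good w ->
    [/\ walk w mn.1, walk w mn.2, wterm w mn.1 = wterm w mn.2, good (wterm w mn.1)
      & ~~ (prefix mn.1 mn.2 || prefix mn.2 mn.1)].
  have [gw|] := pselect (good w); last by exists ([::], [::]).
  apply: contrapT => nomn; apply: nocomp; exists w => // m n wm wn mn gm.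
  by apply/negPn/negP => nc; apply: nomn; exists (m, n).
pose wk k := iter k (fun w => wterm w (F w).1) w0.
pose a k := (F (wk k)).1; pose b k := (F (wk k)).2.
have gwk k : good (wk k).
  by elim: k => // k IH; have [] := FP _ IH.
have aw k : walk (wk k) (a k) by have [] := FP _ (gwk k).
have bw k : walk (wk k) (b k) by have [] := FP _ (gwk k).
have ta k : wterm (wk k) (a k) = wk k.+1 by [].
have tb k : wterm (wk k) (b k) = wk k.+1 by have [_ _ <-] := FP _ (gwk k).
have ab k : ~~ (prefix (a k) (b k) || prefix (b k) (a k)).
  by have [] := FP _ (gwk k).
(* The empty path is a prefix of every path, so incomparability makes each block non-empty and the
   concatenation infinite. *)
have a0 k : (0 < size (a k))%N.
  by have := ab k; case: (a k) => //; rewrite prefix0s.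
pose pre k := flatten (mkseq a k).
have preS k : pre k.+1 = pre k ++ a k.
  by rewrite /pre mkseqS -cats1 flatten_cat /= cats0.
have pre_walk k : walk w0 (pre k) /\ wterm w0 (pre k) = wk k.
  elim: k => [//|k [IHw IHt]]; rewrite preS walk_cat wterm_cat IHw IHt aw.
  by rewrite ta.
have pre_size k : (k <= size (pre k))%N.
  by elim: k => // k IH; rewrite preS size_cat -addn1 leq_add.
have [e0 _] : exists e : edge E, True.
  by have := a0 0%N; case: (a 0%N) => // e; exists e.
(* The first i + 1 blocks contain more than [i] edges, so the default [e0] is never reached. *)
pose X i := nth e0 (pre i.+1) i.
have preD k j : exists t, pre (k + j) = pre k ++ t.
  elim: j => [|j [t IH]]; first by exists [::]; rewrite addn0 cats0.
  by exists (t ++ a (k + j)%N); rewrite addnS preS IH catA.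
have nthX k i : (i < size (pre k))%N -> nth e0 (pre k) i = X i.
  move=> ik; rewrite /X; have [ki|ki] := leqP k i.+1.
    have [t] := preD k (i.+1 - k)%N; rewrite subnKC// => ->.
    by rewrite nth_cat ik.
  have [t] := preD i.+1 (k - i.+1)%N; rewrite subnKC ?(ltnW ki)// => ->.
  by rewrite nth_cat pre_size.
have pre_initial k : initial X (pre k).
  apply: (@eq_from_nth _ e0) => [|i ik]; first by rewrite size_mkseq.
  by rewrite nthX// nth_mkseq.
have walk_nth m v i : walk v m -> (i.+1 < size m)%N ->
    terminus (nth e0 m i) = origin (nth e0 m i.+1).
  elim: m v i => // e m IH v [|i] /= /andP[_ wm]; last exact: (IH _ _ wm).
  by case: m wm {IH} => //= f m /andP[/eqP<-].
have Xp : infinite_path X.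
  move=> i; have [wp _] := pre_walk i.+2.
  rewrite -(nthX i.+2) ?(leq_trans _ (pre_size _))// -(nthX i.+2) ?pre_size//.
  by apply: (walk_nth _ _ _ wp); exact: pre_size.
have Xo k : origin (X (size (pre k))) = wk k.
  have hk : (size (pre k) < size (pre k.+1))%N.
    by rewrite preS size_cat -addn1 leq_add2l a0.
  rewrite -(nthX k.+1)// preS nth_cat ltnn subnn.
  by have := aw k; have := a0 k; case: (a k) => //= e m _ /andP[/eqP].
have [l lP] := finite_grafts w0 Xp.
(* [y k] runs along [X] except for its [k]-th block, where it takes [b k] instead of [a k]. *)
pose y k := graft (pre k ++ b k) (size (pre k.+1)) X.
apply: (@no_infinite_seq _ y l).
(* For i < j the path [y j] still begins with [pre i ++ a i], while [y i] begins with
   [pre i ++ b i]; equality would make [a i] and [b i] comparable. *)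
- have lt_case i j : (i < j)%N -> y i <> y j.
    move=> ij yij; have := ab i; apply/negP; rewrite negbK.
    have bi : initial (y i) (pre i ++ b i) by exact: graft_initial.
    have [t tE] := preD i.+1 (j - i.+1)%N; rewrite subnKC// in tE.
    have : initial (y j) (pre j ++ b j) by exact: graft_initial.
    rewrite -yij tE preS -!catA catA => /initial_catl aj.
    by have := initial_comparable aj bi; rewrite !prefix_cat2l.
  move=> i j yij; case: (ltngtP i j) => // ij; first by case: (lt_case _ _ ij).
  by case: (lt_case _ _ ij).
- move=> k; apply: lP.
    by have [wp tp] := pre_walk k; rewrite walk_cat wp tp bw.
  by have [wp tp] := pre_walk k; rewrite wterm_cat tp tb Xo.
Qed.

Definition rigid_at w := forall m n, walk w m -> walk w n ->
  wterm w m = wterm w n -> good (wterm w m) -> m = n.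

(** The alternative to rigidity: [X] is the only way to continue through good vertices, and as it
    avoids singular vertices, the sum relation is available all along it. *)
Definition good_ray w X := [/\
  forall k, walk w (mkseq X k) /\ good (wterm w (mkseq X k)),
  forall m, walk w m -> good (wterm w m) -> initial X m &
  forall k, ~ singular (wterm w (mkseq X k))].

(** The ray is ccc... If [m] leads to a good vertex, so does [c ++ m], with the same terminus;
    comparability and length make [m] a prefix of [c ++ m], hence by iteration of a power of [c]. *)
Lemma comparable_cycle u c : good u -> comparable_at u -> c != [::] -> walk u c ->
  wterm u c = u -> exists X, good_ray u X.
Proof.
move=> gu cu c0 wc tc.
pose C k := flatten (nseq k c).
have CS k : C k.+1 = c ++ C k by [].
have CD j k : C (j + k)%N = C j ++ C k by rewrite /C nseqD flatten_cat.
have Cw k : walk u (C k) /\ wterm u (C k) = u.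
  by elim: k => // k [wk tk]; rewrite CS walk_cat wc wterm_cat tc.
have c_gt0 : (0 < size c)%N by case: (c) c0.
have Csize k : (k <= size (C k))%N.
  by elim: k => // k IH; rewrite CS size_cat -add1n leq_add.
have [e0 _] : exists e : edge E, True by case: (c) c0 => // e; exists e.
pose X i := nth e0 (C i.+1) i.
have nthX k i : (i < size (C k))%N -> nth e0 (C k) i = X i.
  move=> ik; rewrite /X; have [ki|ki] := leqP k i.+1.
    by rewrite -(subnKC ki) CD nth_cat ik.
  by rewrite -(subnKC (ltnW ki)) CD nth_cat Csize.
have mkX (n : nat) : mkseq X n = take n (C n).
  apply: (@eq_from_nth _ e0) => [|i].
    by rewrite size_mkseq size_takel.
  rewrite size_mkseq => ik; rewrite nth_mkseq// nth_take// nthX//.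
  exact: leq_trans (Csize _).
have gX (n : nat) : walk u (mkseq X n) /\ good (wterm u (mkseq X n)).
  have [+ tC] := Cw n; rewrite mkX -{1}(cat_take_drop n (C n)) walk_cat.
  move=> /andP[w1 w2]; split=> //; apply: good_origin w2 _.
  by rewrite -wterm_cat cat_take_drop tC.
exists X; split=> //.
- move=> m wm gm.
  have step : prefix m (c ++ m).
    have := @cu (c ++ m) m; rewrite walk_cat wc tc wm wterm_cat tc.
    move=> /(_ isT isT erefl gm)/orP[/size_prefix|//].
    by rewrite size_cat leqNgt -[X in (X < _)%N]add0n ltn_add2r c_gt0.
  have stepk k : prefix m (C k ++ m).
    elim: k => [|k IH]; first exact: prefix_refl.
    by rewrite (prefix_trans step)// CS -catA prefix_cat2l.
  have mE : m = take (size m) (C (size m)).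
    have := stepk (size m); rewrite prefixE => /eqP {1}<-.
    by rewrite takel_cat.
  by rewrite /initial mkX.
- move=> n sn; have [l lP] := finite_paths_to_singular (wterm u (mkseq X n)) sn.
  (* From the [n]-th vertex of the ray back to [u], then [j] turns round the cycle, then out again:
     infinitely many paths into a singular vertex, told apart by their lengths. *)
  pose y j := drop n (C n) ++ C j ++ mkseq X n.
  have [wC tC] := Cw n; move: wC; rewrite -{1}(cat_take_drop n (C n)) -mkX walk_cat.
  move=> /andP[wX wd].
  have td : wterm (wterm u (mkseq X n)) (drop n (C n)) = u.
    by rewrite -wterm_cat mkX cat_take_drop.
  apply: (@no_infinite_seq _ y l).
    move=> i j /(congr1 size); rewrite !size_cat => /addnI/addIn.
    have sC k : size (C k) = (k * size c)%N.
      by elim: k => // k IH; rewrite CS size_cat IH mulSn.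
    by rewrite !sC => /eqP; rewrite eqn_pmul2r// => /eqP.
  move=> j; apply: lP; have [wj tj] := Cw j.
    by rewrite walk_cat wd td walk_cat wj tj wX.
  by rewrite !wterm_cat td tj.
Qed.

Lemma rigid_or_ray w0 : good w0 ->
  exists2 w, good w & rigid_at w \/ exists X, good_ray w X.
Proof.
move=> /exists_comparable[w gw cw].
have [rw|] := pselect (rigid_at w); first by exists w => //; left.
move=> /existsNP[m /existsNP[n /not_implyP[wm /not_implyP[wn]]]].
move=> /not_implyP[mn /not_implyP[gm neq]].
wlog pmn : m n wm wn mn gm neq / prefix m n.
  move=> h; have /orP[pmn|pnm] := cw _ _ wm wn mn gm; first exact: (h m n).
  by apply: (h n m) => //; [rewrite -mn|apply/nesym].
have /prefixP[c nE] := pmn.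
move: wn; rewrite nE walk_cat wm => /= wc.
exists (wterm w m) => //; right; apply: (@comparable_cycle _ c) => //.
(* Comparability at [w] passes to the end of [m] by prepending [m] to both paths. *)
- move=> k l wk wl kl gk; have := cw (m ++ k) (m ++ l).
  by rewrite !walk_cat wm !wterm_cat wk wl !prefix_cat2l; exact.
- by apply/eqP => c0; apply: neq; rewrite nE c0 cats0.
- by rewrite -wterm_cat -nE.
Qed.

End BoundaryPaths.

(** * Irreducible representations of the graph algebra *)

Arguments bop_fun : simpl never.

Section GraphOperators.
Variables (R : realType) (E : digraph) (A : cstarAlgType R).
Variables (p : vertex E -> A) (s : edge E -> A) (hA : graph_algebra p s).
Variables (H : hilbertType R) (pi : A -> {linear H -> H}).
Hypotheses (pi_rep : representation pi) (pi_irr : irreducible pi).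
Implicit Types (u v w : vertex E) (e f : edge E) (m n : seq (edge E)) (x y : H).

Let hCK : CK_family p s := graph_algebra_CK hA.

Definition vop v : bop H := repr_bop pi_rep (p v).
Definition eop e : bop H := repr_bop pi_rep (s e).

Lemma vopE v x : vop v x = pi (p v) x. Proof. by []. Qed.
Lemma eopE e x : eop e x = pi (s e) x. Proof. by []. Qed.

Lemma eop_adjE e x : bop_adj (eop e) x = pi (cstar (s e)) x.
Proof. by apply: inner_inj => y; rewrite bop_adjP (repr_star pi_rep). Qed.

Lemma vop_sa v x y : inner (vop v x) y = inner x (vop v y).
Proof. by rewrite !vopE (repr_adj pi_rep) (CK_proj hCK v).2. Qed.

Lemma vop_id v x : vop v (vop v x) = vop v x.
Proof. by rewrite !vopE -(reprM pi_rep) (CK_proj hCK v).1. Qed.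

Lemma vop_orth v w x : v != w -> vop v (vop w x) = 0.
Proof. by move=> vw; rewrite !vopE -(reprM pi_rep) (CK_orth hCK vw) (repr0 pi_rep). Qed.

Lemma eop_source e x : bop_adj (eop e) (eop e x) = vop (terminus e) x.
Proof. by rewrite eop_adjE eopE -(reprM pi_rep) (CK_source hCK). Qed.

Lemma eop_partial_isometry e x : eop e (bop_adj (eop e) (eop e x)) = eop e x.
Proof.
by rewrite eop_adjE !eopE -!(reprM pi_rep) (CK_partial_isometry hCK).
Qed.

Lemma eop_vop_terminus e x : eop e (vop (terminus e) x) = eop e x.
Proof. by rewrite -eop_source eop_partial_isometry. Qed.

(** Bessel's inequality, the form in which relation (ii) is used: the difference of the two sides of
    (ii) is some b^* b, and its quadratic form at [x] is |b x|^2. *)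
Lemma sum_eop_adj_le v (l : seq (edge E)) x : uniq l -> all (fun e => origin e == v) l ->
  \sum_(e <- l) rnorm (bop_adj (eop e) x) ^+ 2 <= rnorm (vop v x) ^+ 2.
Proof.
move=> ul /allP lv.
have [] := @CK_le _ _ _ _ _ hCK v [set` l].
- exact: finite_seq.
- by move=> e /= /lv/eqP.
move=> b pb; rewrite -(fsbig_seq _ _ ul) in pb.
have sumE : forall y, pi (\sum_(e <- l) cmul (s e) (cstar (s e))) y =
    \sum_(e <- l) eop e (bop_adj (eop e) y).
  move=> y; elim: (l) => [|e k IH]; first by rewrite !big_nil (repr0 pi_rep).
  by rewrite !big_cons (reprD pi_rep) IH (reprM pi_rep) eop_adjE.
have : complex.Re (inner (pi (p v - \sum_(e <- l) cmul (s e) (cstar (s e))) x) x)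
    = rnorm (pi b x) ^+ 2.
  by rewrite pb (reprM pi_rep) (repr_star pi_rep) Re_innerxx.
rewrite (reprB pi_rep) sumE innerBl ReD ReN.
have -> : complex.Re (inner (pi (p v) x) x) = rnorm (vop v x) ^+ 2.
  change (complex.Re (inner (vop v x) x) = rnorm (vop v x) ^+ 2).
  by rewrite -{1}vop_id vop_sa Re_innerxx.
have -> : complex.Re (inner (\sum_(e <- l) eop e (bop_adj (eop e) x)) x) =
    \sum_(e <- l) rnorm (bop_adj (eop e) x) ^+ 2.
  elim: (l) => [|e k IH]; first by rewrite !big_nil inner0l.
  by rewrite !big_cons innerDl ReD IH -Re_innerxx bop_adjPr.
by have := sqr_ge0 (rnorm (pi b x)); lra.
Qed.

Lemma eop_adj_vop0 e x : vop (origin e) x = 0 -> bop_adj (eop e) x = 0.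
Proof.
move=> vx; have := @sum_eop_adj_le (origin e) [:: e] x isT; rewrite /= eqxx => /(_ isT).
rewrite big_seq1 vx rnorm0 expr0n /= => h.
by apply/eqP; rewrite -rnorm_eq0 -sqrf_eq0 eq_le h sqr_ge0.
Qed.

Lemma eop_adj_origin e x : bop_adj (eop e) (vop (origin e) x) = bop_adj (eop e) x.
Proof.
apply/eqP; rewrite -subr_eq0 -bopB; apply/eqP/eop_adj_vop0.
by rewrite bopB vop_id subrr.
Qed.

Lemma eop_origin e x : vop (origin e) (eop e x) = eop e x.
Proof.
apply: inner_inj => y; rewrite vop_sa; have := eop_adj_origin e y.
by rewrite !bop_adjPr => ->.
Qed.

Lemma eop_adj_terminus e x : vop (terminus e) (bop_adj (eop e) x) = bop_adj (eop e) x.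
Proof.
by apply: inner_inj => y; rewrite vop_sa !bop_adjP eop_vop_terminus.
Qed.

(** For a common origin, Bessel's inequality at s_f x for the edges [e] and [f] is already exhausted
    by the term of [f], because |s_f^* s_f x| = |s_f x|. *)
Lemma eop_adj_orth e f x : e != f -> bop_adj (eop e) (eop f x) = 0.
Proof.
move=> ef; have [oe|oe] := eqVneq (origin e) (origin f); last first.
  by rewrite -eop_adj_origin -eop_origin vop_orth// bop0.
have := @sum_eop_adj_le (origin e) [:: e; f] (eop f x).
rewrite /= inE ef eqxx oe eqxx => /(_ isT isT).
rewrite big_cons big_seq1 eop_source eop_origin.
have -> : rnorm (eop f x) ^+ 2 = rnorm (vop (terminus f) x) ^+ 2.
  by rewrite -!Re_innerxx -bop_adjP eop_source !vop_sa vop_id.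
rewrite gerDr => h.
by apply/eqP; rewrite -rnorm_eq0 -sqrf_eq0 eq_le h sqr_ge0.
Qed.

Lemma nonsingular_vop0 v x : ~ singular v ->
  (forall e, origin e = v -> bop_adj (eop e) x = 0) -> vop v x = 0.
Proof.
move=> nv h; have := CK_sum hCK nv.
have fv : finite_set (emits v).
  by apply: contrapT => fv; apply: nv; right.
rewrite vopE (fsbig_finite _ _ fv) => <-.
have : {subset enum_fset (fset_set (emits v)) <= emits v}.
  by move=> e; rewrite in_fset_set.
elim: (enum_fset _) => [|e k IH] kv; first by rewrite big_nil (repr0 pi_rep).
rewrite big_cons (reprD pi_rep) IH; last by move=> f fk; apply: kv; rewrite inE fk orbT.
rewrite (reprM pi_rep) -eop_adjE h ?linear0 ?addr0//.
by have := kv e (mem_head _ _); rewrite inE.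
Qed.

Fixpoint pop v m : bop H :=
  if m is e :: m' then bop_comp (eop e) (pop (terminus e) m') else vop v.

Arguments pop : simpl never.

Lemma pop_nil v x : pop v [::] x = vop v x.
Proof. by []. Qed.

Lemma pop_cons v e m x : pop v (e :: m) x = eop e (pop (terminus e) m x).
Proof. by []. Qed.

Lemma pop_adj_nil v x : bop_adj (pop v [::]) x = vop v x.
Proof. by apply: inner_inj => y; rewrite bop_adjP /= vop_sa. Qed.

Lemma pop_adj_cons v e m x :
  bop_adj (pop v (e :: m)) x = bop_adj (pop (terminus e) m) (bop_adj (eop e) x).
Proof. by apply: inner_inj => y; rewrite !bop_adjP. Qed.

Lemma pop_origin v m x : walk v m -> vop v (pop v m x) = pop v m x.
Proof.
case: m => [|e m] /=; first by rewrite vop_id.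
by move=> /andP[/eqP<- _]; exact: eop_origin.
Qed.

Lemma pop_terminus v m x : pop v m (vop (wterm v m) x) = pop v m x.
Proof.
elim: m v => [|e m IH] v; first exact: vop_id.
by rewrite !pop_cons wterm_cons IH.
Qed.

Lemma pop_adj_origin v m x : walk v m -> bop_adj (pop v m) (vop v x) = bop_adj (pop v m) x.
Proof. by move=> vm; apply: inner_inj => y; rewrite !bop_adjP vop_sa pop_origin. Qed.

Lemma pop_adj_terminus v m x :
  vop (wterm v m) (bop_adj (pop v m) x) = bop_adj (pop v m) x.
Proof. by apply: inner_inj => y; rewrite vop_sa !bop_adjP pop_terminus. Qed.

Lemma pop_source v m x : walk v m -> bop_adj (pop v m) (pop v m x) = vop (wterm v m) x.
Proof.
elim: m v => [|e m IH] v /=; first by rewrite pop_adj_nil vop_id.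
move=> /andP[_ wm]; rewrite pop_adj_cons eop_source pop_origin//.
exact: IH.
Qed.

Lemma pop_cat v m n x : walk v (m ++ n) -> pop v (m ++ n) x = pop v m (pop (wterm v m) n x).
Proof.
elim: m v => [|e m IH] v; first by move=> wn; rewrite [RHS]pop_origin.
by rewrite cat_cons => /andP[_ wm]; rewrite !pop_cons IH.
Qed.

Lemma pop_adj_cat v m n x : walk v (m ++ n) ->
  bop_adj (pop v (m ++ n)) x = bop_adj (pop (wterm v m) n) (bop_adj (pop v m) x).
Proof. by move=> wmn; apply: inner_inj => y; rewrite !bop_adjP pop_cat. Qed.

Lemma pop_orth v m n x : walk v m -> walk v n -> ~~ prefix m n -> ~~ prefix n m ->
  bop_adj (pop v m) (pop v n x) = 0.
Proof.
elim: m v n => [|e m IH] v [|f n]//=.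
move=> /andP[_ wm] /andP[_ wn]; case: (eqVneq e f) wm => [->|ef] wm.
  move=> /= mn nm; rewrite pop_adj_cons pop_cons eop_source pop_adj_origin//.
  exact: IH.
by move=> _ _; rewrite pop_adj_cons pop_cons eop_adj_orth// bop0.
Qed.

Lemma repr_cvg_closed (V W : set H) : closed W ->
  closed [set a | forall x, V x -> W (pi a x)].
Proof.
move=> /closed_rnormP clW; apply/closed_rnormP => a h x Vx; apply: clW => e e0.
have x1 : 0 < rnorm x + 1 by rewrite ltr_wpDl ?rnorm_ge0.
have [|b Vb ab] := h (e / (rnorm x + 1)); first by rewrite divr_gt0.
exists (pi b x); first exact: Vb.
rewrite -(reprB pi_rep) (le_lt_trans (repr_contractive pi_rep _ _))//.
move: ab; rewrite ltr_pdivlMr// => /(le_lt_trans _); apply.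
by rewrite ler_wpM2l ?rnorm_ge0// lerDl.
Qed.

(** Two sets serve two purposes: W = V gives invariance of a subspace under all of [A], while V =
    [setT] and W = 0 shows that [A] acts as 0 if its generators do. *)
Lemma generated_maps (V W : set H) : closed_subspace W -> W `<=` V ->
  (forall v x, V x -> W (vop v x)) ->
  (forall e x, V x -> W (eop e x) /\ W (bop_adj (eop e) x)) ->
  forall a x, V x -> W (pi a x).
Proof.
move=> [clW W0 WL] WV Vv Ve.
pose C a := forall x, V x -> W (pi a x).
have clC : closed C by exact: repr_cvg_closed.
(* Including the condition on [cstar a] makes the set closed under the involution, as a
   C*-subalgebra must be. *)
suff CT : [set a | C a /\ C (cstar a)] = setT.
  by move=> a; have : setT a by []; rewrite -CT => -[].
apply: (graph_algebra_generated hA) => [|v|e].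
- split.
  + apply/closed_rnormP => a h; split; move/closed_rnormP: clC; apply => e /h[b [Cb Cb']].
      by exists b.
    by move=> ab; exists (cstar b) => //; rewrite -cstarB rnorm_star.
  + by rewrite /= cstar0; split=> x Vx; rewrite (repr0 pi_rep).
  + move=> c a b [Ca Ca'] [Cb Cb']; split=> x Vx.
      by rewrite (repr_linear pi_rep); apply: WL; [exact: Ca|exact: Cb].
    by rewrite cstar_antilinear (repr_linear pi_rep); apply: WL; [exact: Ca'|exact: Cb'].
  + move=> a b [Ca Ca'] [Cb Cb']; split=> x Vx.
      by rewrite (reprM pi_rep); apply/Ca/WV/Cb.
    by rewrite cstarM (reprM pi_rep); apply/Cb'/WV/Ca'.
  + by move=> a [Ca Ca']; split=> //; rewrite cstarK.
- by split=> x Vx; rewrite ?(CK_proj hCK v).2; exact: Vv.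
- split=> x /(Ve e)[]//.
  by rewrite eop_adjE.
Qed.

Lemma irreducible_cspan (G : set H) : (exists2 g, G g & g != 0) ->
  (forall v g, G g -> cspan G (vop v g)) ->
  (forall e g, G g -> cspan G (eop e g) /\ cspan G (bop_adj (eop e) g)) ->
  forall x, cspan G x.
Proof.
move=> [g0 Gg0 g00] Gv Ge; have cV := cspan_subspace G; have [clV V0 VL] := cV.
have [|V1|VT] := (pi_irr.2 (cspan G) clV V0 VL).
- apply: generated_maps => // [v|e] x Gx.
    by apply: cspan_map Gx => g /Gv.
  by split; apply: cspan_map Gx => g /(Ge e)[].
- by have := sub_cspan Gg0; rewrite V1 => /= g0E; rewrite g0E eqxx in g00.
- by move=> x; rewrite VT.
Qed.

Lemma exists_vop_neq0 : exists v, exists x, vop v x != 0.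
Proof.
apply: contrapT => /forallNP h.
have v0 v x : vop v x = 0 by apply: contrapT => /eqP vx; apply: (h v); exists x.
have [a [x /eqP]] := pi_irr.1; apply.
apply: (@generated_maps setT _ (zero_subspace H)) => // [v y _|e y _]; first exact: v0.
split; last exact/eop_adj_vop0/v0.
by rewrite -eop_origin v0.
Qed.

(* The roots are the vectors [h] with [Q u h]; the family of all [pop v m h] with
   [h] a root at the end of [m] is stable under the generators up to scalars. *)
Section Roots.
Variable Q : vertex E -> set H.
Hypothesis QP : forall u h, Q u h -> vop u h = h.
Hypothesis Q_adj : forall u h e, Q u h -> origin e = u ->
  bop_adj (eop e) h = 0 \/ Q (terminus e) (bop_adj (eop e) h).

Definition rooted : set H :=
  [set g | exists v m h, [/\ walk v m, Q (wterm v m) h & g = pop v m h]].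

Definition rooted_at v : set H :=
  [set g | exists m h, [/\ walk v m, Q (wterm v m) h & g = pop v m h]].

Lemma rooted_cspan : (exists u h, Q u h /\ h != 0) -> forall x, cspan rooted x.
Proof.
move=> [u0 [h0 [Qh0 h00]]]; apply: irreducible_cspan.
- by exists h0 => //; exists u0, [::], h0; split=> //; rewrite pop_nil QP.
- move=> v g [w [m [h [wm Qh ->]]]].
  have [->|vw] := eqVneq v w.
    by rewrite pop_origin//; apply: sub_cspan; exists w, m, h.
  by rewrite -pop_origin// vop_orth//; exact: cspan0.
- move=> e g [w [m [h [wm Qh ->]]]]; split.
    have [te|te] := eqVneq (terminus e) w.
      apply: sub_cspan; exists (origin e), (e :: m), h; split=> //=.
      + by rewrite eqxx te.
      + by rewrite wterm_cons te.
      + by rewrite pop_cons te.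
    rewrite -eop_vop_terminus -pop_origin// vop_orth// bop0; exact: cspan0.
  case: m wm Qh => [|f m] /= wm Qh.
    rewrite pop_nil QP//.
    have [oe|oe] := eqVneq (origin e) w.
      have [->|Qe] := Q_adj Qh oe; first exact: cspan0.
      apply: sub_cspan; exists (terminus e), [::], (bop_adj (eop e) h).
      by split=> //; rewrite pop_nil QP.
    rewrite -[h](QP Qh) -eop_adj_origin vop_orth// bop0; exact: cspan0.
  move/andP: wm => [_ wm]; rewrite pop_cons.
  have [->|ef] := eqVneq e f; last by rewrite eop_adj_orth//; exact: cspan0.
  rewrite eop_source pop_origin//; apply: sub_cspan.
  by exists (terminus f), m, h.
Qed.

Lemma rooted_at_cspan : (exists u h, Q u h /\ h != 0) ->
  forall v x, cspan (rooted_at v) (vop v x).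
Proof.
move=> /rooted_cspan h v x; apply: cspan_map (h x) => g [w [m [y [wm Qy ->]]]].
have [->|vw] := eqVneq v w.
  by rewrite pop_origin//; apply: sub_cspan; exists m, y.
by rewrite -pop_origin// vop_orth//; exact: cspan0.
Qed.

End Roots.

(** * Commutative corners and one-dimensional vertex projections *)

Definition good v := exists x, vop v x != 0.

Lemma not_good v x : ~ good v -> vop v x = 0.
Proof. by move=> gv; apply: contrapT => /eqP vx; apply: gv; exists x. Qed.

Lemma good_origin u m : walk u m -> good (wterm u m) -> good u.
Proof.
move=> um [x xt]; exists (pop u m x); rewrite pop_origin//.
by apply: contra_neq xt => h; rewrite -pop_source// h bop0.
Qed.

Lemma pop_not_good v m x : ~ good (wterm v m) -> pop v m x = 0.
Proof. by move=> gt; rewrite -pop_terminus not_good// bop0. Qed.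

Definition gop w m n : bop H := bop_comp (pop w m) (bop_adj (pop w n)).

Lemma gopE w m n x : gop w m n x = pop w m (bop_adj (pop w n) x).
Proof. by []. Qed.

Lemma gop_not_good w m n x : ~ good (wterm w m) -> gop w m n x = 0.
Proof. exact: pop_not_good. Qed.

Lemma gop_mul w m n k x : walk w n -> wterm w m = wterm w n ->
  gop w m n (gop w n k x) = gop w m k x.
Proof. by move=> wn mn; rewrite !gopE pop_source// -mn pop_terminus. Qed.

Definition parallel w m n := [/\ walk w m, walk w n & wterm w m = wterm w n].

(** The products s_m s_n^* of parallel paths span a dense subspace of the corner p_w C*(E) p_w, so
    this is commutativity of the corner in the representation. *)
Definition corner_commutes w := forall m n k l, parallel w m n -> parallel w k l ->
  bop_commute (gop w m n) (gop w k l).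

Definition one_dim v h :=
  [/\ vop v h = h, h != 0 & forall x, vop v x = x -> exists c : R[i], x = c *: h].

(** For any non-zero [x] in the range of p_w, the vectors s_m s_n^* x span that range, by
    irreducibility. So an operator that commutes with the corner and kills [x] kills the whole
    range, which is the hypothesis of the Schur lemma; each s_m s_n^* is then scalar and the span is
    the line of [x]. *)
Lemma corner_one_dim w : good w -> corner_commutes w -> exists h, one_dim w h.
Proof.
move=> [x0 x0w] cw.
pose G := [set T | exists m n, parallel w m n /\ T = gop w m n].
pose Q x u h := exists n, [/\ walk w n, wterm w n = u & h = bop_adj (pop w n) x].
have QP x u h : vop w x = x -> Q x u h -> vop u h = h.
  by move=> wx [n [wn <- ->]]; rewrite pop_adj_terminus.
have Q_adj x u h e : vop w x = x -> Q x u h -> origin e = u ->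
    bop_adj (eop e) h = 0 \/ Q x (terminus e) (bop_adj (eop e) h).
  move=> wx [n [wn nu ->]] oe; right; exists (n ++ [:: e]).
  have wne : walk w (n ++ [:: e]) by rewrite walk_cat wn /= oe nu eqxx.
  by rewrite wterm_cat pop_adj_cat// pop_adj_cons pop_adj_nil eop_adj_terminus.
have span x y : vop w x = x -> x != 0 -> cspan (rooted_at (Q x) w) (vop w y).
  move=> wx x0'; apply: rooted_at_cspan => [u h|u h e|]; first exact: QP.
    exact: Q_adj.
  by exists w, x; split=> //; exists [::]; rewrite pop_adj_nil.
have scal T : G T -> exists c : R[i], forall x, vop w x = x -> T x = c *: x.
  apply: (@commuting_scalar _ _ [set x | vop w x = x] (vop w) _ G) => //.
  - exists [::], [::]; split=> //; apply: bop_eqP => x.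
    by rewrite gopE pop_adj_nil pop_nil vop_id.
  - by move=> S U [m [n [mn ->]]] [k [l [kl ->]]]; exact: cw.
  - move=> D GD [x [/= wx x0' Dx]] y /= wy.
    have := span x y wx x0'; rewrite wy.
    apply: (cspan_min (subspace_preimage D (zero_subspace H))).
    move=> _ [m [_ [wm [n [wn nm ->]] ->]]] /=.
    have := GD (gop w m n); rewrite -gopE => <-; first by rewrite Dx bop0.
    by exists m, n.
  - move=> S [m [n [[wm wn mn] ->]]]; exists n, m; split=> //.
    apply: bop_adj_unique => x y; rewrite !gopE bop_adjPr -[in RHS]bop_adjP.
    by [].
exists (vop w x0); split=> [|//|x wx]; first exact: vop_id.
have := span (vop w x0) x (vop_id _ _) x0w; rewrite wx.
apply: (cspan_min (line_subspace _)) => _ [m [_ [wm [n [wn nm ->]] ->]]] /=.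
have [|c cP] := scal (gop w m n); first by exists m, n.
by exists c; rewrite -gopE cP// vop_id.
Qed.

(** Rigidity leaves only the projections s_m s_m^* non-zero. Two of them are nested if one path is a
    prefix of the other and orthogonal if not. *)
Lemma rigid_commutes w : rigid_at good w -> corner_commutes w.
Proof.
move=> rw m n k l [wm wn mn] [wk wl kl] x.
have [gm|gm] := pselect (good (wterm w m)); last by rewrite !(gop_not_good _ _ gm) bop0.
have [gk|gk] := pselect (good (wterm w k)); last by rewrite !(gop_not_good _ _ gk) bop0.
have <- := rw _ _ wm wn mn gm; have <- := rw _ _ wk wl kl gk.
have absorb a b y : walk w (a ++ b) ->
    gop w a a (gop w (a ++ b) (a ++ b) y) = gop w (a ++ b) (a ++ b) y /\
    gop w (a ++ b) (a ++ b) (gop w a a y) = gop w (a ++ b) (a ++ b) y.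
  move=> wab; have := wab; rewrite walk_cat => /andP[wa wb].
  rewrite !gopE !pop_cat// !pop_adj_cat// !pop_source//.
  by rewrite pop_origin// pop_adj_origin.
have [/prefixP[b kE]|mk] := boolP (prefix m k).
  by rewrite kE; have [|-> ->] := absorb m b x; first by rewrite -kE.
have [/prefixP[b mE]|km] := boolP (prefix k m).
  by rewrite mE; have [|-> ->] := absorb k b x; first by rewrite -mE.
by rewrite !gopE !pop_orth// !bop0.
Qed.

Section Ray.
Variables (w : vertex E) (X : nat -> edge E).
Hypothesis wX : good_ray good w X.

Let Xm k := mkseq X k.

Let XmS k : Xm k.+1 = Xm k ++ [:: X k].
Proof. by rewrite /Xm mkseqS cats1. Qed.

Let Xw k : walk w (Xm k).
Proof. by have [/(_ k)[]] := wX. Qed.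

Let X_origin k : origin (X k) = wterm w (Xm k).
Proof. by have := Xw k.+1; rewrite XmS walk_cat /= => /andP[_ /andP[/eqP]]. Qed.

Let next_good k e : origin e = wterm w (Xm k) -> good (terminus e) -> e = X k.
Proof.
move=> oe ge; have [_ h _] := wX.
have := h (Xm k ++ [:: e]); rewrite walk_cat Xw /= oe eqxx wterm_cat => /(_ isT ge).
rewrite /initial size_cat size_mkseq addn1 -/(Xm k.+1) XmS => /eqP.
by rewrite eqseq_cat// eqxx /= eqseq_cons andbT => /eqP.
Qed.

(** In the sum relation at this non-singular vertex, every edge other than [X k] ends at a vertex
    that is not good and contributes 0. *)
Let range_full k y : eop (X k) (bop_adj (eop (X k)) y) = vop (wterm w (Xm k)) y.
Proof.
have [_ _ /(_ k) nsing] := wX.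
apply/esym/eqP; rewrite -subr_eq0 -[X in _ - X]eop_origin X_origin -bopB; apply/eqP.
apply: (nonsingular_vop0 nsing) => e oe; rewrite bopB.
have [->|eX] := eqVneq e (X k).
  by rewrite eop_source eop_adj_terminus subrr.
rewrite eop_adj_orth// subr0 -eop_adj_terminus not_good// => ge.
by move/eqP: eX; apply; exact: next_good.
Qed.

(** From a common vertex the ray has only one good continuation, and by [range_full] lengthening
    both paths by its edges inserts factors s_e s_e^* that act as the identity there. *)
Let shift a b i : wterm w (Xm a) = wterm w (Xm b) ->
  wterm w (Xm (a + i)%N) = wterm w (Xm (b + i)%N) /\
  forall x, gop w (Xm (a + i)%N) (Xm (b + i)%N) x = gop w (Xm a) (Xm b) x.
Proof.
move=> ab; elim: i => [|i [IH1 IH2]]; first by rewrite !addn0.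
have XX : X (a + i)%N = X (b + i)%N.
  apply: next_good; first by rewrite X_origin.
  have [/(_ (a + i).+1)[_]] := wX.
  by rewrite -/(Xm _) XmS wterm_cat.
rewrite !addnS !XmS; split; first by rewrite !wterm_cat IH1 XX.
move=> x; rewrite -IH2 !gopE pop_cat; last by rewrite -XmS.
rewrite pop_adj_cat; last by rewrite -XmS.
rewrite !pop_cons !pop_adj_cons pop_nil pop_adj_nil XX vop_id eop_vop_terminus range_full.
by rewrite -[RHS]pop_terminus IH1.
Qed.

(** Write S_a for the operator of the first [a] edges. Shifting aligns the inner factors: S_a S_b^*
    S_c S_d^* becomes S_(a+c) S_(b+d)^*, an expression that is the same for the opposite order. *)
Lemma ray_commutes : corner_commutes w.
Proof.
move=> m n k l [wm wn mn] [wk wl kl] x.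
have [gm|gm] := pselect (good (wterm w m)); last by rewrite !(gop_not_good _ _ gm) bop0.
have [gk|gk] := pselect (good (wterm w k)); last by rewrite !(gop_not_good _ _ gk) bop0.
have [_ ini _] := wX.
have gn : good (wterm w n) by rewrite -mn.
have gl : good (wterm w l) by rewrite -kl.
move: mn kl; rewrite (ini _ wm gm) (ini _ wn gn) (ini _ wk gk) (ini _ wl gl).
rewrite -!/(Xm _); move: (size m) (size n) (size k) (size l) => a b c d ab cd.
have [ab1 ab2] := shift c ab; have [cd1 cd2] := shift b cd.
have [ab3 ab4] := shift d ab; have [cd3 cd4] := shift a cd.
rewrite -ab2 -cd2 (addnC c b) gop_mul//.
rewrite -cd4 -ab4 (addnC d a) gop_mul//; last by rewrite (addnC a d).
by rewrite (addnC c a) (addnC b d).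
Qed.

End Ray.

(** * From a one-dimensional corner to compactness *)

Hypothesis hM : condition_M E.

Lemma exists_one_dim : exists w h, one_dim w h.
Proof.
have [v [x vx]] := exists_vop_neq0.
have [|w gw ww] := @rigid_or_ray E hM good good_origin v; first by exists x.
exists w; apply: corner_one_dim => //.
by case: ww => [|[X]]; [exact: rigid_commutes|exact: ray_commutes].
Qed.

(** s_n embeds the range of the projection at the end of [n] into the line of [h], and s_n^* undoes
    the embedding. *)
Lemma one_dim_source w h n : one_dim w h -> walk w n -> bop_adj (pop w n) h != 0 ->
  one_dim (wterm w n) (bop_adj (pop w n) h).
Proof.
move=> [wh h0 hP] wn nh; split=> //; first by rewrite pop_adj_terminus.
move=> x xn; have [|c cP] := hP (pop w n x); first by rewrite pop_origin.
by exists c; rewrite -bopZ -cP pop_source.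
Qed.

Lemma finite_vop_tboperator v (G : set H) (l : seq H) :
  (forall x, cspan G (vop v x)) -> G `<=` cspan [set` l] -> tboperator (vop v).
Proof.
move=> Gv Gl; apply: (@finite_rank_tboperator _ _ _ l) => x.
exact: cspan_min (cspan_subspace _) Gl _ (Gv x).
Qed.

(** The case of a vector that cannot be continued: the sum relation forces [u] to be singular, and
    the range of p_v is spanned by the s_m h for the paths [m] from [v] to [u], finitely many by
    (M). *)
Lemma source_vop_tboperator u h : vop u h = h -> h != 0 ->
  (forall e, origin e = u -> bop_adj (eop e) h = 0) ->
  forall v, tboperator (vop v).
Proof.
move=> uh h0 ah v.
have su : singular u.
  apply: contrapT => /nonsingular_vop0/(_ ah); rewrite uh => hE.
  by rewrite hE eqxx in h0.
have [l lP] := finite_paths_to_singular hM v su.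
apply: (@finite_vop_tboperator v (rooted_at (fun u' y => u' = u /\ y = h) v)
  [seq pop v m h | m <- l]).
  apply: rooted_at_cspan => [u' y [-> ->]//|u' y e [-> ->] /ah|]; first by left.
  by exists u, h.
move=> _ [m [_ [vm [mu ->] ->]]]; apply: sub_cspan => /=.
by apply: map_f; exact: lP.
Qed.

Section OneDimensionalRay.
Variables (w : vertex E) (h : H) (wh : one_dim w h).
Variable X : nat -> edge E.
Hypothesis Xw : forall k, walk w (mkseq X k).

Let eta k := bop_adj (pop w (mkseq X k)) h.

Hypothesis eta0 : forall k, eta k != 0.

Let XmS k : mkseq X k.+1 = mkseq X k ++ [:: X k].
Proof. by rewrite mkseqS cats1. Qed.

Let X_origin k : origin (X k) = wterm w (mkseq X k).
Proof. by have := Xw k.+1; rewrite XmS walk_cat /= => /andP[_ /andP[/eqP]]. Qed.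

Let Xp : infinite_path X.
Proof. by move=> k; rewrite X_origin XmS wterm_cat. Qed.

Let eta_one_dim k : one_dim (origin (X k)) (eta k).
Proof. by rewrite X_origin; exact: one_dim_source wh (Xw k) (eta0 k). Qed.

Let etaS k : bop_adj (eop (X k)) (eta k) = eta k.+1.
Proof.
rewrite /eta XmS pop_adj_cat; last by rewrite -XmS.
by rewrite pop_adj_cons pop_adj_nil eop_adj_terminus.
Qed.

(** On a line, s_e s_e^* eta_k is a multiple c eta_k. The adjoint of the edge [X k] kills the left
    side but maps eta_k to eta_(k+1), which is not 0; so c = 0. *)
Let eta_next k e : origin e = origin (X k) -> e != X k -> bop_adj (eop e) (eta k) = 0.
Proof.
move=> oe eX; have [_ _ etaP] := eta_one_dim k.
have [|c cP] := etaP (eop e (bop_adj (eop e) (eta k))).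
  by rewrite -oe eop_origin.
have : bop_adj (eop (X k)) (c *: eta k) = 0 by rewrite -cP eop_adj_orth// eq_sym.
rewrite bopZ etaS => /eqP; rewrite scaler_eq0 (negPf (eta0 _)) orbF => /eqP c0.
by rewrite -eop_adj_terminus -eop_source cP c0 scale0r bop0.
Qed.

Let Q u : set H := [set y | exists2 k, u = origin (X k) & y = eta k].

Let eta_tail k r : exists2 c : R[i], c != 0 &
  pop (origin (X k)) (mkseq (fun i => X (k + i)%N) r) (eta (k + r)) = c *: eta k.
Proof.
set n := mkseq _ r.
have wn : walk (origin (X k)) n by have := Xw (k + r); rewrite mkseqD walk_cat X_origin => /andP[].
have adjn : bop_adj (pop (origin (X k)) n) (eta k) = eta (k + r).
  rewrite /eta mkseqD pop_adj_cat ?X_origin//.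
  by rewrite -mkseqD.
have tn : wterm (origin (X k)) n = origin (X (k + r)%N).
  by rewrite !X_origin mkseqD wterm_cat.
have [vr _ _] := eta_one_dim (k + r).
have [_ _ etaP] := eta_one_dim k.
have [|c cP] := etaP (pop (origin (X k)) n (eta (k + r))); first by rewrite pop_origin.
exists c => //; apply: contraNneq (eta0 (k + r)) => c0.
by rewrite -vr -tn -pop_source// cP c0 scale0r bop0.
Qed.

(* The ray meets each vertex in a line, so the vector [pop v m (eta k)] depends,
   up to scalars, only on the infinite path obtained by prefixing [m] to the
   [k]-th tail of [X]. *)
Lemma graft_collinear v m k m' k' : walk v m -> wterm v m = origin (X k) ->
  walk v m' -> wterm v m' = origin (X k') -> graft m k X = graft m' k' X ->
  exists c : R[i], pop v m (eta k) = c *: pop v m' (eta k').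
Proof.
move=> wm mX wm' mX' gE.
(* A non-zero scalar can be inverted, which makes the claim symmetric and allows the reduction to
   [size m <= size m']. *)
suff : exists2 c : R[i], c != 0 & pop v m (eta k) = c *: pop v m' (eta k').
  by move=> [c _ cP]; exists c.
wlog mm' : m k m' k' wm mX wm' mX' gE / (size m <= size m')%N.
  move=> wl; have [|/ltnW] := leqP (size m) (size m'); first exact: wl.
  move=> /(wl _ _ _ _ wm' mX' wm mX (esym gE))[c c0 ->].
  by exists c^-1; rewrite ?invr_eq0// scalerK.
pose r := (size m' - size m)%N.
have m'E : m' = m ++ mkseq (fun i => X (k + i)%N) r.
  have := graft_initial m' k' X; rewrite -gE => /[dup] h1 ->.
  rewrite -(subnKC mm') mkseqD -/r; congr (_ ++ _).
    exact/esym/(graft_initial m k X).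
  by apply: eq_mkseq => i; rewrite graft_shift.
have tr : wterm v m' = origin (X (k + r)%N).
  by rewrite m'E wterm_cat mX !X_origin mkseqD wterm_cat.
have [_ _ etaP] := eta_one_dim (k + r).
(* Both vectors lie in the range of the projection at the end of [m'], which is a line. *)
have [d dP] : exists d : R[i], eta k' = d *: eta (k + r).
  by apply: etaP; rewrite -tr mX'; have [] := eta_one_dim k'.
have d0 : d != 0 by apply: contraNneq (eta0 k') => d0; rewrite dP d0 scale0r.
have [c c0 cP] := eta_tail k r.
exists ((d * c)^-1); first by rewrite invr_eq0 mulf_neq0.
rewrite dP bopZ m'E pop_cat -?m'E// mX cP bopZ !scalerA -mulrA mulVf ?scale1r//.
by rewrite mulf_neq0.
Qed.

(** One representative vector is chosen for each infinite path. The spanning vectors are multiples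
    of representatives of grafts, and there are finitely many grafts from [v] by (M). *)
Lemma ray_vop_tboperator v : tboperator (vop v).
Proof.
have [l lP] := finite_grafts hM v Xp.
have /choice[rep repP] (f : nat -> edge E) : exists y : H, forall m k, walk v m ->
    wterm v m = origin (X k) -> graft m k X = f -> exists c : R[i], pop v m (eta k) = c *: y.
  have [[m [k [wm mk mf]]]|nex] := pselect (exists m k,
      [/\ walk v m, wterm v m = origin (X k) & graft m k X = f]).
    exists (pop v m (eta k)) => m' k' wm' mk' mf'.
    by apply: graft_collinear => //; rewrite mf.
  by exists 0 => m k wm mk mf; case: nex; exists m, k.
apply: (@finite_vop_tboperator v (rooted_at Q v) (map rep l)).
  apply: rooted_at_cspan => [u _ [k -> ->]|u _ e [k -> ->] oe|].
  - by have [] := eta_one_dim k.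
  - have [->|eX] := eqVneq e (X k); last by left; exact: eta_next.
    by right; rewrite etaS; exists k.+1.
  - by exists (origin (X 0%N)), (eta 0%N); split=> //; exists 0%N.
move=> _ [m [_ [wm [k mk ->] ->]]].
have [c ->] := repP _ _ _ wm mk erefl.
apply: (subspaceZ _ (cspan_subspace _)); apply: sub_cspan => /=.
exact: (map_f rep (lP _ _ wm mk)).
Qed.

End OneDimensionalRay.

Lemma vop_tboperator v : tboperator (vop v).
Proof.
have [w [h wh]] := exists_one_dim.
(* Either some s_n^* h is killed by the adjoints of all outgoing edges, or every non-zero s_n^* h
   can be continued by an edge, and choice produces a ray. *)
have [|/forallNP alive] := pselect (exists n, [/\ walk w n, bop_adj (pop w n) h != 0 &
    forall e, origin e = wterm w n -> bop_adj (eop e) (bop_adj (pop w n) h) = 0]).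
  move=> [n [wn nh dead]]; apply: source_vop_tboperator nh dead v.
  exact: pop_adj_terminus.
have /choice[next nextP] n : exists e, walk w n -> bop_adj (pop w n) h != 0 ->
    origin e = wterm w n /\ bop_adj (eop e) (bop_adj (pop w n) h) != 0.
  have [[wn nh]|] := pselect (walk w n /\ bop_adj (pop w n) h != 0); last first.
    (* [next] must return an edge even where nothing is claimed. In a graph without edges, the empty
       path would contradict [alive]. *)
    move=> nwn; have [[e _]|noe] := pselect (exists e : edge E, True).
      by exists e => wn nh; case: nwn.
    case: (alive [::]); split=> // [|e]; last by case: noe; exists e.
    by rewrite pop_adj_nil; have [-> ->] := wh.
  apply: contrapT => noe; apply: (alive n); split=> // e oe.
  by apply: contrapT => /eqP en; apply: noe; exists e.
pose P := fix P k := if k is k'.+1 then rcons (P k') (next (P k')) else [::].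
pose X k := next (P k).
have PX k : mkseq X k = P k.
  by elim: k => // k IH; rewrite mkseqS IH.
have Pok k : walk w (P k) /\ bop_adj (pop w (P k)) h != 0.
  elim: k => [|k [wk hk]].
    by split=> //=; rewrite pop_adj_nil; have [-> ->] := wh.
  have [oX X0] := nextP _ wk hk.
  have wS : walk w (P k ++ [:: next (P k)]) by rewrite walk_cat wk /= oX eqxx.
  rewrite /= -cats1; split=> //.
  by rewrite pop_adj_cat// pop_adj_cons pop_adj_nil eop_adj_terminus.
by apply: (ray_vop_tboperator wh (X := X)) => k; rewrite PX; have [] := Pok k.
Qed.

Lemma repr_tboperator a : tboperator (pi a).
Proof.
pose C a := tboperator (pi a).
have clC b : (forall e : R, 0 < e -> exists2 c, C c & rnorm (b - c) < e) -> C b.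
  move=> hb; apply: tboperator_lim => e /hb[c Cc bc]; exists (pi c) => // x x1.
  rewrite -(reprB pi_rep) (le_lt_trans _ bc)//.
  by rewrite (le_trans (repr_contractive pi_rep _ _))// ler_piMr ?rnorm_ge0.
have Cmul b c : C c -> C (cmul b c).
  move=> Cc; rewrite /C; have := tboperator_compl (repr_bop pi_rep b) Cc.
  congr tboperator; apply/funext => x; exact/esym/(reprM pi_rep).
(* Requiring compactness of the adjoint as well gives closure under the involution without
   Schauder's theorem. The generators qualify since s_e = s_e p_t(e). *)
suff CT : [set a | C a /\ C (cstar a)] = setT.
  by have : setT a by []; rewrite -CT => -[].
apply: (graph_algebra_generated hA) => [|v|e].
- split.
  + apply/closed_rnormP => b hb; split; apply: clC => e /hb[c [Cc Cc'] bc].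
      by exists c.
    by exists (cstar c) => //; rewrite -cstarB rnorm_star.
  + have C0 : C 0.
      rewrite /C (_ : (pi 0 : H -> H) = fun=> 0); first exact: tboperator0.
      by apply/funext => x; rewrite (repr0 pi_rep).
    by rewrite /= cstar0.
  + have Clin (c : R[i]) (b d : A) : C b -> C d -> C (c *: b + d).
      move=> Cb Cd; rewrite /C; have := tboperator_linear c Cb Cd.
      by congr tboperator; apply/funext => z; rewrite (repr_linear pi_rep).
    move=> c b d [Cb Cb'] [Cd Cd']; split; first exact: Clin.
    by rewrite cstar_antilinear; exact: Clin.
  + move=> b d [Cb Cb'] [Cd Cd']; split; first exact: Cmul.
    by rewrite cstarM; exact: Cmul.
  + by move=> b [Cb Cb']; split=> //; rewrite cstarK.
- by rewrite /= (CK_proj hCK v).2; split; exact: vop_tboperator.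
- split.
    rewrite /C; have := tboperator_compl (eop e) (@vop_tboperator (terminus e)).
    by congr tboperator; apply/funext => x; exact: eop_vop_terminus.
  rewrite /C; have := @tboperator_compr _ _ (vop (terminus e)) (bop_adj (eop e))
    (@vop_tboperator (terminus e)).
  by congr tboperator; apply/funext => x; rewrite /= eop_adj_terminus eop_adjE.
Qed.

End GraphOperators.

Lemma condition_M_liminal (R : realType) (E : digraph) (A : cstarAlgType R)
    (p : vertex E -> A) (s : edge E -> A) (hA : graph_algebra p s) :
  condition_M E -> liminal A.
Proof.
move=> hM H pi pi_rep pi_irr a; apply/compact_operatorP.
exact: (repr_tboperator hA pi_rep pi_irr hM).
Qed.

(** * Square-summable functions *)

Lemma real_rcauchy_cvg (R : realType) (u : nat -> R) :
  (forall e, 0 < e -> exists N, forall m n, (N <= m)%N -> (N <= n)%N -> `|u m - u n| < e) ->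
  exists l, forall e, 0 < e -> exists N, forall n, (N <= n)%N -> `|u n - l| < e.
Proof.
move=> uc.
have /cvg_ex[l ul] : cvg (u @ \oo).
  apply/cauchy_cvgP/cauchyP => e /uc[N h].
  by exists (u N); exists N => // n /= Nn; rewrite /ball/= h.
exists l => e e0; have /cvgrPdist_lt/(_ _ e0)[N _ h] := ul.
by exists N => n /h /=; rewrite distrC.
Qed.

Lemma complex_rcauchy_cvg (R : realType) (u : nat -> R[i]) :
  (forall e, 0 < e -> exists N, forall m n, (N <= m)%N -> (N <= n)%N -> cmod (u m - u n) < e) ->
  exists l, forall e, 0 < e -> exists N, forall n, (N <= n)%N -> cmod (u n - l) < e.
Proof.
move=> uc.
have Im_le (c : R[i]) : `|complex.Im c| <= cmod c.
  by rewrite -lecR -cmodE normc_def lecR -{1}sqrtr_sqr ler_wsqrtr// lerDr sqr_ge0.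
have [|a aP] := @real_rcauchy_cvg R (fun n => complex.Re (u n)).
  move=> e /uc[N h]; exists N => m n Nm Nn; apply: le_lt_trans (h _ _ Nm Nn).
  by rewrite -ReN -ReD; exact: Re_le_cmod.
have [|b bP] := @real_rcauchy_cvg R (fun n => complex.Im (u n)).
  move=> e /uc[N h]; exists N => m n Nm Nn; apply: le_lt_trans (h _ _ Nm Nn).
  rewrite (_ : _ - _ = complex.Im (u m - u n)); first exact: Im_le.
  by case: (u m) => ? ?; case: (u n).
exists (a +i* b)%C => e e0; have e2 : 0 < e / 2 by rewrite divr_gt0.
have [N1 h1] := aP _ e2; have [N2 h2] := bP _ e2.
exists (maxn N1 N2) => n; rewrite geq_max => /andP[/h1 {}h1 /h2 {}h2].
have -> : u n - (a +i* b)%C = (complex.Re (u n) - a)%:C + 'i%C * (complex.Im (u n) - b)%:C.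
  by rewrite [LHS]complexE; case: (u n).
rewrite (le_lt_trans (cmodD _ _))// cmodM !cmodR.
by rewrite {1}/cmod complexiE normCi mul1r [ltRHS]splitr ltrD.
Qed.

Section NetSums.
Variables (R : realType) (T : choiceType).
Implicit Types (f g : T -> R[i]) (l : seq T).

(* Unconditional summation, as the limit along finite subsets of [T]. *)
Definition sums_to f (c : R[i]) := forall e : R, 0 < e -> exists l0 : seq T,
  forall l, uniq l -> {subset l0 <= l} -> cmod (\sum_(t <- l) f t - c) < e.

Lemma sums_to_unique f c d : sums_to f c -> sums_to f d -> c = d.
Proof.
move=> fc fd; apply/eqP; rewrite -subr_eq0 -cmod_eq0 eq_le cmod_ge0 andbT.
apply/ler_addgt0Pr => e e0; rewrite add0r; have e2 : 0 < e / 2 by rewrite divr_gt0.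
have [l1 h1] := fc _ e2; have [l2 h2] := fd _ e2.
pose l := undup (l1 ++ l2).
have {}h1 := h1 l (undup_uniq _); have {}h2 := h2 l (undup_uniq _).
have -> : c - d = (\sum_(t <- l) f t - d) - (\sum_(t <- l) f t - c).
  by rewrite opprB [RHS]addrC addrA subrK.
rewrite (le_trans (cmodD _ _))// cmodN [leRHS]splitr lerD// ltW//.
  by apply: h2 => t tl; rewrite mem_undup mem_cat tl orbT.
by apply: h1 => t tl; rewrite mem_undup mem_cat tl.
Qed.

Lemma sums_to_linear (a : R[i]) f g c d :
  sums_to f c -> sums_to g d -> sums_to (fun t => a * f t + g t) (a * c + d).
Proof.
move=> fc gd e e0; have a1 : 0 < cmod a + 1 by rewrite ltr_wpDl ?cmod_ge0.
have [|l1 h1] := fc (e / 2 / (cmod a + 1)); first by rewrite !divr_gt0.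
have [|l2 h2] := gd (e / 2); first by rewrite divr_gt0.
exists (l1 ++ l2) => l ul ll.
have {}h1 : cmod (\sum_(t <- l) f t - c) < e / 2 / (cmod a + 1).
  by apply: h1 => // t tl; apply: ll; rewrite mem_cat tl.
have {}h2 : cmod (\sum_(t <- l) g t - d) < e / 2.
  by apply: h2 => // t tl; apply: ll; rewrite mem_cat tl orbT.
rewrite big_split/= -mulr_sumr opprD addrACA -mulrBr.
rewrite (le_lt_trans (cmodD _ _))// [ltRHS]splitr ler_ltD// cmodM.
move: h1; rewrite ltr_pdivlMr// => /ltW; apply: le_trans.
by rewrite mulrC ler_wpM2l ?cmod_ge0// lerDl.
Qed.

Lemma sums_to_conj f c : sums_to f c -> sums_to (fun t => Num.conj (f t)) (Num.conj c).
Proof.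
move=> fc e /fc[l0 h]; exists l0 => l ul ll.
by rewrite -rmorph_sum -rmorphB cmod_conj h.
Qed.

Lemma eq_sums_to f g c : f =1 g -> sums_to f c -> sums_to g c.
Proof. by move=> /funext->. Qed.

Definition sqsum (l : seq T) f : R := \sum_(t <- l) cmod (f t) ^+ 2.

Lemma sqsum_ge0 l f : 0 <= sqsum l f.
Proof. by apply: sumr_ge0 => t _; exact: sqr_ge0. Qed.

Lemma sqsum_sub l l' f : uniq l -> {subset l <= l'} -> sqsum l f <= sqsum l' f.
Proof.
move=> ul ll'; rewrite /sqsum.
have -> : \sum_(t <- l) cmod (f t) ^+ 2 = \sum_(t <- undup l' | t \in l) cmod (f t) ^+ 2.
  rewrite -[RHS]big_filter; apply: perm_big; apply: uniq_perm => //.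
    by rewrite filter_uniq ?undup_uniq.
  move=> t; rewrite mem_filter mem_undup; case: (boolP (t \in l)) => //= tl.
  by rewrite ll'.
have : \sum_(t <- undup l') cmod (f t) ^+ 2 <= \sum_(t <- l') cmod (f t) ^+ 2.
  elim: (l') => [//|t k IH] /=; case: ifP => tk; rewrite !big_cons.
    by rewrite (le_trans IH)// lerDr sqr_ge0.
  by rewrite lerD2l.
apply: le_trans; rewrite [leRHS](bigID (mem l))/= lerDl.
by apply: sumr_ge0 => t _; exact: sqr_ge0.
Qed.

Definition sqsummable : {pred T -> R[i]} :=
  fun f => `[< exists M, forall l, uniq l -> sqsum l f <= M >].

Lemma sqsum_linear_le l (a : R[i]) f g :
  sqsum l (a *: f + g) <= 2 * cmod a ^+ 2 * sqsum l f + 2 * sqsum l g.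
Proof.
rewrite /sqsum !mulr_sumr -big_split/=; apply: ler_sum => t _.
change (cmod (a * f t + g t) ^+ 2 <= 2 * cmod a ^+ 2 * cmod (f t) ^+ 2 + 2 * cmod (g t) ^+ 2).
have := cmodD (a * f t) (g t); rewrite cmodM => h.
have : cmod (a * f t + g t) ^+ 2 <= (cmod a * cmod (f t) + cmod (g t)) ^+ 2.
  by rewrite ler_pXn2r ?nnegrE ?cmod_ge0 ?addr_ge0 ?mulr_ge0 ?cmod_ge0.
have := sqr_ge0 (cmod a * cmod (f t) - cmod (g t)).
by nra.
Qed.

Fact sqsummable_submod_closed : submod_closed sqsummable.
Proof.
split.
  apply/asboolP; exists 0 => l _; rewrite /sqsum big1// => t _.
  by rewrite cmod0 expr0n.
move=> a f g /asboolP[M fM] /asboolP[N gN]; apply/asboolP.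
exists (2 * cmod a ^+ 2 * M + 2 * N) => l ul.
rewrite (le_trans (sqsum_linear_le _ _ _ _))// lerD// ?ler_wpM2l ?fM ?gN//.
by rewrite mulr_ge0 ?sqr_ge0.
Qed.

HB.instance Definition _ := GRing.isSubmodClosed.Build _ _ sqsummable
  sqsummable_submod_closed.

Record ell2 := Ell2 { ell2_fun :> T -> R[i]; _ : ell2_fun \in sqsummable }.

HB.instance Definition _ := [isSub for ell2_fun].
HB.instance Definition _ := [Choice of ell2 by <:].
HB.instance Definition _ := [SubChoice_isSubLmodule of ell2 by <:].

Implicit Types x y z : ell2.

Lemma ell2P x : exists M, forall l, uniq l -> sqsum l x <= M.
Proof. by case: x => f /= /asboolP. Qed.

Lemma ell2_eqP x y : x =1 y -> x = y.
Proof. by move=> xy; apply/val_inj/funext. Qed.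

Lemma ell2DE x y t : (x + y) t = x t + y t. Proof. by []. Qed.
Lemma ell2BE x y t : (x - y) t = x t - y t. Proof. by []. Qed.
Lemma ell2ZE (a : R[i]) x t : (a *: x) t = a * x t. Proof. by []. Qed.
Definition sqnorm x : R := sup [set sqsum l x | l in [set l | uniq l]].

Let has_sup_sqsum x : has_sup [set sqsum l x | l in [set l | uniq l]].
Proof.
split; first by exists (sqsum [::] x), [::].
by have [M xM] := ell2P x; exists M => _ [l ul <-]; exact: xM.
Qed.

Lemma sqsum_le x l : uniq l -> sqsum l x <= sqnorm x.
Proof. by move=> ul; apply: ub_le_sup; [case: (has_sup_sqsum x)|exists l]. Qed.

Lemma sqnorm_le x M : (forall l, uniq l -> sqsum l x <= M) -> sqnorm x <= M.
Proof.
move=> xM; apply: ge_sup; first by case: (has_sup_sqsum x).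
by move=> _ [l ul <-]; exact: xM.
Qed.

Lemma sqnorm_ge0 x : 0 <= sqnorm x.
Proof. by rewrite (le_trans _ (@sqsum_le x [::] isT))// sqsum_ge0. Qed.

Lemma sqnorm_approx x (e : R) : 0 < e -> exists2 l, uniq l & sqnorm x - e < sqsum l x.
Proof. by move=> e0; have [_ [l ul <-] h] := sup_adherent e0 (has_sup_sqsum x); exists l. Qed.

Lemma sqnorm_sums_to x : sums_to (fun t => x t * Num.conj (x t)) (sqnorm x)%:C.
Proof.
move=> e /(sqnorm_approx x)[l0 ul0 h]; exists l0 => l ul ll.
have -> : \sum_(t <- l) x t * Num.conj (x t) = (sqsum l x)%:C.
  by rewrite rmorph_sum; apply: eq_bigr => t _; rewrite cmodK.
rewrite -rmorphB cmodR distrC ger0_norm ?subr_ge0 ?sqsum_le//.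
by have := sqsum_sub x ul0 ll; move: h; lra.
Qed.

Lemma cmod_le_sqnorm x t : cmod (x t) ^+ 2 <= sqnorm x.
Proof. by have := @sqsum_le x [:: t] isT; rewrite /sqsum big_seq1. Qed.

Definition ell2norm x : R := Num.sqrt (sqnorm x).

Lemma sqr_ell2norm x : ell2norm x ^+ 2 = sqnorm x.
Proof. by rewrite sqr_sqrtr ?sqnorm_ge0. Qed.

Lemma ell2norm_ge0 x : 0 <= ell2norm x. Proof. exact: sqrtr_ge0. Qed.

Lemma cmod_le_ell2norm x t : cmod (x t) <= ell2norm x.
Proof.
rewrite -(ler_pXn2r (ltn0Sn 1)) ?nnegrE ?cmod_ge0 ?ell2norm_ge0//.
by rewrite sqr_ell2norm cmod_le_sqnorm.
Qed.

Let ell2norm_eq0' x : ell2norm x = 0 -> x = 0.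
Proof.
move=> x0; apply: ell2_eqP => t; apply/eqP.
by rewrite -cmod_eq0 eq_le cmod_ge0 -x0 cmod_le_ell2norm.
Qed.

Fact ell2norm_eq0 x : (ell2norm x)%:C = 0 -> x = 0.
Proof. by move=> /(@complexI R)/ell2norm_eq0'. Qed.

(* [|u + v|^2 <= (1 + b/a) |u|^2 + (1 + a/b) |v|^2], with [a] and [b] the norms
   of the two vectors, sums to the square of the triangle inequality. *)
Fact ell2normD x y : (ell2norm (x + y))%:C <= (ell2norm x)%:C + (ell2norm y)%:C.
Proof.
rewrite -rmorphD lecR.
have [x0|x0] := eqVneq (ell2norm x) 0.
  by rewrite (ell2norm_eq0' x0) add0r lerDr ell2norm_ge0.
have [y0|y0] := eqVneq (ell2norm y) 0.
  by rewrite (ell2norm_eq0' y0) addr0 lerDl ell2norm_ge0.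
have a0 : 0 < ell2norm x by rewrite lt_def x0 ell2norm_ge0.
have b0 : 0 < ell2norm y by rewrite lt_def y0 ell2norm_ge0.
rewrite -(ler_pXn2r (ltn0Sn 1)) ?nnegrE ?addr_ge0 ?ell2norm_ge0// sqr_ell2norm.
set a := ell2norm x in x0 a0 *; set b := ell2norm y in y0 b0 *.
have -> : (a + b) ^+ 2 = (1 + b / a) * a ^+ 2 + (1 + a / b) * b ^+ 2.
  by field; rewrite x0 y0.
apply: sqnorm_le => l ul.
have ba : 0 <= b / a by rewrite divr_ge0 ?ltW.
have ab : 0 <= a / b by rewrite divr_ge0 ?ltW.
rewrite (@le_trans _ _ ((1 + b / a) * sqsum l x + (1 + a / b) * sqsum l y))//; last first.
  by rewrite lerD// ler_wpM2l ?addr_ge0// sqr_ell2norm sqsum_le.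
rewrite /sqsum !mulr_sumr -big_split/=; apply: ler_sum => t _.
have h := cmodD (x t) (y t).
rewrite (@le_trans _ _ ((cmod (x t) + cmod (y t)) ^+ 2))//.
  by rewrite ler_pXn2r ?nnegrE ?addr_ge0 ?cmod_ge0.
set u := cmod (x t); set v := cmod (y t).
have := sqr_ge0 (b * u - a * v) => k.
rewrite -subr_ge0 (_ : _ - _ = (b * u - a * v) ^+ 2 / (a * b)).
  by rewrite divr_ge0// mulr_ge0// ltW.
by field; rewrite x0 y0.
Qed.

Let ell2normZ_le (c : R[i]) x : ell2norm (c *: x) <= cmod c * ell2norm x.
Proof.
rewrite -(ler_pXn2r (ltn0Sn 1)) ?nnegrE ?mulr_ge0 ?ell2norm_ge0 ?cmod_ge0//.
rewrite exprMn !sqr_ell2norm; apply: sqnorm_le => l ul.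
have -> : sqsum l (c *: x) = cmod c ^+ 2 * sqsum l x.
  rewrite /sqsum mulr_sumr; apply: eq_bigr => t _.
  by rewrite ell2ZE cmodM exprMn.
by rewrite ler_wpM2l ?sqr_ge0 ?sqsum_le.
Qed.

Fact ell2normZ (c : R[i]) x : (ell2norm (c *: x))%:C = `|c| * (ell2norm x)%:C.
Proof.
rewrite cmodE -rmorphM; congr (_%:C); apply/eqP; rewrite eq_le ell2normZ_le/=.
have [->|c0] := eqVneq c 0; first by rewrite cmod0 mul0r ell2norm_ge0.
have c1 : 0 < cmod c by rewrite lt_def cmod_ge0 cmod_eq0 c0.
rewrite mulrC -ler_pdivlMr// mulrC -[in leLHS](scalerK c0 x).
rewrite (le_trans (ell2normZ_le _ _))// ler_wpM2r ?ell2norm_ge0//.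
by rewrite -(ler_pM2l c1) -cmodM mulfV// cmod1 mulfV// gt_eqF.
Qed.

HB.instance Definition _ :=
  Lmodule_isNormed.Build R[i] ell2 ell2normD ell2normZ ell2norm_eq0.

Lemma rnorm_ell2 x : rnorm x = ell2norm x. Proof. by []. Qed.

Fact ell2_rcauchy (u : nat -> ell2) : rcauchy u -> exists x, rcvg u x.
Proof.
move=> uc.
have /choice[f fP] t : exists c, forall e, 0 < e ->
    exists N, forall n, (N <= n)%N -> cmod (u n t - c) < e.
  apply: complex_rcauchy_cvg => e /uc[N h]; exists N => m n Nm Nn.
  by rewrite -ell2BE (le_lt_trans (cmod_le_ell2norm _ _))// -rnorm_ell2 h.
(* Stated with finite sums, because [f] is not yet known to be square-summable. *)
have fbnd (e : R) : 0 < e -> exists N, forall n, (N <= n)%N ->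
    forall l, uniq l -> sqsum l (- f + u n) <= e.
  move=> e0; have e4 : 0 < e / 4 by rewrite divr_gt0.
  have [|N h] := uc (Num.sqrt (e / 4)); first by rewrite sqrtr_gt0.
  exists N => n Nn l ul.
  (* On the fixed finite list, [u m] is close to [f] for some large [m], which may depend on [l].
     Passing through it costs 2 (e/4) + 2 (e/4) = e. *)
  have [m Nm mf] : exists2 m, (N <= m)%N & sqsum l (- f + u m) <= e / 4.
    have lk k : exists M, forall m, (M <= m)%N ->
        sqsum k (- f + u m) <= (size k)%:R * (e / 4 / (size l).+1%:R).
      elim: k => [|t k [M IH]].
        by exists 0%N => m _; rewrite /sqsum big_nil mul0r.
      have [|M' M'P] := fP t (Num.sqrt (e / 4 / (size l).+1%:R)).
        by rewrite sqrtr_gt0 divr_gt0 ?ltr0n.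
      exists (maxn M M') => m; rewrite geq_max => /andP[/IH h1 /M'P h2].
      rewrite /sqsum big_cons -/(sqsum k _) /= -natr1 mulrDl mul1r addrC lerD//.
      change (cmod (- f t + u m t) ^+ 2 <= e / 4 / (size l).+1%:R).
      have d0 : 0 < e / 4 / (size l).+1%:R by rewrite divr_gt0 ?ltr0n.
      rewrite addrC -[leRHS]sqr_sqrtr ?(ltW d0)//.
      by rewrite ler_pXn2r ?nnegrE ?cmod_ge0 ?sqrtr_ge0// ltW.
    have [M MP] := lk l; exists (maxn M N); first exact: leq_maxr.
    rewrite (le_trans (MP _ (leq_maxl _ _)))// mulrA ler_pdivrMr ?ltr0n//.
    by rewrite mulrC ler_wpM2l ?(ltW e4)// ler_nat.
  have -> : - f + u n = 1 *: (u n - u m : T -> R[i]) + (- f + u m).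
    rewrite scale1r; apply/funext => t.
    change (- f t + u n t = (u n t - u m t) + (- f t + u m t)); ring.
  rewrite (le_trans (sqsum_linear_le _ _ _ _))// cmod1 expr1n mulr1.
  have : sqsum l (u n - u m) <= e / 4.
    rewrite (le_trans (@sqsum_le (u n - u m) l ul))// -sqr_ell2norm -rnorm_ell2.
    rewrite -[leRHS]sqr_sqrtr ?(ltW e4)// ler_pXn2r ?nnegrE ?rnorm_ge0 ?sqrtr_ge0//.
    by rewrite ltW// h.
  by move: mf; lra.
have fin : f \in sqsummable.
  have [N /(_ _ (leqnn N)) h] := fbnd 1 ltr01.
  have fu : - f + u N \in sqsummable by apply/asboolP; exists 1.
  rewrite -[f]opprK rpredN -[- f](addrK (u N : T -> R[i])) rpredB//.
  exact: valP.
exists (Ell2 fin) => e e0; have [|N h] := fbnd ((e / 2) ^+ 2).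
  by rewrite exprn_gt0// divr_gt0.
exists N => n Nn; rewrite rnorm_ell2 (@le_lt_trans _ _ (e / 2))//; last lra.
rewrite -(ler_pXn2r (ltn0Sn 1)) ?nnegrE ?ell2norm_ge0 ?divr_ge0 ?(ltW e0)// sqr_ell2norm.
apply: sqnorm_le => l ul; have := h n Nn l ul.
by rewrite (_ : - f + u n = u n - Ell2 fin)//; apply/funext => t /=; rewrite addrC.
Qed.

HB.instance Definition _ :=
  Uniform_isComplete.Build ell2 (rcauchy_complete ell2_rcauchy).

(** Polarisation reduces the product to four summable squares. The last block in [h] adds up to 0;
    it supplies the second argument of the outer [sums_to_linear]. *)
Lemma ell2_summable x y : exists c, sums_to (fun t => x t * Num.conj (y t)) c.
Proof.
have h := sums_to_linear (4^-1) (sums_to_linear 'i (sums_to_linear (-1)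
  (sqnorm_sums_to (x - 'i *: y)) (sqnorm_sums_to (x + 'i *: y)))
  (sums_to_linear (-1) (sqnorm_sums_to (x - y)) (sqnorm_sums_to (x + y))))
  (sums_to_linear 0 (sqnorm_sums_to x) (sums_to_linear (-1) (sqnorm_sums_to x) (sqnorm_sums_to x))).
eexists; apply: eq_sums_to h => t.
have polar (a b : R[i]) : 4^-1 * ('i * (-1 * ((a - 'i * b) * Num.conj (a - 'i * b)) +
      (a + 'i * b) * Num.conj (a + 'i * b)) +
    (-1 * ((a - b) * Num.conj (a - b)) + (a + b) * Num.conj (a + b))) +
    (0 * (a * Num.conj a) + (-1 * (a * Num.conj a) + a * Num.conj a)) = a * Num.conj b.
  rewrite !(rmorphB, rmorphD, rmorphM)/= conjCi.
  have := @sqrCi R[i].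
  move: (Num.conj a) (Num.conj b) ('i : R[i]) => a' b' j jj.
  rewrite [LHS](_ : _ = 4^-1 * (j ^+ 2 * (2 * (b * a' - a * b')) + 2 * (a * b' + b * a'))).
    by rewrite jj; field.
  by ring.
rewrite !(ell2BE, ell2DE, ell2ZE); exact: polar.
Qed.

Definition ell2_inner x y : R[i] := sval (cid (ell2_summable x y)).

Lemma ell2_innerP x y : sums_to (fun t => x t * Num.conj (y t)) (ell2_inner x y).
Proof. by rewrite /ell2_inner; case: cid. Qed.

Lemma ell2_inner_unique x y c :
  sums_to (fun t => x t * Num.conj (y t)) c -> ell2_inner x y = c.
Proof. exact: sums_to_unique (ell2_innerP x y). Qed.

Lemma ell2_innerxx x : ell2_inner x x = (sqnorm x)%:C.
Proof. exact/ell2_inner_unique/sqnorm_sums_to. Qed.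

Fact ell2_inner_linearl y : linear_for *%R (ell2_inner^~ y).
Proof.
move=> a x x'; apply: ell2_inner_unique.
apply: eq_sums_to (sums_to_linear a (ell2_innerP x y) (ell2_innerP x' y)) => t.
by rewrite ell2DE ell2ZE mulrDl mulrA.
Qed.

Fact ell2_inner_herm x y : ell2_inner x y = (-1) ^+ false * Num.conj (ell2_inner y x).
Proof.
rewrite expr0 mul1r; apply: ell2_inner_unique.
apply: eq_sums_to (sums_to_conj (ell2_innerP y x)) => t.
by rewrite rmorphM/= conjCK mulrC.
Qed.

Fact ell2_inner_linearr x : linear_for (Num.conj \; *%R) (ell2_inner x).
Proof.
move=> a y y'; rewrite !(ell2_inner_herm x) !expr0 !mul1r ell2_inner_linearl.
by rewrite rmorphD rmorphM.
Qed.

HB.instance Definition _ := bilinear_isBilinear.Build R[i] ell2 ell2 R[i]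
  (GRing.Scale.Law.clone _ _ *%R _) (GRing.Scale.Law.clone _ _ (Num.conj \; *%R) _)
  ell2_inner (ell2_inner_linearl, ell2_inner_linearr).

HB.instance Definition _ := isHermitianSesquilinear.Build R[i] ell2 false Num.conj
  ell2_inner ell2_inner_herm.

Fact ell2_inner_gt0 x : x != 0 -> 0 < ell2_inner x x.
Proof.
move=> x0; rewrite ell2_innerxx ltcR lt_def sqnorm_ge0 andbT -sqr_ell2norm sqrf_eq0.
by apply: contra_neq x0; exact: ell2norm_eq0'.
Qed.

HB.instance Definition _ := isDotProduct.Build R[i] ell2 ell2_inner ell2_inner_gt0.

Fact ell2_inner_norm x : `|x| ^+ 2 = ell2_inner x x.
Proof. by rewrite ell2_innerxx -sqr_ell2norm normE rmorphXn. Qed.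

HB.instance Definition _ :=
  CompleteNormedModule_isHilbert.Build R ell2 ell2_inner_norm.

Lemma innerE x y : inner x y = ell2_inner x y. Proof. by []. Qed.

End NetSums.

(** * Operators induced by partial bijections *)

Lemma sum_single (V : nmodType) (T : eqType) (l : seq T) t (F : T -> V) : uniq l ->
  \sum_(s <- l) (if s == t then F s else 0) = if t \in l then F t else 0.
Proof.
move=> ul; rewrite -big_mkcond -big_filter; case: ifPn => tl.
  by rewrite (filter_pred1_uniq ul tl) big_seq1.
rewrite (_ : [seq s <- l | s == t] = [::]) ?big_nil//.
by apply/eqP; rewrite -[_ == _]negbK -has_filter; apply: contra tl => /hasP[s sl /eqP<-].
Qed.

Section PullOperators.
Variables (R : realType) (T : choiceType).
Implicit Types (x y : ell2 R T) (l : seq T) (g : T -> option T).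

Definition partial_inverse g g' := forall t t', g t = Some t' <-> g' t' = Some t.

Lemma partial_inverse_sym g g' : partial_inverse g g' -> partial_inverse g' g.
Proof. by move=> gg t t'; rewrite gg. Qed.

(** For a partial bijection this moves the basis vector at [g t] to the one at [t]; vertex
    projections and edge operators on boundary paths are both of this kind. *)
Definition pull g (f : T -> R[i]) t : R[i] := if g t is Some t' then f t' else 0.

Lemma sum_pull g (F : T -> R[i]) l :
  \sum_(t <- l) pull g F t = \sum_(t <- pmap g l) F t.
Proof.
elim: l => [|t l IH]; first by rewrite !big_nil.
rewrite big_cons IH /pull /=; case: (g t) => [t'|] /=; last by rewrite add0r.
by rewrite big_cons.
Qed.

Lemma sqsum_pull g (f : T -> R[i]) l : sqsum l (pull g f) = sqsum (pmap g l) f.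
Proof.
rewrite /sqsum; elim: l => [|t l IH]; first by rewrite !big_nil.
rewrite big_cons IH /pull /=; case: (g t) => [t'|] /=.
  by rewrite big_cons.
by rewrite cmod0 expr0n add0r.
Qed.

Lemma pmap_partial_uniq g g' l : partial_inverse g g' -> uniq l -> uniq (pmap g l).
Proof.
move=> gg; apply: (@pmap_uniq _ _ g (fun t' => odflt t' (g' t'))) => t.
by case gt: (g t) => [t'|] //=; move/gg: gt => ->.
Qed.

Section PullOperator.
Variables (g g' : T -> option T) (gg : partial_inverse g g').

Fact pull_sqsummable x : pull g x \in @sqsummable R T.
Proof.
apply/asboolP; have [M xM] := ell2P x; exists M => l ul.
by rewrite sqsum_pull xM// (pmap_partial_uniq gg).
Qed.

Definition pull_ell2 x : ell2 R T := Ell2 (pull_sqsummable x).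

Lemma rbounded_pull : rbounded pull_ell2 1.
Proof.
move=> x; rewrite mul1r !rnorm_ell2 -(ler_pXn2r (ltn0Sn 1)) ?nnegrE ?ell2norm_ge0//.
rewrite !sqr_ell2norm; apply: sqnorm_le => l ul.
by rewrite sqsum_pull sqsum_le// (pmap_partial_uniq gg).
Qed.

End PullOperator.

Lemma pull_adjoint g g' (gg : partial_inverse g g') :
  adjoint_of (pull_ell2 gg) (pull_ell2 (partial_inverse_sym gg)).
Proof.
move=> x y; rewrite !innerE; apply: ell2_inner_unique => e e0.
have [l0 h] := ell2_innerP x (pull_ell2 gg y) e0.
exists (pmap g l0) => l ul ll.
(* The net sum on the other side needs a list containing [l0]. The indices that must be added to
   [pmap g' l] lie outside the domain of [g] and contribute 0. *)
have zl : {in [seq t <- undup l0 | t \notin pmap g' l], forall t,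
    x t * Num.conj (pull_ell2 gg y t) = 0}.
  move=> t; rewrite mem_filter mem_undup => /andP[tl tl0].
  rewrite /= /pull; case gt: (g t) => [t'|]; last by rewrite conjC0 mulr0.
  case/negP: tl; rewrite mem_pmap; apply/mapP; exists t'; last by symmetry; apply/gg.
  by apply: ll; rewrite mem_pmap -gt map_f.
have -> : \sum_(t <- l) pull_ell2 (partial_inverse_sym gg) x t * Num.conj (y t) =
    \sum_(t <- pmap g' l ++ [seq t <- undup l0 | t \notin pmap g' l])
      x t * Num.conj (pull_ell2 gg y t).
  rewrite big_cat /= [X in _ + X]big_seq [X in _ + X]big1 ?addr0//.
  rewrite -(sum_pull g' (fun t => x t * Num.conj (pull_ell2 gg y t))).
  apply: eq_bigr => t _; rewrite /= /pull; case gt: (g' t) => [t'|]; last by rewrite mul0r.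
  by move/gg: gt => ->.
apply: h.
  rewrite cat_uniq (pmap_partial_uniq (partial_inverse_sym gg) ul) filter_uniq ?undup_uniq// andbT.
  by apply/hasPn => t; rewrite mem_filter => /andP[].
move=> t tl0; rewrite mem_cat; case: (boolP (t \in pmap g' l)) => //= tl.
by rewrite mem_filter tl mem_undup.
Qed.

Fact pull_adjointable g g' (gg : partial_inverse g g') :
  pull_ell2 gg \in adjointable (H := ell2 R T).
Proof.
apply/asboolP; split; first by exists 1; exact: rbounded_pull.
by exists (pull_ell2 (partial_inverse_sym gg)); exact: pull_adjoint.
Qed.

Definition pull_bop g g' (gg : partial_inverse g g') : bop (ell2 R T) :=
  Bop (pull_adjointable gg).

Lemma pull_bopE g g' (gg : partial_inverse g g') x t :
  pull_bop gg x t = if g t is Some t' then x t' else 0.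
Proof. by []. Qed.

Lemma pull_bop_adjE g g' (gg : partial_inverse g g') x t :
  bop_adj (pull_bop gg) x t = if g' t is Some t' then x t' else 0.
Proof.
have -> // : bop_adj (pull_bop gg) = pull_bop (partial_inverse_sym gg).
by apply: bop_adj_unique; exact: pull_adjoint.
Qed.

Lemma sqsum_delta t l : uniq l -> sqsum l (fun s => (s == t)%:R : R[i]) <= 1.
Proof.
move=> ul; rewrite /sqsum (eq_bigr (fun s => if s == t then 1 else 0)); last first.
  by move=> s _; case: eqP => _; rewrite ?cmod1 ?cmod0 ?expr1n ?expr0n.
by rewrite sum_single//; case: ifP.
Qed.

Fact delta_sqsummable t : (fun s => (s == t)%:R) \in @sqsummable R T.
Proof.
by apply/asboolP; exists 1 => l; exact: sqsum_delta.
Qed.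

Definition delta t : ell2 R T := Ell2 (delta_sqsummable t).

Lemma deltaE t s : delta t s = (s == t)%:R. Proof. by []. Qed.

Lemma rnorm_delta_le1 t : rnorm (delta t) <= 1.
Proof.
rewrite rnorm_ell2 -(ler_pXn2r (ltn0Sn 1)) ?nnegrE ?ell2norm_ge0// expr1n sqr_ell2norm.
by apply: sqnorm_le => l; exact: sqsum_delta.
Qed.

Lemma rnorm_delta_sub t t' : t != t' -> 1 <= rnorm (delta t - delta t').
Proof.
move=> tt'; apply: le_trans (cmod_le_ell2norm (delta t - delta t') t).
by rewrite ell2BE !deltaE eqxx (negPf tt') subr0 cmod1.
Qed.

(** Serves twice: for the density of finite combinations of basis vectors, and to cut a vector down
    to a single coordinate up to [e]. *)
Lemma ell2_tail x (e : R) : 0 < e -> exists l : seq T, forall y,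
  (forall t, t \in l -> y t = 0) -> (forall t, y t = 0 \/ y t = x t) -> rnorm y < e.
Proof.
move=> e0; have [|l ul h] := @sqnorm_approx _ _ x ((e / 2) ^+ 2).
  by rewrite exprn_gt0// divr_gt0.
exists l => y yl yx; rewrite rnorm_ell2 (@le_lt_trans _ _ (e / 2))//; last lra.
rewrite -(ler_pXn2r (ltn0Sn 1)) ?nnegrE ?ell2norm_ge0 ?divr_ge0 ?(ltW e0)// sqr_ell2norm.
apply: sqnorm_le => k uk.
have : sqsum k y <= sqsum [seq t <- k | t \notin l] x.
  rewrite /sqsum big_filter [leRHS]big_mkcond; apply: ler_sum => t _.
  case: ifPn => [_|/negbNE tl]; last by rewrite yl// cmod0 expr0n.
  by case: (yx t) => ->//; rewrite cmod0 expr0n sqr_ge0.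
have : sqsum (l ++ [seq t <- k | t \notin l]) x <= sqnorm x.
  apply: sqsum_le; rewrite cat_uniq ul filter_uniq// andbT.
  by apply/hasPn => t; rewrite mem_filter => /andP[].
rewrite {1}/sqsum big_cat -!/(sqsum _ _) /=; move: h; lra.
Qed.

Lemma ell2_sumE (I : Type) (r : seq I) (F : I -> ell2 R T) t :
  (\sum_(i <- r) F i) t = \sum_(i <- r) F i t.
Proof. by elim: r => [|i r IH]; rewrite ?big_nil// !big_cons ell2DE IH. Qed.

Lemma delta_total (V : set (ell2 R T)) : closed_subspace V ->
  (forall t, V (delta t)) -> V = setT.
Proof.
move=> [/closed_rnormP clV V0 VL] Vd; apply/seteqP; split=> // x _.
apply: clV => e /(ell2_tail x)[l lP].
exists (\sum_(t <- undup l) x t *: delta t).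
  by elim: (undup l) => [|t k IH]; rewrite ?big_nil// big_cons; exact: VL.
have sumE t : (\sum_(s <- undup l) x s *: delta s) t = if t \in l then x t else 0.
  rewrite ell2_sumE (eq_bigr (fun s => if s == t then x s else 0)).
    by rewrite sum_single ?undup_uniq// mem_undup.
  by move=> s _; rewrite ell2ZE deltaE eq_sym; case: eqP => _; rewrite ?mulr1 ?mulr0.
apply: lP => t => [tl|]; rewrite ell2BE sumE; first by rewrite tl subrr.
by case: ifP; [left; rewrite subrr|right; rewrite subr0].
Qed.

End PullOperators.

(** * Concatenation of boundary paths *)

Lemma exists_partial_fun (A B : Type) (G : A -> B -> Prop) :
  (forall a b b', G a b -> G a b' -> b = b') ->
  exists g : A -> option B, forall a b, g a = Some b <-> G a b.
Proof.
move=> Gf; have /choice[g gP] a : exists o : option B, forall b, o = Some b <-> G a b.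
  have [[b Gab]|nG] := pselect (exists b, G a b).
    by exists (Some b) => b'; split=> [[<-]//|/(Gf _ _ _ Gab)->].
  by exists None => b; split=> // Gab; case: nG; exists b.
by exists g.
Qed.

HB.instance Definition _ (E : digraph) := gen_eqMixin (boundary_path E).
HB.instance Definition _ (E : digraph) := gen_choiceMixin (boundary_path E).

Section BoundarySequences.
Local Open Scope nat_scope.
Variable E : digraph.
Implicit Types (x y z : boundary_path E) (e : edge E).

(** Finite and infinite paths are read alike as partial sequences, so that [step] is defined without
    distinguishing them. The origin is kept apart since a path of length 0 has no edge recording
    it. *)
Definition bedge y (i : nat) : option (edge E) :=
  match y with
  | Defs.Infinite q => Some (ipath_edge q i)
  | Defs.Finite q _ => onth (fpath_edges q) i
  end.

Lemma eq_from_onth (m n : seq (edge E)) : onth m =1 onth n -> m = n.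
Proof.
elim: m n => [|a m IH] [|b n] mn //; try by have := mn 0.
have [->] := mn 0; congr (_ :: _); apply: IH => i; exact: (mn i.+1).
Qed.

Lemma boundary_eq y z : boundary_origin y = boundary_origin z -> bedge y =1 bedge z -> y = z.
Proof.
case: y z => [[q Hq]|[v m wm] Hm] [[r Hr]|[w n wn] Hn] /= yz.
- move=> qr; have qrE : q = r by apply/funext => i; have [] := qr i.
  by case: r / qrE Hr {yz qr} => Hr; rewrite (Prop_irrelevance Hq Hr).
- by move=> /(_ (size n)) /=; rewrite onth_default.
- by move=> /(_ (size m)) /=; rewrite onth_default.
- move=> /eq_from_onth /= mn; case: w / yz wn Hn => wn Hn.
  case: n / mn wn Hn => wn; rewrite (Prop_irrelevance wn wm) => Hn.
  by rewrite (Prop_irrelevance Hn Hm).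
Qed.

(* [step e y' y] says that [y] is the concatenation of [e] and [y']. *)
Definition step e y' y : Prop :=
  [/\ boundary_origin y = origin e, boundary_origin y' = terminus e,
      bedge y 0 = Some e & forall i, bedge y i.+1 = bedge y' i].

Lemma step_tail_unique e y y1 y2 : step e y1 y -> step e y2 y -> y1 = y2.
Proof.
move=> [_ o1 _ h1] [_ o2 _ h2]; apply: boundary_eq; first by rewrite o1 o2.
by move=> i; rewrite -h1 -h2.
Qed.

Lemma step_cons_unique e y y1 y2 : step e y y1 -> step e y y2 -> y1 = y2.
Proof.
move=> [w1 _ h1 t1] [w2 _ h2 t2]; apply: boundary_eq; first by rewrite w1 w2.
by case=> [|i]; rewrite ?h1 ?h2 ?t1 ?t2.
Qed.

Lemma step_equiv e x y' y : step e y' y -> boundary_equiv x y' <-> boundary_equiv x y.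
Proof.
case: y' y => [q'|[v' m' wm'] Hm'] [q|[v m wm] Hm] [/= ov tv h0 hS].
- case: x => [r|r _] //=; split=> [] [j [k jk]].
    exists j, k.+1 => i; rewrite jk addSn.
    by have [] := hS (k + i).
  exists j.+1, k => i; rewrite addSn -addnS jk addnS.
  by have [] := hS (k + i).
- have : onth m (size m).+1 = Some (ipath_edge q' (size m)) := hS (size m).
  by rewrite onth_default.
- by have /= := hS (size m'); rewrite onth_default.
- case: x => [r|r _] //=.
  case: m wm Hm h0 hS => [//|f m] wm Hm [fe] /= hS.
  have mE : m = m' by exact: eq_from_onth.
  by rewrite /fpath_terminus /= tv mE fe.
Qed.

Lemma exists_step_cons e y' : boundary_origin y' = terminus e -> exists y, step e y' y.
Proof.
case: y' => [[q Hq]|[v m wm] Hm] /= ov.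
  have Hq' n : terminus (if n is n'.+1 then q n' else e) = origin (q n).
    by case: n => [|n]; [rewrite ov|exact: Hq].
  by exists (Defs.Infinite (@IPath E (fun n => if n is n'.+1 then q n' else e) Hq')).
have wm' : walk (origin e) (e :: m) by rewrite /= eqxx -ov.
have Hm' : singular (fpath_terminus (FPath wm')).
  by rewrite /fpath_terminus /= -ov.
by exists (Defs.Finite Hm').
Qed.

Lemma exists_step_tail e y : bedge y 0 = Some e -> exists y', step e y' y.
Proof.
case: y => [[q Hq]|[v [//|f m] wm] Hm] /= [qe].
  exists (Defs.Infinite (@IPath E (fun n => q n.+1) (fun n => Hq n.+1))).
  by split=> //=; rewrite -qe ?Hq.
have := wm => /= /andP[/eqP fv wm'].
have Hm' : singular (fpath_terminus (FPath wm')) by [].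
by exists (Defs.Finite Hm'); split=> //=; rewrite -?qe ?fv.
Qed.

Lemma bedge_origin e y : bedge y 0 = Some e -> boundary_origin y = origin e.
Proof. by move=> /exists_step_tail[y' []]. Qed.

Lemma bedge_singular y : bedge y 0 = None -> singular (boundary_origin y).
Proof. by case: y => [//|[v [|//] wm] Hm] /= _. Qed.

Lemma boundary_equiv_refl y : boundary_equiv y y.
Proof. by case: y => //= q; exists 0, 0. Qed.

(** The equivalence is generated by removing or prepending one edge: infinite paths are shifted to
    their common tail, finite ones stripped down to the path of length 0 at their terminus. *)
Lemma boundary_equiv_ind (Phi : boundary_path E -> Prop) :
  (forall e y' y, step e y' y -> Phi y' <-> Phi y) ->
  forall x y z, boundary_equiv x y -> boundary_equiv x z -> Phi y -> Phi z.
Proof.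
move=> PhiS x y z xy xz.
suff h w : boundary_equiv x w -> Phi x <-> Phi w.
  by move=> /(h _ xy)/(h _ xz).
case: x w {y z xy xz} => [q|[u n wn] Hn] [r|[v m wm] Hm] //=.
  pose shift (q : ipath E) (k : nat) : boundary_path E :=
    Defs.Infinite (@IPath E (fun i => ipath_edge q (k + i))
      (fun i => etrans (ipath_walk q (k + i))
         (congr1 (fun j => origin (ipath_edge q j)) (esym (addnS k i))))).
  have shiftP (s : ipath E) k : Phi (Defs.Infinite s) <-> Phi (shift s k).
    elim: k => [|k IH].
      suff -> : shift s 0 = Defs.Infinite s by [].
      exact: boundary_eq.
    rewrite IH; symmetry; apply: (PhiS (ipath_edge s k)); split=> //=.
    - by rewrite addn0.
    - by rewrite addn0 ipath_walk.
    - by rewrite addn0.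
    - by move=> i; rewrite addSnnS.
  move=> [j [k jk]]; rewrite (shiftP q j) (shiftP r k).
  suff -> : shift q j = shift r k by [].
  by apply: boundary_eq => [|i] /=; rewrite jk.
rewrite /fpath_terminus /= => nm.
have trivP s k (ws : walk k s) (Hs : singular (fpath_terminus (FPath ws)))
    (Ht : singular (fpath_terminus (@FPath E (last k (map (@terminus E) s)) [::] isT))) :
    Phi (Defs.Finite Hs) <-> Phi (Defs.Finite Ht).
  elim: s k ws Hs Ht => [|f s IH] k ws Hs Ht.
    suff -> : Defs.Finite Hs = Defs.Finite Ht by [].
    exact: boundary_eq.
  have := ws => /= /andP[/eqP fk ws'].
  rewrite -(IH (terminus f) ws' Hs Ht); symmetry; apply: (PhiS f).
  by split=> //=; rewrite fk.
rewrite (trivP n u wn Hn Hn).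
have Hm' : singular (fpath_terminus (@FPath E (last v (map (@terminus E) m)) [::] isT)).
  exact: Hm.
rewrite (trivP m v wm Hm Hm').
suff -> : Defs.Finite (p := @FPath E (last u (map (@terminus E) n)) [::] isT) Hn = Defs.Finite Hm' by [].
exact: boundary_eq.
Qed.

End BoundarySequences.

(** * The representation on a class of boundary paths *)

HB.instance Definition _ (R : realType) (H : hilbertType R) (T : bop H) :=
  GRing.isLinear.Build R[i] H H *:%R (bop_fun T) (bop_linearP T).

Lemma bop_continuous (R : realType) (H : hilbertType R) (T : bop H) : continuous T.
Proof.
apply/bounded_linear_continuous/linear_boundedP.
exists (rnorm T)%:C; split; first by apply/complex_realP; exists (rnorm T).
move=> r Tr x; rewrite (le_trans _ (ler_wpM2r (normr_ge0 _) (ltW Tr)))//.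
by rewrite !normE -rmorphM lecR; exact: (@opnormP _ _ T).
Qed.

Lemma cmul_bopE (R : realType) (H : hilbertType R) (S T : bop H) x :
  cmul S T x = S (T x).
Proof. by []. Qed.

Lemma cstar_bopE (R : realType) (H : hilbertType R) (T : bop H) : cstar T = bop_adj T.
Proof. by []. Qed.

Lemma bop_sumE (R : realType) (H : hilbertType R) (I : Type) (r : seq I)
  (F : I -> bop H) x : (\sum_(i <- r) F i) x = \sum_(i <- r) F i x.
Proof. by elim: r => [|i r IH]; rewrite ?big_nil// !big_cons bopDE IH. Qed.

Section BoundaryRepresentation.
Variables (R : realType) (E : digraph) (x0 : boundary_path E).
Implicit Types (v : vertex E) (e : edge E).

Definition orbit : choiceType := {y : boundary_path E | `[< boundary_equiv x0 y >]}.
Implicit Types (t : orbit) (P : pred orbit) (x : ell2 R orbit).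

Definition org t : vertex E := boundary_origin (val t).
Definition hd t : option (edge E) := bedge (val t) 0.

Definition sel P t : option orbit := if P t then Some t else None.

Fact selK P : partial_inverse (sel P) (sel P).
Proof.
by move=> t t'; rewrite /sel; split; case: ifP => // Pt [<-]; rewrite Pt.
Qed.

Definition sel_bop P : bop (ell2 R orbit) := pull_bop R (selK P).

Lemma sel_bopE P x t : sel_bop P x t = if P t then x t else 0.
Proof. by rewrite pull_bopE /sel; case: ifP. Qed.

Lemma sel_bop_adj P : bop_adj (sel_bop P) = sel_bop P.
Proof. by apply: bop_eqP => x; apply: ell2_eqP => t; rewrite pull_bop_adjE. Qed.

Lemma orbit_step e y' y : step e y' y ->
  `[< boundary_equiv x0 y' >] = `[< boundary_equiv x0 y >].
Proof. by move=> /(step_equiv x0) h; apply/asbool_equiv_eq. Qed.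

Lemma edge_maps e : exists gg : (orbit -> option orbit) * (orbit -> option orbit),
  (forall t t', gg.1 t = Some t' <-> step e (val t') (val t)) /\
  partial_inverse gg.1 gg.2.
Proof.
have [g gP] : exists g : orbit -> option orbit,
    forall t t', g t = Some t' <-> step e (val t') (val t).
  apply: exists_partial_fun => t t1 t2 s1 s2.
  by apply: val_inj; exact: step_tail_unique s1 s2.
have [g' gP'] : exists g : orbit -> option orbit,
    forall t' t, g t' = Some t <-> step e (val t') (val t).
  apply: exists_partial_fun => t t1 t2 s1 s2.
  by apply: val_inj; exact: step_cons_unique s1 s2.
by exists (g, g'); split=> //= t t'; rewrite gP gP'.
Qed.

Definition tl e := (sval (cid (edge_maps e))).1.
Definition cn e := (sval (cid (edge_maps e))).2.

Lemma tlP e t t' : tl e t = Some t' <-> step e (val t') (val t).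
Proof. by rewrite /tl; case: cid => gg /= [h _]. Qed.

Fact tlK e : partial_inverse (tl e) (cn e).
Proof. by rewrite /tl /cn; case: cid => gg /= []. Qed.

Lemma tl_hd e t t' : tl e t = Some t' -> hd t = Some e.
Proof. by move=> /tlP[]. Qed.

Lemma hd_tl e t : hd t = Some e -> exists t', tl e t = Some t'.
Proof.
move=> /exists_step_tail[y' sy]; have y'o : `[< boundary_equiv x0 y' >].
  by rewrite (orbit_step sy); exact: (valP t).
by exists (Sub y' y'o); apply/tlP.
Qed.

Lemma cn_org e t t' : cn e t' = Some t -> org t' = terminus e.
Proof. by move=> /tlK/tlP[]. Qed.

Lemma org_cn e t' : org t' = terminus e -> exists t, cn e t' = Some t.
Proof.
move=> te; have [y sy] := @exists_step_cons E e (val t') te; have yo : `[< boundary_equiv x0 y >].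
  by rewrite -(orbit_step sy); exact: (valP t').
by exists (Sub y yo); apply/tlK/tlP.
Qed.

Lemma hd_org e t : hd t = Some e -> org t = origin e.
Proof. exact: bedge_origin. Qed.

Definition vertex_op v : bop (ell2 R orbit) := sel_bop (fun t => org t == v).
Definition edge_op e : bop (ell2 R orbit) := pull_bop R (tlK e).

Lemma vertex_opE v x t : vertex_op v x t = if org t == v then x t else 0.
Proof. exact: sel_bopE. Qed.

Lemma edge_opE e x t t' : tl e t = Some t' -> edge_op e x t = x t'.
Proof. by rewrite pull_bopE => ->. Qed.

Lemma edge_op0 e x t : hd t != Some e -> edge_op e x t = 0.
Proof.
by rewrite pull_bopE; case te : (tl e t) => [t'|]//; rewrite (tl_hd te) eqxx.
Qed.

Lemma edge_adjE e x t t' : tl e t = Some t' -> bop_adj (edge_op e) x t' = x t.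
Proof. by move=> /tlK; rewrite pull_bop_adjE => ->. Qed.

Lemma edge_adj0 e x t' : org t' != terminus e -> bop_adj (edge_op e) x t' = 0.
Proof.
by rewrite pull_bop_adjE; case te : (cn e t') => [t|]//; rewrite (cn_org te) eqxx.
Qed.

Lemma edge_rangeE e x t :
  edge_op e (bop_adj (edge_op e) x) t = if hd t == Some e then x t else 0.
Proof.
case: ifPn => [/eqP/hd_tl[t' tt']|he]; last exact: edge_op0.
by rewrite (edge_opE _ tt') (edge_adjE _ tt').
Qed.

Lemma edge_sourceE e x t' :
  bop_adj (edge_op e) (edge_op e x) t' = if org t' == terminus e then x t' else 0.
Proof.
case: ifPn => [/eqP/org_cn[t /tlK tt']|te]; last exact: edge_adj0.
by rewrite (edge_adjE _ tt') (edge_opE _ tt').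
Qed.

Let hd_in (l : seq (edge E)) t := if hd t is Some e then e \in l else false.

Let sum_rangeE (l : seq (edge E)) x t : uniq l ->
  (\sum_(e <- l) cmul (edge_op e) (cstar (edge_op e))) x t = if hd_in l t then x t else 0.
Proof.
move=> ul; rewrite bop_sumE ell2_sumE (eq_bigr (fun e => if hd t == Some e then x t else 0)).
  rewrite /hd_in; case: (hd t) => [f|]; last by rewrite big1.
  rewrite -(sum_single f (fun=> x t) ul); apply: eq_bigr => e _.
  by rewrite eq_sym.
by move=> e _; exact: edge_rangeE.
Qed.

Let hd_in_org v (l : seq (edge E)) t : {in l, forall e, origin e = v} ->
  hd_in l t -> org t == v.
Proof. by move=> lv; rewrite /hd_in; case ht: (hd t) => [e|]// /lv <-; rewrite (hd_org ht). Qed.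

Lemma boundary_CK_family : CK_family vertex_op edge_op.
Proof.
split.
- move=> v; split; last exact: sel_bop_adj.
  apply: bop_eqP => x; apply: ell2_eqP => t.
  by rewrite cmul_bopE !vertex_opE; case: (org t == v).
- move=> v w vw; apply: bop_eqP => x; apply: ell2_eqP => t.
  rewrite cmul_bopE !vertex_opE; case: ifP => // /eqP->.
  by rewrite (negPf vw).
- move=> e; apply: bop_eqP => x; apply: ell2_eqP => t.
  rewrite !cmul_bopE cstar_bopE edge_rangeE; case: ifPn => // he.
  by rewrite edge_op0.
- move=> e; apply: bop_eqP => x; apply: ell2_eqP => t.
  by rewrite cmul_bopE cstar_bopE edge_sourceE vertex_opE.
- move=> v F fF Fv.
  rewrite /cle (fsbig_finite _ _ fF)/=; set l := enum_fset _.
  have ul : uniq l by exact: fset_uniq.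
  have lv : {in l, forall e, origin e = v}.
    by move=> e; rewrite in_fset_set// inE => /Fv.
  (* The difference is the projection onto the paths from [v] whose first edge is not in [F], hence
     its own positive square root. *)
  exists (sel_bop (fun t => (org t == v) && ~~ hd_in l t)).
  apply: bop_eqP => x; apply: ell2_eqP => t.
  rewrite cmul_bopE cstar_bopE sel_bop_adj bopBE ell2BE sum_rangeE// vertex_opE !sel_bopE.
  have := @hd_in_org v l t lv; case: (hd_in l t) => [->//|_]; rewrite ?subrr//.
  by rewrite subr0 andbT; case: ifP.
- move=> v nv; have fv : finite_set (emits v).
    by apply: contrapT => fv; apply: nv; right.
  rewrite (fsbig_finite _ _ fv)/=; set l := enum_fset _.
  have ul : uniq l by exact: fset_uniq.
  have lP e : (e \in l) = (origin e == v).
    by rewrite in_fset_set//; apply/idP/eqP; rewrite inE.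
  apply: bop_eqP => x; apply: ell2_eqP => t; rewrite sum_rangeE// vertex_opE.
  suff -> : hd_in l t = (org t == v) by [].
  rewrite /hd_in; case ht: (hd t) => [e|]; first by rewrite lP (hd_org ht).
  (* A boundary path without a first edge sits at a singular vertex; this is why finite boundary
     paths must end at such vertices. *)
  by apply/esym/negP => /eqP ov; apply: nv; rewrite -ov; exact: bedge_singular.
Qed.

Lemma edge_delta e t t' : tl e t = Some t' -> edge_op e (delta R t') = delta R t.
Proof.
move=> tt'; apply: ell2_eqP => s; rewrite pull_bopE deltaE.
have [->|st] := eqVneq s t; first by rewrite tt' deltaE eqxx.
case es: (tl e s) => [s'|]//; rewrite deltaE; case: eqP => // s't'.
move: es; rewrite s't' => /tlK; move/tlK: tt' => -> [ts].
by rewrite ts eqxx in st.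
Qed.

Lemma edge_adj_delta e t t' : tl e t = Some t' -> bop_adj (edge_op e) (delta R t) = delta R t'.
Proof.
move=> /[dup] /tlP[_ ot' _ _] tt'; rewrite -(edge_delta tt'); apply: ell2_eqP => s.
rewrite edge_sourceE deltaE; case: eqP => // /eqP os; case: eqP => // st'.
by rewrite st' -[org t']/(boundary_origin (val t')) ot' eqxx in os.
Qed.

Section Irreducibility.
Variables (A : cstarAlgType R) (p : vertex E -> A) (s : edge E -> A).
Variables (f : A -> bop (ell2 R orbit)) (f_hom : star_hom f).
Hypotheses (fp : forall v, f (p v) = vertex_op v) (fs : forall e, f (s e) = edge_op e).

Definition boundary_repr (a : A) : {linear ell2 R orbit -> ell2 R orbit} := f a.

Lemma boundary_representation : representation boundary_repr.
Proof.
split=> [a|c a b x|a b x|a x y].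
- exact: bop_continuous.
- by rewrite /boundary_repr (star_hom_linear f_hom).
- by rewrite /boundary_repr (star_homM f_hom).
- by rewrite /boundary_repr (star_hom_star f_hom) cstar_bopE bop_adjP.
Qed.

Definition diagonal P := exists a, forall x t, f a x t = if P t then x t else 0.

Lemma diagonal_vertex v : diagonal (fun t => org t == v).
Proof. by exists (p v) => x t; rewrite fp vertex_opE. Qed.

Lemma diagonal_edge e : diagonal (fun t => hd t == Some e).
Proof.
exists (cmul (s e) (cstar (s e))) => x t.
by rewrite (star_homM f_hom) (star_hom_star f_hom) fs cmul_bopE cstar_bopE edge_rangeE.
Qed.

Lemma diagonalI P Q : diagonal P -> diagonal Q -> diagonal (predI P Q).
Proof.
move=> [a aP] [b bQ]; exists (cmul a b) => x t.
by rewrite (star_homM f_hom) cmul_bopE aP bQ /=; case: (P t); case: (Q t).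
Qed.

Lemma diagonalD P Q : diagonal P -> diagonal Q -> diagonal (predD P Q).
Proof.
move=> [a aP] [b bQ]; exists (a - cmul b a) => x t.
have -> : f (a - cmul b a) = f a - f (cmul b a).
  by rewrite addrC -scaleN1r (star_hom_linear f_hom) scaleN1r addrC.
rewrite (star_homM f_hom) bopBE ell2BE cmul_bopE bQ aP /=.
by case: (P t); case: (Q t); rewrite ?subrr ?subr0.
Qed.

(** Conjugation by s_e moves a test from a path to what follows its first edge [e]. *)
Lemma diagonal_step P e : diagonal P ->
  diagonal (fun t => if tl e t is Some t' then P t' else false).
Proof.
move=> [a aP]; exists (cmul (s e) (cmul a (cstar (s e)))) => x t.
rewrite !(star_homM f_hom) (star_hom_star f_hom) fs !cmul_bopE cstar_bopE.
rewrite pull_bopE; case tt': (tl e t) => [t'|] //.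
by rewrite aP (edge_adjE _ tt').
Qed.

(** Induction on a position where the edges differ, for equal origins. At position 0 the first edge
    is tested, or its absence if [t] has none; otherwise a common first edge is removed by
    [diagonal_step]. *)
Lemma diagonal_separates t t' : t != t' -> exists2 P, diagonal P & P t && ~~ P t'.
Proof.
move=> tt'.
have [ott'|ott'] := eqVneq (org t) (org t'); last first.
  exists (fun u => org u == org t); first exact: diagonal_vertex.
  by rewrite eqxx eq_sym.
have [k tk] : exists k, bedge (val t) k <> bedge (val t') k.
  apply: contrapT => /forallNP h; move/eqP: tt'; apply; apply/val_inj/boundary_eq => // i.
  by apply: contrapT => hi; exact: (h i).
elim: k t t' {tt' ott'} tk => [|k IH] t t' tti.
  case ht : (hd t) => [e|].
    exists (fun t => hd t == Some e); first exact: diagonal_edge.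
    by rewrite ht eqxx /=; apply/eqP => ht'; apply: tti; rewrite -/(hd t) ht.
  case ht' : (hd t') => [e|]; last by case: tti; rewrite -/(hd t) ht -ht'.
  exists (predD (fun s => org s == org t) (fun t => hd t == Some e)).
    by apply: diagonalD; [exact: diagonal_vertex|exact: diagonal_edge].
  by rewrite /= ht ht' !eqxx.
case ht : (hd t) => [e|]; last first.
  case ht' : (hd t') => [e|].
    exists (predD (fun s => org s == org t) (fun t => hd t == Some e)).
      by apply: diagonalD; [exact: diagonal_vertex|exact: diagonal_edge].
    by rewrite /= ht ht' !eqxx.
  case: tti; move: ht ht'; rewrite /hd.
  case: (val t) (val t') => [//|q Hq] [//|q' Hq'] /=.
  by case: (fpath_edges q) (fpath_edges q') => // -[].
have [t1 tt1] := hd_tl ht.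
case: (eqVneq (hd t') (Some e)) => [ht'|ht']; last first.
  exists (fun t => hd t == Some e); first exact: diagonal_edge.
  by rewrite ht eqxx.
have [t1' tt1'] := hd_tl ht'.
have [|P dP Pt] := IH t1 t1'.
  move: tti; have [_ _ _ ->] := (tlP e t t1).1 tt1.
  by have [_ _ _ ->] := (tlP e t' t1').1 tt1'.
exists (fun t => if tl e t is Some t' then P t' else false).
  exact: diagonal_step.
by rewrite tt1 tt1'.
Qed.

Lemma diagonal_isolates t (l : seq orbit) : t \notin l ->
  exists2 P, diagonal P & P t && all (predC P) l.
Proof.
elim: l => [|u l IH] /=.
  by exists (fun u => org u == org t); [exact: diagonal_vertex|rewrite eqxx].
rewrite inE negb_or => /andP[tu /IH[P dP /andP[Pt Pl]]].
have [Q dQ /andP[Qt Qu]] := diagonal_separates tu.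
exists (predI P Q); first exact: diagonalI.
rewrite /= Pt Qt (negPf Qu) andbF /=.
by apply/allP => w /(allP Pl) /= /negPf->.
Qed.

Lemma boundary_irreducible : irreducible boundary_repr.
Proof.
split.
  have x0o : `[< boundary_equiv x0 x0 >] by apply/asboolP/boundary_equiv_refl.
  pose t : orbit := Sub x0 x0o.
  exists (p (org t)), (delta R t); apply/eqP => /(congr1 (fun x : ell2 R orbit => x t)).
  by rewrite /boundary_repr fp vertex_opE eqxx deltaE eqxx => /eqP; rewrite oner_eq0.
move=> V clV V0 VL Vinv; have cV : closed_subspace V by [].
have [|nV] := pselect (exists x, V x /\ x != 0); last first.
  left; apply/seteqP; split=> x /= => [Vx|->//].
  by apply: contrapT => /eqP x0'; apply: nV; exists x.
move=> [x [Vx xn0]]; right; apply: delta_total => //.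
have [t0 xt0] : exists t, x t != 0.
  apply: contrapT => /forallNP h; move/eqP: xn0; apply; apply: ell2_eqP => t.
  by apply: contrapT => /eqP; exact: h.
(* A diagonal projection that keeps [t0] and drops the other significant coordinates of y = x /
   x(t0) maps [y] close to the basis vector at [t0]; closedness of [V] does the rest. *)
have Vt0 : V (delta R t0).
  move/closed_rnormP: (clV); apply => e e0.
  pose y : ell2 R orbit := (x t0)^-1 *: x.
  have Vy : V y by exact: subspaceZ.
  have yt0 : y t0 = 1 by rewrite ell2ZE mulVf.
  have [l lP] := ell2_tail y e0.
  have [|P [a aP] /andP[Pt0 Pl]] := @diagonal_isolates t0 [seq t <- l | t != t0].
    by rewrite mem_filter eqxx.
  exists (f a y); first exact: (Vinv a y Vy).
  rewrite rnormC; apply: lP => t; rewrite ell2BE aP deltaE.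
    move=> tl; case: eqVneq => [->|tt0]; first by rewrite Pt0 yt0 subrr.
    have /negPf-> : ~~ P t by apply: (allP Pl); rewrite mem_filter tt0.
    by rewrite subr0.
  case: eqVneq => [->|tt0]; first by left; rewrite Pt0 yt0 subrr.
  by rewrite subr0; case: (P t); [right|left].
(* The edge operators and their adjoints carry basis vectors along [step] in both directions, so one
   basis vector in [V] brings in the whole class. *)
pose Phi z := forall t : orbit, val t = z -> V (delta R t).
suff h : forall t : orbit, Phi (val t) by move=> t; exact: (h t).
move=> w; apply: (@boundary_equiv_ind E Phi _ x0 (val t0)).
- move=> e y' y sy; split=> Phiy t ty; rewrite -ty in sy.
    have y'o : `[< boundary_equiv x0 y' >] by rewrite (orbit_step sy); exact: (valP t).
    have tt' : tl e t = Some (Sub y' y'o) by apply/tlP.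
    rewrite -(edge_delta tt') -fs; apply: (Vinv (s e)).
    exact: Phiy.
  have yo : `[< boundary_equiv x0 y >] by rewrite -(orbit_step sy); exact: (valP t).
  have tt' : tl e (Sub y yo) = Some t by apply/tlP.
  rewrite -(edge_adj_delta tt') -fs -cstar_bopE -(star_hom_star f_hom).
  by apply: (Vinv (cstar (s e))); exact: Phiy.
- exact/asboolP/(valP t0).
- exact/asboolP/(valP w).
- by move=> t' /val_inj->.
Qed.

End Irreducibility.

(** Distinct basis vectors are at distance at least 1, so each ball of radius 1/2 of a finite net
    for the image of the unit ball contains at most one of those fixed by p_v. *)
Lemma tboperator_vertex_finite v : tboperator (vertex_op v) ->
  finite_set [set y | boundary_equiv x0 y /\ boundary_origin y = v].
Proof.
move=> /tboperatorP/(_ (1 / 2))[|l lP]; first by rewrite divr_gt0.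
pose near_delta y t := org t = v /\ rnorm (delta R t - y) < 1 / 2.
have near_unique y t u : near_delta y t -> near_delta y u -> t = u.
  move=> [_ ty] [_ uy]; apply/eqP; apply: contraT => /(@rnorm_delta_sub R) tu.
  rewrite rnormC in uy.
  have := le_lt_trans (rnorm_tri _ y _) (ltrD ty uy).
  by rewrite -splitr ltNge tu.
have /choice[d dP] y : exists z, forall t, near_delta y t -> z = val t.
  have [[t yt]|nt] := pselect (exists t, near_delta y t).
    by exists (val t) => u yu; rewrite (near_unique y t u).
  by exists x0 => t yt; case: nt; exists t.
apply: (@sub_finite_set _ _ (d @` [set` l])); last exact/finite_image/finite_seq.
move=> z [xz zv]; have zo : `[< boundary_equiv x0 z >] by exact/asboolP.
pose t : orbit := Sub z zo; have [y yl ty] := lP _ (rnorm_delta_le1 R t).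
exists y; first exact: yl.
apply: (dP y t); split; first exact: zv.
suff <- : vertex_op v (delta R t) = delta R t by [].
apply: ell2_eqP => u; rewrite vertex_opE deltaE; case: eqP => // ou.
by case: eqP => // ut; case: ou; rewrite ut.
Qed.

End BoundaryRepresentation.

Lemma liminal_condition_M (R : realType) (E : digraph) (A : cstarAlgType R)
    (p : vertex E -> A) (s : edge E -> A) (hA : graph_algebra p s) :
  liminal A -> condition_M E.
Proof.
move=> hlim x v.
have [f f_hom [fp fs]] := graph_algebra_universal hA (boundary_CK_family R x).
apply: (@tboperator_vertex_finite R).
have := hlim _ _ (boundary_representation f_hom) (boundary_irreducible f_hom fp fs) (p v).
by move=> /compact_operatorP; rewrite /boundary_repr fp.
Qed.

Theorem theorem5p5 (R : realType) (E : digraph) (A : cstarAlgType R)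
    (p : vertex E -> A) (s : edge E -> A) (hA : graph_algebra p s) :
  liminal A <-> condition_M E.
Proof.
split; first exact: liminal_condition_M hA.
exact: condition_M_liminal hA.
Qed.
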